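(* Let $\Omega$ be a star graph with $n$ edges $\epsilon_i\cong[0,\ell_i]$, let $V_i\in L^1(0,\ell_i)$ be real-valued for $1\le i\le n$, and let $\Gamma=\{\alpha_1,\alpha_2,\beta_1,\beta_2\}$ be separated self-adjoint boundary conditions with $\beta_1,\beta_2$ diagonal. Let $s_1\in(0,\ell_j)$ be a non-vertex point of an edge $\epsilon_j$. Split $\Omega$ at $s_1$ into $\Omega_1$ (the interval $[s_1,\ell_j]$ of edge $\epsilon_j$) and $\Omega_2$ (the star graph obtained from $\Omega$ by replacing edge $\epsilon_j$ by $[0,s_1]$), with boundary conditions $\Gamma_1,\Gamma_2$ that agree with $\Gamma$ at the vertices shared with $\Omega$ and are Dirichlet at $s_1$. For $\lambda\in\mathbb R$ let $\mathcal N_X(\lambda)$ be the number of eigenvalues (counted with multiplicity) of an operator $X$ that are less than or equal to $\lambda$, and let $N(\lambda)$ be the difference between the number of zeros and the number of poles (counted with multiplicity) less than or equal to $\lambda$ of the two-sided map $M_1+M_2$ at $s_1$, regarded as a meromorphic function. Then $$\mathcal N_{H^\Omega_\Gamma}(\lambda)=\mathcal N_{H^{\Omega_1}_{\Gamma_1}}(\lambda)+\mathcal N_{H^{\Omega_2}_{\Gamma_2}}(\lambda)+N(\lambda).$$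
   Context: **Star graph and functions.** $\Omega$ has $n\ge1$ edges; edge $\epsilon_i$ has coordinate $x_i\in[0,\ell_i]$, $\ell_i>0$, where $x_i=0$ is the common vertex (origin) of all edges. A function on $\Omega$ is a vector $\vec u=(u_1,\dots,u_n)$ with $u_i$ a function of $x_i$; $\vec u'=(u_1',\dots,u_n')$; $\vec u(\vec 0)=(u_i(0))_i$ and $\vec u(\vec\ell)=(u_i(\ell_i))_i$. **Boundary conditions.** $\Gamma=\{\alpha_1,\alpha_2,\beta_1,\beta_2\}$ consists of complex $n\times n$ matrices with $\operatorname{rank}[\alpha_1\ \alpha_2]=\operatorname{rank}[\beta_1\ \beta_2]=n$, $\alpha_1\alpha_2^*=\alpha_2\alpha_1^*$, $\beta_1\beta_2^*=\beta_2\beta_1^*$, and $\beta_1=\operatorname{diag}(g_1,\dots,g_n)$, $\beta_2=\operatorname{diag}(h_1,\dots,h_n)$. A function $\vec u$ satisfies $\Gamma$ if $\alpha_1\vec u(\vec 0)+\alpha_2\vec u'(\vec 0)=\vec 0$ and $\beta_1\vec u(\vec\ell)+\beta_2\vec u'(\vec\ell)=\vec 0$. **Operators.** $H^\Omega=\operatorname{diag}(-\partial_{x_i}^2+V_i(x_i))$ is a differential expression. Solutions of $(H^\Omega-\lambda)\vec u=\vec 0$ are understood with $u_i,u_i'$ absolutely continuous on the closed edge and the equation holding a.e. $H^\Omega_\Gamma$ is the operator $\vec u\mapsto H^\Omega\vec u$ in $L^2(\Omega)=\bigoplus_iL^2(0,\ell_i)$ with domain the functions $\vec u$ satisfying $\Gamma$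 such that $u_i,u_i'$ are absolutely continuous and $-u_i''+V_iu_i\in L^2(0,\ell_i)$ (this is $u_i\in H^2(0,\ell_i)$ when $V_i\in L^2$). Its spectrum is discrete. $H^{\Omega_1},H^{\Omega_2}$ are the restrictions of $H^\Omega$ to the subgraphs, and $H^{\Omega_1}_{\Gamma_1},H^{\Omega_2}_{\Gamma_2}$ are defined in the same way from the boundary conditions below. $\rho(\cdot)$ denotes the resolvent set. **Subgraph boundary conditions.** $\Gamma_1$ on $\Omega_1=[s_1,\ell_j]$: $u(s_1)=0$ and $g_ju(\ell_j)+h_ju'(\ell_j)=0$. $\Gamma_2$ on $\Omega_2$: $\alpha_1\vec u(\vec 0)+\alpha_2\vec u'(\vec 0)=\vec 0$, $g_iu_i(\ell_i)+h_iu_i'(\ell_i)=0$ for $i\ne j$, and $u_j(s_1)=0$. **One-sided maps.** For $\lambda\in\rho(H^{\Omega_1}_{\Gamma_1})$, $M_1(\lambda)=-u'(s_1,\lambda)/u(s_1,\lambda)$, equivalently $M_1(\lambda)f=-u'(s_1)$, where $u$ is the unique solution of $(H^{\Omega_1}-\lambda)u=0$ with $u(s_1)=f$ that satisfies the $\Gamma_1$ condition at $\ell_j$. For $\lambda\in\rho(H^{\Omega_2}_{\Gamma_2})$, $M_2(\lambda)f=u_j'(s_1)$, where $\vec u$ is the unique solution of $(H^{\Omega_2}-\lambda)\vec u=\vec 0$ with $u_j(s_1)=f$ that satisfies all other $\Gamma_2$ conditions. $M_1+M_2$ is the two-sided map at $s_1$; it extends to a meromorphic function of $\lambda\in\mathbb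 C$. *)

(* Defs.v *)
From HB Require Import structures.
From mathcomp Require Import all_boot all_order all_algebra.
From mathcomp Require Import complex.
From mathcomp Require Import all_classical all_reals all_analysis.

Set Implicit Arguments.
Unset Strict Implicit.
Unset Printing Implicit Defensive.
Import Order.TTheory GRing.Theory Num.Theory.
Import numFieldNormedType.Exports.

Local Open Scope classical_set_scope.
Local Open Scope ring_scope.

(* The disjointness condition concerns the open intervals ]s k, t k[. *)
Definition abs_cont (R : realType) (a b : R) (f : R -> R) : Prop :=
  forall e : R, 0 < e -> exists2 d : R, 0 < d &
    forall (m : nat) (s t : 'I_m -> R),
      (forall k, [/\ a <= s k, s k <= t k & t k <= b]) ->
      (forall k k', k != k' -> t k <= s k' \/ t k' <= s k) ->
      \sum_k (t k - s k) < d ->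
      \sum_k `|f (t k) - f (s k)| < e.

(* df is the derivative of f everywhere on the closed interval [a, b],
   one-sided at the endpoints. *)
Definition derivative_on (R : realType) (a b : R) (f df : R -> R) : Prop :=
  forall x, x \in `[a, b] ->
    (f y - f x) / (y - x) @[y --> within `[a, b] x^'] --> df x.

Definition abs_contC (R : realType) (a b : R) (f : R -> R[i]) : Prop :=
  abs_cont a b (@complex.Re R \o f) /\ abs_cont a b (@complex.Im R \o f).

Definition derivative_onC (R : realType) (a b : R) (f df : R -> R[i]) : Prop :=
  derivative_on a b (@complex.Re R \o f) (@complex.Re R \o df) /\
  derivative_on a b (@complex.Im R \o f) (@complex.Im R \o df).

Definition is_deriveC (R : realType) (f : R -> R[i]) (x : R) (z : R[i]) : Prop :=
  is_derive x 1 (@complex.Re R \o f) (complex.Re z) /\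
  is_derive x 1 (@complex.Im R \o f) (complex.Im z).

Definition sqnormC (R : realType) (z : R[i]) : R :=
  complex.Re z ^+ 2 + complex.Im z ^+ 2.

Definition square_integrable (R : realType) (a b : R) (f : R -> R[i]) : Prop :=
  [/\ measurable_fun `]a, b[%classic (@complex.Re R \o f),
      measurable_fun `]a, b[%classic (@complex.Im R \o f) &
      (\int[@lebesgue_measure R]_(x in `]a, b[%classic) (sqnormC (f x))%:E
         < +oo)%E].

(* Edge i is the interval [vertex i, tip i]; the points x_i = vertex i are the
   ends of the edges that meet at the common vertex.  The offset is needed to
   see [s, l_j] as a graph with one edge. *)
Record star_graph (R : realType) (n : nat) := StarGraph {
  vertex : 'I_n -> R;
  tip : 'I_n -> R;
  potential : 'I_n -> R -> R
}.

(* A function on the graph; only the values of u i on the closed edge i are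
   meaningful. *)
Definition graph_fun (R : realType) (n : nat) := 'I_n -> R -> R[i].

Definition eq_on_graph (R : realType) (n : nat) (G : star_graph R n)
    (u v : graph_fun R n) : Prop :=
  forall i x, x \in `[vertex G i, tip G i] -> u i x = v i x.

Definition in_L2 (R : realType) (n : nat) (G : star_graph R n)
    (f : graph_fun R n) : Prop :=
  forall i, square_integrable (vertex G i) (tip G i) (f i).

Definition L2_sqnorm (R : realType) (n : nat) (G : star_graph R n)
    (f : graph_fun R n) : \bar R :=
  (\sum_(i < n) \int[@lebesgue_measure R]_(x in `]vertex G i, tip G i[%classic)
     (sqnormC (f i x))%:E)%E.

(* - u'' + V u = f on every edge, where du = u'. *)
Definition diff_expr (R : realType) (n : nat) (G : star_graph R n)
    (u du f : graph_fun R n) : Prop :=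
  forall i,
    [/\ abs_contC (vertex G i) (tip G i) (u i),
        derivative_onC (vertex G i) (tip G i) (u i) (du i),
        abs_contC (vertex G i) (tip G i) (du i) &
        {ae @lebesgue_measure R, forall x, x \in `]vertex G i, tip G i[ ->
          exists2 ddu : R[i], is_deriveC (du i) x ddu &
            - ddu + (potential G i x)%:C%C * u i x = f i x}].

(* (H - lam) u = 0, without boundary conditions. *)
Definition solution (R : realType) (n : nat) (G : star_graph R n) (lam : R[i])
    (u du : graph_fun R n) : Prop :=
  diff_expr G u du (fun i x => lam * u i x).

Record boundary_cond (R : realType) (n : nat) := BoundaryCond {
  alpha1 : 'M[R[i]]_n;
  alpha2 : 'M[R[i]]_n;
  beta1 : 'M[R[i]]_n;
  beta2 : 'M[R[i]]_n
}.

Definition vertex_cond (R : realType) (n : nat) (G : star_graph R n)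
    (B : boundary_cond R n) (u du : graph_fun R n) : Prop :=
  alpha1 B *m (\col_i u i (vertex G i)) +
  alpha2 B *m (\col_i du i (vertex G i)) = 0.

Definition tip_cond (R : realType) (n : nat) (G : star_graph R n)
    (B : boundary_cond R n) (u du : graph_fun R n) : Prop :=
  beta1 B *m (\col_i u i (tip G i)) +
  beta2 B *m (\col_i du i (tip G i)) = 0.

Definition self_adjoint_bc (R : realType) (n : nat)
    (B : boundary_cond R n) : Prop :=
  [/\ \rank (row_mx (alpha1 B) (alpha2 B)) = n,
      \rank (row_mx (beta1 B) (beta2 B)) = n,
      alpha1 B *m map_mx Num.conj (alpha2 B)^T =
        alpha2 B *m map_mx Num.conj (alpha1 B)^T &
      beta1 B *m map_mx Num.conj (beta2 B)^T =
        beta2 B *m map_mx Num.conj (beta1 B)^T].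

(* The graph of the operator H_B: u belongs to its domain and H_B u = f. *)
Definition operator (R : realType) (n : nat) (G : star_graph R n)
    (B : boundary_cond R n) (u f : graph_fun R n) : Prop :=
  in_L2 G f /\
  exists du, [/\ diff_expr G u du f, vertex_cond G B u du & tip_cond G B u du].

(* u belongs to the domain of H_B and (H_B - lam) u = f. *)
Definition shifted_operator (R : realType) (n : nat) (G : star_graph R n)
    (B : boundary_cond R n) (lam : R[i]) (u f : graph_fun R n) : Prop :=
  operator G B u (fun i x => f i x + lam * u i x).

(* H_B - lam is a bijection from its domain onto L^2 with bounded inverse. *)
Definition resolvent_set (R : realType) (n : nat) (G : star_graph R n)
    (B : boundary_cond R n) : set R[i] :=
  [set lam | exists c : R, forall f, in_L2 G f ->
    exists u, [/\ shifted_operator G B lam u f,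
      (L2_sqnorm G u <= c%:E * L2_sqnorm G f)%E &
      forall v, shifted_operator G B lam v f -> eq_on_graph G v u]].

(* The linear space S of functions on the graph has dimension m. *)
Definition has_dim (R : realType) (n : nat) (G : star_graph R n)
    (S : set (graph_fun R n)) (m : nat) : Prop :=
  exists2 phi : 'I_m -> graph_fun R n, (forall k, S (phi k)) &
    forall u, S u -> exists! c : 'rV[R[i]]_m,
      eq_on_graph G u (fun i x => \sum_k c 0 k * phi k i x).

(* The multiplicity of mu as an eigenvalue is the dimension of ker (H_B - mu);
   it is 0 when mu is not an eigenvalue. *)
Definition eigen_mult (R : realType) (n : nat) (G : star_graph R n)
    (B : boundary_cond R n) (mu : R) (m : nat) : Prop :=
  has_dim G [set u | shifted_operator G B mu%:C%C u (fun _ _ => 0)] m.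

Definition holomorphic_at (R : realType) (f : R[i] -> R[i]) (z : R[i]) : Prop :=
  \forall w \near (z : R[i]^o), derivable (f : R[i]^o -> R[i]^o) w 1.

(* f has a zero of order k at z if k >= 0, and a pole of order -k if k < 0. *)
Definition has_order (R : realType) (f : R[i] -> R[i]) (z : R[i]) (k : int)
    : Prop :=
  exists g : R[i] -> R[i], [/\ holomorphic_at g z, g z != 0 &
    \forall w \near (z : R[i]^o)^', f w = (w - z) ^ k * g w].

(* At its poles the value of f is irrelevant. *)
Definition meromorphic (R : realType) (f : R[i] -> R[i]) : Prop :=
  forall z, holomorphic_at f z \/ exists2 k : int, k < 0 & has_order f z k.

Definition zero_mult (R : realType) (f : R[i] -> R[i]) (mu : R) (m : nat)
    : Prop :=
  exists2 k : int, has_order f mu%:C%C k & m = if 0 <= k then absz k else 0%N.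

Definition pole_mult (R : realType) (f : R[i] -> R[i]) (mu : R) (m : nat)
    : Prop :=
  exists2 k : int, has_order f mu%:C%C k & m = if k <= 0 then absz k else 0%N.

(* There are finitely many mu <= lam of nonzero multiplicity, and N of them
   when each is counted with its multiplicity. *)
Definition count_le (R : realType) (is_mult : R -> nat -> Prop) (lam : R)
    (N : nat) : Prop :=
  exists m : R -> nat,
    [/\ forall mu, mu <= lam -> is_mult mu (m mu),
        finite_set [set mu | mu <= lam /\ m mu != 0%N] &
        N = \sum_(mu \in [set mu | mu <= lam]) m mu].

Definition Omega (R : realType) (n : nat) (l : 'I_n -> R)
    (V : 'I_n -> R -> R) : star_graph R n :=
  StarGraph (fun=> 0) l V.

Definition Omega1 (R : realType) (n : nat) (l : 'I_n -> R)
    (V : 'I_n -> R -> R) (j : 'I_n) (s : R) : star_graph R 1 :=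
  StarGraph (fun=> s) (fun=> l j) (fun=> V j).

Definition Omega2 (R : realType) (n : nat) (l : 'I_n -> R)
    (V : 'I_n -> R -> R) (j : 'I_n) (s : R) : star_graph R n :=
  StarGraph (fun=> 0) (fun i => if i == j then s else l i) V.

Definition Gamma (R : realType) (n : nat) (a1 a2 : 'M[R[i]]_n)
    (g h : 'rV[R[i]]_n) : boundary_cond R n :=
  BoundaryCond a1 a2 (diag_mx g) (diag_mx h).

(* u(s) = 0 and g_j u(l_j) + h_j u'(l_j) = 0. *)
Definition Gamma1 (R : realType) (n : nat) (g h : 'rV[R[i]]_n) (j : 'I_n)
    : boundary_cond R 1 :=
  BoundaryCond 1%:M 0 (g 0 j)%:M (h 0 j)%:M.

(* The condition of Gamma at the common vertex, u_j(s) = 0, and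
   g_i u_i(l_i) + h_i u_i'(l_i) = 0 for i <> j. *)
Definition Gamma2 (R : realType) (n : nat) (a1 a2 : 'M[R[i]]_n)
    (g h : 'rV[R[i]]_n) (j : 'I_n) : boundary_cond R n :=
  BoundaryCond a1 a2
    (diag_mx (\row_i (if i == j then 1 else g 0 i)))
    (diag_mx (\row_i (if i == j then 0 else h 0 i))).

(* The linear map M_1(lam) of C is identified with its scalar m; it is
   meaningful for lam in the resolvent set of the Dirichlet problem only, where
   the solution u is unique.  The same holds for M2. *)
Definition M1 (R : realType) (n : nat) (l : 'I_n -> R) (V : 'I_n -> R -> R)
    (g h : 'rV[R[i]]_n) (j : 'I_n) (s : R) (lam : R[i]) : R[i] :=
  xget 0 [set m | forall f : R[i], exists u du,
    [/\ solution (Omega1 l V j s) lam u du,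
        u ord0 s = f,
        g 0 j * u ord0 (l j) + h 0 j * du ord0 (l j) = 0 &
        - du ord0 s = m * f]].

Definition M2 (R : realType) (n : nat) (l : 'I_n -> R) (V : 'I_n -> R -> R)
    (a1 a2 : 'M[R[i]]_n) (g h : 'rV[R[i]]_n) (j : 'I_n) (s : R) (lam : R[i])
    : R[i] :=
  xget 0 [set m | forall f : R[i], exists u du,
    [/\ solution (Omega2 l V j s) lam u du,
        a1 *m (\col_i u i 0) + a2 *m (\col_i du i 0) = 0,
        forall i, i != j -> g 0 i * u i (l i) + h 0 i * du i (l i) = 0,
        u j s = f &
        du j s = m * f]].

(* F is the meromorphic extension to the whole plane of M_1 + M_2. *)
Definition two_sided_map (R : realType) (n : nat) (l : 'I_n -> R)
    (V : 'I_n -> R -> R) (a1 a2 : 'M[R[i]]_n) (g h : 'rV[R[i]]_n) (j : 'I_n)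
    (s : R) (F : R[i] -> R[i]) : Prop :=
  meromorphic F /\
  forall lam, resolvent_set (Omega1 l V j s) (Gamma1 g h j) lam ->
    resolvent_set (Omega2 l V j s) (Gamma2 a1 a2 g h j) lam ->
    F lam = M1 l V g h j s lam + M2 l V a1 a2 g h j s lam.

(* Main.v *)
(* On every edge let psi_i(., lam) be the solution of - u'' + V_i u = lam u whose
   data at the tip are (h_i, - g_i).  The functions satisfying all tip conditions
   are the (c_i psi_i)_i, so the eigenvalues are the zeros of the entire function
   D(lam) = det (a1 diag(psi_i(0)) + a2 diag(psi_i'(0))), and the resolvent set is
   its complement.  By the Lagrange identity a self-adjoint problem has no Jordan
   chains, so the order of a zero of D is the dimension of the eigenspace; in
   particular the zeros are real and isolated.  A Riccati comparison function
   shows that they are bounded below.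

   Let D0, D1, D2 belong to Omega, Omega_1, Omega_2.  Only the j-th columns of
   the matrices for Omega and Omega_2 differ, and on [0, s] the solution psi_j is
   a combination of the solutions with data (0, - 1) and (1, 0) at s.  Expanding
   the determinant along that column gives M_1 + M_2 = D0 / (D1 D2), hence the
   order of M_1 + M_2 at mu is the multiplicity of mu for Omega minus those for
   Omega_1 and Omega_2.  Summing over mu <= lam proves the formula. *)

Require Import Defs.
From mathcomp Require Import all_boot all_order all_algebra.
From mathcomp Require Import complex.
From mathcomp Require Import all_classical all_reals all_analysis.

From mathcomp Require Import measurable_realfun.
From mathcomp Require Import ring lra zify.

Set Implicit Arguments.
Unset Strict Implicit.
Unset Printing Implicit Defensive.
Import Order.TTheory GRing.Theory Num.Theory.
Import numFieldNormedType.Exports.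
Import Normc.

Local Open Scope classical_set_scope.
Local Open Scope ring_scope.

Notation Re := complex.Re.
Notation Im := complex.Im.

(** * Absolutely continuous functions *)

Section AbsCont.
Context {R : realType}.
Notation mu := (@lebesgue_measure R).
Implicit Types (a b x y : R) (f g h df dg : R -> R).

(** Since each [V i] is only integrable, the equation holds almost everywhere. Estimates and
    uniqueness therefore rest on one principle: an absolutely continuous function with almost
    everywhere nonnegative derivative is nondecreasing. [ac_deriv] pairs such functions with their
    derivatives.

    The order of a zero equals the nullity because [Amat w = Amat z + (w - z) Q(w)] holds exactly, Q
    being defined by the equation that difference quotients solve. The normal form of [Amat z] lets
    one factor [w - z] be taken out per dimension of the kernel. The remaining determinant vanishes
    at z only if some nonzero c in the kernel has Q(z) c in the range of [Amat z], that is, only if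
    there is a Jordan chain. The factorization holds for all w with an entire cofactor, so orders of
    quotients can be read off.

    M_1 and M_2 are prescribed on resolvent sets only, and these ask for a bounded inverse. Relating
    them to the zeros of D therefore takes an explicit resolvent and an estimate by the L^2 norm of
    the source. *)

Definition ac_deriv a b f df : Prop :=
  abs_cont a b f /\
  {ae mu, forall x, x \in `]a, b[ -> is_derive x 1 f (df x)}.

Lemma abs_cont_sub a b a' b' f : a <= a' -> b' <= b ->
  abs_cont a b f -> abs_cont a' b' f.
Proof.
move=> aa bb acf e e0; have [d d0 H] := acf e e0; exists d => // m s t st dj.
apply: H => // k; have [h1 h2 h3] := st k; split=> //.
  exact: le_trans h1.
exact: le_trans bb.
Qed.

(** One epsilon-delta argument serves all the closure properties below: each of them only has to
    bound increments. *)
Lemma abs_cont_dom a b f g h (C : R) :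
  (forall x y, a <= x -> x <= y -> y <= b ->
     `|h y - h x| <= C * (`|f y - f x| + `|g y - g x|)) ->
  abs_cont a b f -> abs_cont a b g -> abs_cont a b h.
Proof.
move=> H acf acg e e0.
pose C' := `|C| + 1.
have C'0 : 0 < C' by rewrite ltr_wpDl.
pose e' := e / (2 * C').
have e'0 : 0 < e' by rewrite divr_gt0// mulr_gt0.
have [d1 d10 H1] := acf e' e'0; have [d2 d20 H2] := acg e' e'0.
exists (Num.min d1 d2); first by rewrite lt_min d10.
move=> m s t st dj; rewrite lt_min => /andP[s1 s2].
have := H1 m s t st dj s1; have := H2 m s t st dj s2.
set S1 := \sum_k _; set S2 := \sum_k _ => h1 h2.
have -> : e = C' * (e' + e').
  by rewrite /e'; field; rewrite lt0r_neq0.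
apply: (@le_lt_trans _ _ (C' * (S2 + S1))).
  rewrite /S1 /S2 -big_split/= mulr_sumr; apply: ler_sum => k _.
  have [a1 a2 a3] := st k.
  apply: le_trans (H _ _ a1 a2 a3) _.
  apply: ler_wpM2r; first by rewrite addr_ge0.
  by rewrite (le_trans (ler_norm _))// lerDl.
by rewrite ltr_pM2l// ltrD.
Qed.

Lemma abs_cont_cst a b (c : R) : abs_cont a b (fun=> c).
Proof.
move=> e e0; exists 1 => // m s t _ _ _.
by under eq_bigr do rewrite subrr normr0; rewrite big1.
Qed.

Lemma abs_cont_id a b : abs_cont a b id.
Proof.
move=> e e0; exists e => // m s t st _.
apply: le_lt_trans; apply: ler_sum => k _.
by rewrite ger0_norm// subr_ge0; have [] := st k.
Qed.

Lemma abs_cont_eps a b f : abs_cont a b f -> forall e : R, 0 < e ->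
  exists2 d : R, 0 < d & forall x y, a <= x -> x <= b -> a <= y -> y <= b ->
    `|y - x| < d -> `|f y - f x| < e.
Proof.
move=> acf e e0; have [d d0 H] := acf e e0; exists d => //.
suff W x y : a <= x -> y <= b -> x <= y -> `|y - x| < d -> `|f y - f x| < e.
  move=> x y ax xb ay yb xy; have [le|/ltW le] := leP x y; first exact: W.
  by rewrite distrC; apply: W => //; rewrite distrC.
move=> ax yb xy xyd.
have := H 1%N (fun=> x) (fun=> y); rewrite !big_ord1; apply => //.
  by move=> k k'; rewrite !ord1.
by rewrite -(@ger0_norm _ (y - x))// subr_ge0.
Qed.


Lemma abs_cont_continuous a b f : abs_cont a b f ->
  {in `]a, b[, continuous f}.
Proof.
move=> acf x; rewrite in_itv/= => /andP[ax xb].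
apply/cvgrPdist_lt => e e0; have [d d0 H] := abs_cont_eps acf e0.
have xab : x \in `]a, b[ by rewrite in_itv/= ax.
have H1 : \forall t \near x, t \in `]a, b[ by exact: near_in_itvoo.
near=> t.
have : t \in `]a, b[ by near: t.
rewrite in_itv/= => /andP[/ltW at_ /ltW tb].
rewrite distrC; apply: H => //; rewrite ?(ltW ax) ?(ltW xb)// distrC.
Unshelve. all: by end_near. Qed.

(** Compactness of [[a, b]] as an induction principle for properties of intervals. It yields
    boundedness, monotonicity and the finiteness of the spectrum below a level. *)
Lemma interval_additive (a b : R) (Q : R -> R -> Prop) : a <= b ->
  (forall s t r, a <= s -> s <= t -> t <= r -> r <= b ->
     Q s t -> Q t r -> Q s r) ->
  (forall x, a <= x -> x <= b -> exists2 d, 0 < d &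
     forall s t, a <= s -> t <= b -> s <= x -> x <= t -> x - s < d ->
       t - x < d -> Q s t) ->
  Q a b.
Proof.
move=> ab Qadd Qloc.
pose S := [set x | a <= x <= b /\ Q a x].
have Sa : S a.
  split; first by rewrite lexx.
  have [d d0 H] := Qloc a (lexx a) ab.
  by apply: H => //; rewrite subrr.
have bS : ubound S b by move=> x [/andP[]].
have supS : has_sup S by split; [exists a|exists b].
set c := sup S.
have ac : a <= c by apply: ub_le_sup => //; exists b.
have cb : c <= b by apply: ge_sup => //; exists a.
have [d d0 H] := Qloc c ac cb.
have [x [/andP[ax xb] Qx] cx] := sup_adherent d0 supS.
have xc : x <= c by apply: ub_le_sup; [exists b|split=> //; rewrite ax].
(* The local property at the supremum [c] carries [S] past [c], unless the minimum is [b]. *)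
pose t := Num.min b (c + d / 2).
have ct : c <= t by rewrite le_min cb/= lerDl ltW// divr_gt0.
have Qt : Q a t.
  apply: (Qadd a x t) => //; rewrite ?ge_min ?lexx//.
    exact: le_trans ct.
  apply: H => //; rewrite ?ge_min ?lexx//; first by rewrite ltrBlDl -ltrBlDr.
  rewrite ltrBlDl gt_min ltrD2l.
  by apply/orP; right; rewrite ltr_pdivrMr// ltr_pMr// ltr1n.
have [bt|tb] := leP b (c + d / 2).
  by move: Qt; rewrite /t (min_idPl bt).
have : c + d / 2 <= c.
  apply: ub_le_sup; first by exists b.
  split; last by move: Qt; rewrite /t (min_idPr (ltW tb)).
  by rewrite (ltW tb) andbT (le_trans ac)// lerDl ltW// divr_gt0.
by rewrite gerDl leNgt divr_gt0.
Qed.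

Lemma abs_cont_bounded a b f : abs_cont a b f ->
  exists2 M : R, 0 <= M & forall x, a <= x -> x <= b -> `|f x| <= M.
Proof.
move=> acf; have [ab|ba] := leP a b; last first.
  exists 0 => // x ax xb; have := le_lt_trans (le_trans ax xb) ba.
  by rewrite ltxx.
suff [M HM] : exists M, forall x, a <= x -> x <= b -> `|f x| <= M.
  by exists M => //; rewrite (le_trans _ (HM a _ _)).
apply: (@interval_additive a b
  (fun s t => exists M, forall x, s <= x -> x <= t -> `|f x| <= M)) => //.
  move=> s t r _ st tr _ [M1 H1] [M2 H2]; exists (Num.max M1 M2) => x sx xr.
  rewrite le_max; have [xt|/ltW tx] := leP x t; first by rewrite H1.
  by rewrite H2// orbT.
move=> x ax xb; have [d d0 H] := abs_cont_eps acf ltr01; exists d => //.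
move=> s t as_ tb sx xt xs tx; exists (1 + `|f x|) => y sy yt.
rewrite -[f y](subrK (f x)) (le_trans (ler_normD _ _))// lerD2r ltW//.
apply: H => //; first by rewrite (le_trans as_).
  by rewrite (le_trans yt).
have [yx|yx] := leP y x; rewrite ltr_norml; apply/andP; split; lra.
Qed.

Lemma abs_contD a b f g : abs_cont a b f -> abs_cont a b g ->
  abs_cont a b (f + g).
Proof.
move=> acf acg; apply: (@abs_cont_dom a b f g _ 1) => // x y _ _ _.
rewrite mul1r /= opprD addrACA ler_normD//.
Qed.

Lemma abs_cont_lip a b f h (C : R) :
  (forall x y, a <= x -> x <= y -> y <= b ->
     `|h y - h x| <= C * `|f y - f x|) ->
  abs_cont a b f -> abs_cont a b h.
Proof.
move=> H acf; apply: (@abs_cont_dom a b f (fun=> 0) _ C) => //.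
  by move=> x y ax xy yb; rewrite subrr normr0 addr0 H.
exact: abs_cont_cst.
Qed.

Lemma abs_contN a b f : abs_cont a b f -> abs_cont a b (- f).
Proof.
apply: (@abs_cont_lip _ _ _ _ 1) => x y _ _ _.
by rewrite mul1r /= -opprD normrN.
Qed.

Lemma abs_contM a b f g : abs_cont a b f -> abs_cont a b g ->
  abs_cont a b (f * g).
Proof.
move=> acf acg; have [M M0 HM] := abs_cont_bounded acf.
have [N N0 HN] := abs_cont_bounded acg.
apply: (@abs_cont_dom a b f g _ (M + N)) => // x y ax xy yb /=.
have -> : (f * g) y - (f * g) x = (f y - f x) * g y + f x * (g y - g x).
  by rewrite !mulrfctE; ring.
rewrite (le_trans (ler_normD _ _))// !normrM mulrDr; apply: lerD.
  rewrite mulrC ler_wpM2r// (le_trans (HN _ _ _))//; last by rewrite lerDr.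
  exact: le_trans xy.
rewrite ler_wpM2r// (le_trans (HM _ _ _))//; last by rewrite lerDl.
exact: le_trans yb.
Qed.

Lemma abs_cont_expR a b f : abs_cont a b f -> abs_cont a b (expR \o f).
Proof.
move=> acf; have [M M0 HM] := abs_cont_bounded acf.
apply: (@abs_cont_lip _ _ f _ (expR M)) => // x y ax xy yb /=.
have Hx : f x <= M.
  by rewrite (le_trans (ler_norm _))// HM// (le_trans xy).
have Hy : f y <= M.
  by rewrite (le_trans (ler_norm _))// HM// (le_trans ax).
have key (u v : R) : u <= v -> v <= M ->
    `|expR v - expR u| <= expR M * `|v - u|.
  move=> uv vM; rewrite !ger0_norm ?subr_ge0 ?ler_expR//.
  have h : 1 + (u - v) <= expR (u - v) := expR_ge1Dx _.
  have -> : expR u = expR v * expR (u - v) by rewrite -expRD addrC subrK.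
  have h2 : expR v <= expR M by rewrite ler_expR.
  have h3 : 0 < expR v := expR_gt0 _.
  apply: (@le_trans _ _ (expR v * (v - u))); first by nra.
  by rewrite ler_wpM2r ?subr_ge0.
have [le|/ltW le] := leP (f x) (f y); first exact: key.
by rewrite distrC [`|f y - _|]distrC key.
Qed.

Lemma abs_cont_ext a b f g : (forall x, a <= x -> x <= b -> f x = g x) ->
  abs_cont a b f -> abs_cont a b g.
Proof.
move=> fg; apply: (@abs_cont_lip _ _ _ _ 1) => x y ax xy yb.
by rewrite mul1r -!fg// ?(le_trans ax)// (le_trans xy).
Qed.

End AbsCont.

(** * Monotonicity from an almost everywhere derivative *)

Section Monotone.
Context {R : realType}.
Notation mu := (@lebesgue_measure R).
Implicit Types (a b x y : R) (f g h df dg : R -> R).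

Lemma is_derive_eps f x d : is_derive x 1 f d -> forall e : R, 0 < e ->
  exists2 r : R, 0 < r &
    forall y, `|y - x| < r -> `|f y - f x - d * (y - x)| <= e * `|y - x|.
Proof.
move=> [dfx <-] e e0.
have : (fun h : R => h^-1 *: (f (h *: 1 + x) - f x)) @ 0^' --> 'D_1 f x by [].
move/cvgrPdist_lt/(_ e e0).
rewrite /dnbhs/= near_withinE => /nbhs_ballP[r /= r0 H].
exists r => // y yx; have [->|ney] := eqVneq y x.
  by rewrite !subrr mulr0 subrr normr0 mulr0.
have h0 : y - x != 0 by rewrite subr_eq0.
have /= := H (y - x); rewrite /ball/= sub0r normrN => /(_ yx h0).
rewrite /GRing.scale/= mulr1 subrK => /ltW.
rewrite -(ler_pM2r (_ : 0 < `|y - x|)) ?normr_gt0// -normrM.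
have -> : ('D_1 f x - (y - x)^-1 * (f y - f x)) * (y - x) =
  - (f y - f x - 'D_1 f x * (y - x)) by field.
by rewrite normrN.
Qed.

(** Lists, unlike families indexed by ordinals, concatenate easily, which is what the additivity
    step of [ac_le] requires. *)
Lemma abs_cont_seq a b f (e : R) : abs_cont a b f -> 0 < e ->
  exists2 d : R, 0 < d & forall ps : seq (R * R),
    all (fun p => [&& a <= p.1, p.1 <= p.2 & p.2 <= b]) ps ->
    pairwise (fun p q => p.2 <= q.1) ps ->
    \sum_(p <- ps) (p.2 - p.1) < d ->
    \sum_(p <- ps) `|f p.2 - f p.1| < e.
Proof.
move=> acf e0; have [d d0 H] := acf e e0; exists d => // ps rng pw.
have := H (size ps) (fun k => (tnth (in_tuple ps) k).1)
  (fun k => (tnth (in_tuple ps) k).2).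
rewrite -(big_tnth _ _ ps xpredT (fun p => p.2 - p.1)).
rewrite -(big_tnth _ _ ps xpredT (fun p => `|f p.2 - f p.1|)); apply.
  move=> k; have /and3P[? ? ?] := allP rng _ (mem_tnth k (in_tuple ps)).
  by split.
move=> k k' kk'; rewrite !(tnth_nth (0, 0))/=.
have [kk|kk|/val_inj kk] := ltngtP k k'; last by rewrite kk eqxx in kk'.
  by left; apply: (elimT (pairwiseP (0, 0)) pw); rewrite ?inE ?ltn_ord.
by right; apply: (elimT (pairwiseP (0, 0)) pw); rewrite ?inE ?ltn_ord.
Qed.

(* The exceptional points lie in an open set U of small measure.  Outside U the
   function decreases at most at rate eta, and the total variation over
   intervals inside U is small by absolute continuity. *)
Lemma ac_le a b f : a <= b -> abs_cont a b f ->
  {ae mu, forall x, x \in `]a, b[ -> exists2 d, is_derive x 1 f d & 0 <= d} ->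
  f a <= f b.
Proof.
move=> ab acf [A [mA muA0 subA]].
apply/ler_addgt0Pr => e e0.
pose eta := e / (b - a + 1).
have ba1 : 0 < b - a + 1 by rewrite ltr_wpDl// subr_ge0.
have eta0 : 0 < eta by rewrite divr_gt0.
have [del del0 Hdel] := abs_cont_seq acf eta0.
(* No derivative is known at the endpoints, so they join the exceptional null set. *)
pose N := A `|` [set a] `|` [set b].
have mN : measurable N by do 2 (apply: measurableU => //).
have muN : mu N = 0%E.
  apply/eqP; rewrite -measure_le0.
  apply: (le_trans (measureU2 _ _ _)) => //; first exact: measurableU.
  rewrite [X in (_ + X)%E]lebesgue_measure_set1 adde0.
  apply: (le_trans (measureU2 _ _ _)) => //.
  rewrite [X in (_ + X)%E]lebesgue_measure_set1 adde0 le_eqVlt.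
  by apply/orP; left; apply/eqP; exact: muA0.
have [U [oU NU muU]] : exists U, [/\ open U, N `<=` U & (mu (U `\` N) < del%:E)%E].
  by apply: lebesgue_regularity_outer => //; rewrite [X in (X < _)%E]muN.
have mU : measurable U by exact: open_measurable.
have muUdel : (mu U < del%:E)%E.
  apply: le_lt_trans muU.
  have {1}-> : U = (U `\` N) `|` N.
    by rewrite setUC setDUK.
  apply: (le_trans (measureU2 _ _ _)) => //; first exact: measurableD.
  by rewrite [X in (_ + X)%E]muN adde0.
(* The list collects intervals inside [U], where the descent is paid by the variation of [f];
   elsewhere it is paid by the rate [eta]. The half-open []s, t]] makes the measure additive under
   concatenation. *)
pose Q s t := exists ps : seq (R * R),
  [/\ all (fun p => [&& s <= p.1, p.1 <= p.2 & p.2 <= t]) ps,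
     pairwise (fun p q => p.2 <= q.1) ps,
     ((\sum_(p <- ps) (p.2 - p.1))%:E <= mu (U `&` `]s, t]))%E &
     f s - f t <= eta * (t - s) + \sum_(p <- ps) `|f p.2 - f p.1|].
suff [ps [rng pw sm H]] : Q a b.
  have : \sum_(p <- ps) (p.2 - p.1) < del.
    rewrite -lte_fin (le_lt_trans sm)// (le_lt_trans _ muUdel)//.
    apply: le_measure; rewrite ?inE.
    - exact: measurableI.
    - exact: mU.
    - exact: subIsetl.
  move=> /(Hdel _ rng pw) H2.
  have -> : e = eta * (b - a) + eta by rewrite /eta; field; rewrite gt_eqF.
  lra.
apply: interval_additive => //.
  move=> s t r _ st tr _ [p1 [r1 w1 m1 h1]] [p2 [r2 w2 m2 h2]].
  exists (p1 ++ p2); split.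
  - rewrite all_cat; apply/andP; split.
      apply: sub_all r1 => p /and3P[-> -> /= pt]; exact: le_trans tr.
    by apply: sub_all r2 => p /and3P[/(le_trans st) -> -> ->].
  - rewrite pairwise_cat w1 w2 !andbT; apply/allrelP => p q pp qq.
    have /and3P[_ _ h] := allP r1 _ pp.
    by have /and3P[h' _ _] := allP r2 _ qq; exact: le_trans h'.
  - rewrite big_cat/= EFinD.
    have -> : U `&` `]s, r] = (U `&` `]s, t]) `|` (U `&` `]t, r]).
      rewrite -setIUr; congr (_ `&` _).
      by rewrite -itv_bndbnd_setU.
    rewrite measureU//; [exact: leeD|exact: measurableI|exact: measurableI|].
    apply/seteqP; split=> // x [[_ /=]]; rewrite !in_itv/=.
    by move=> /andP[_ xt] [_ /andP[/(le_lt_trans xt)]]; rewrite ltxx.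
  - rewrite big_cat/=; lra.
move=> x ax xb; have [xU|xU] := pselect (U x).
  have [r /= r0 Hr] := (iffLR (@nbhs_ballP _ _ x U)) (open_nbhs_nbhs (conj oU xU)).
  exists r => // s t as_ tb sx xt xs tx; exists [:: (s, t)]; split=> //=.
  - by rewrite !lexx/= (le_trans sx xt).
  - rewrite big_seq1/= setIidr.
      rewrite lebesgue_measure_itv/= lte_fin.
      case: ltP => [_|ts]; first by rewrite -EFinB.
      by rewrite lee_fin subr_le0.
    move=> y; rewrite /= in_itv/= => /andP[sy yt].
    apply: Hr; rewrite ball_itv/= in_itv/=; apply/andP; split; lra.
  - rewrite big_seq1/= distrC (le_trans (ler_norm _))// lerDr mulr_ge0//.
      exact: ltW.
    by rewrite subr_ge0 (le_trans sx).
have xN : ~ N x by move=> /NU.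
have xab : x \in `]a, b[.
  rewrite in_itv/= !lt_neqAle ax xb !andbT; apply/andP; split.
    by apply/eqP => xa; apply: xN; left; right.
  by apply/eqP => xa; apply: xN; right.
have [d dfx d0] : exists2 d, is_derive x 1 f d & 0 <= d.
  have : ~ A x by move=> Ax; apply: xN; left; left.
  by move/(contra_not (subA x))/contrapT; apply.
have [r r0 Hr] := is_derive_eps dfx eta0.
exists r => // s t as_ tb sx xt xs tx; exists [::]; split=> //=.
  by rewrite big_nil measure_ge0.
rewrite big_nil addr0.
have := Hr s; rewrite distrC ger0_norm ?subr_ge0// => /(_ xs).
have := Hr t; rewrite ger0_norm ?subr_ge0// => /(_ tx).
rewrite !ler_norml => /andP[h1 _] /andP[_ h2].
have : 0 <= d * (x - s) by rewrite mulr_ge0// subr_ge0.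
have : 0 <= d * (t - x) by rewrite mulr_ge0// subr_ge0.
lra.
Qed.

End Monotone.

(** * Primitives and calculus of absolutely continuous functions *)

Section Primitive.
Context {R : realType}.
Notation mu := (@lebesgue_measure R).
Implicit Types (a b x y : R) (f g h df dg : R -> R).

Lemma indefinite_integral a b g (c : R) :
  mu.-integrable `]a, b[%classic (EFin \o g) ->
  exists G, [/\ ac_deriv a b G g, G b = c &
    a <= b -> G b - G a = (\int[mu]_(t in `]a, b[) g t)%R].
Proof.
move=> ig.
(* Extension by zero makes the integrand integrable on the line, so that primitives from [-oo] and
   the fundamental theorem of calculus apply. *)
pose gx := g \_ `]a, b[%classic.
have igx : mu.-integrable setT (EFin \o gx).
  rewrite -restrict_EFin; apply/integrable_restrict => //.
  by rewrite setTI.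
pose P x := (\int[mu]_(t in `]-oo, x]) gx t)%R.
have iS A : measurable A -> mu.-integrable A (EFin \o gx).
  by move=> mA; apply: integrableS igx.
have dP : {ae mu, forall x, x \in `]a, b[ -> is_derive x 1 P (g x)}.
  have : {ae mu, forall x, derivable P x 1 /\ derive1 P x = gx x}.
    apply: FTC1Ny; first by move=> y; exact: iS.
    exact: integrable_locally.
  apply: (@filterS _ _ (ae_filter_ringOfSetsType mu)) => x [d1 d2] xab.
  have -> : g x = gx x by rewrite /gx patchE mem_set.
  by apply: DeriveDef; [exact: d1|rewrite -d2 derive1E].
have acP : abs_cont a b P.
  move=> e e0; have [d [d0 H]] := integral_normr_continuous igx e0.
  exists d => // m s t st dj sm.
  (* Half-open intervals are disjoint under the weak separation [t k <= s k']. *)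
  pose F (k : 'I_m) := `]s k, t k]%classic : set R.
  have mF k : measurable (F k) by exact: measurable_itv.
  have tF : trivIset [set: 'I_m] F.
    apply/trivIsetP => k k' _ _ kk'; apply/seteqP; split=> // x [].
    rewrite /F/= !in_itv/= => /andP[skx xtk] /andP[skx' xtk'].
    have [h|h] := dj _ _ kk'.
      by have := lt_le_trans skx' (le_trans xtk h); rewrite ltxx.
    by have := lt_le_trans skx (le_trans xtk' h); rewrite ltxx.
  pose D := \big[setU/set0]_(k < m) F k.
  have mD : measurable D by exact: bigsetU_measurable.
  have muD : (mu D < d%:E)%E.
    rewrite /D measure_bigsetU_ord//.
    rewrite (_ : (\sum_(i < m) _)%E = (\sum_k (t k - s k))%:E) ?lte_fin//.
    rewrite -sumEFin; apply: eq_bigr => k _.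
    suff : mu (F k) = (t k - s k)%:E by [].
    rewrite /F lebesgue_measure_itv/= lte_fin.
    have [_ + _] := st k; rewrite le_eqVlt => /orP[/eqP ->|->//].
    by rewrite ltxx subrr.
  apply: le_lt_trans (H D mD muD).
  have -> : (\int[mu]_(x in D) `|gx x| =
      \sum_(k < m) \int[mu]_(x in F k) `|gx x|)%R.
    rewrite /Rintegral /D integral_bigsetU_EFin//=.
    - rewrite sum_fine// => k _; apply: integrable_fin_num; first exact: mF.
      exact: (integrable_norm (iS _ (mF k))).
    - exact: (@index_enum_uniq (fintype_ordinal__canonical__fintype_Finite m)).
    - exact: sub_trivIset tF.
    - apply/measurable_EFinP/(measurableT_comp (@normr_measurable R setT)) => //.
      by apply/measurable_EFinP; have /integrableP[] := iS _ mD.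
  apply: ler_sum => k _.
  have [_ sk _] := st k.
  have -> : P (t k) - P (s k) = (\int[mu]_(x in F k) gx x)%R.
    by rewrite /P Rintegral_itvB ?bnd_simp//; exact: (iS _ (measurable_itv `]-oo, t k])).
  by apply: le_normr_Rintegral; [exact: mF|exact: (iS _ (mF k))].
exists (fun x => P x + (c - P b)); split; last 2 first.
- by rewrite addrC subrK.
- move=> ab; rewrite opprD addrACA subrr addr0 /P Rintegral_itvB ?bnd_simp//; last first.
    exact: (iS _ (measurable_itv `]-oo, b])).
  rewrite -Rintegral_itv_bndo_bndc; last exact: (iS _ (measurable_itv `]a, b[)).
  by apply: eq_Rintegral => x xab; rewrite /gx patchE xab.
split.
  apply: (@abs_cont_lip _ _ _ P _ 1) acP => x y _ _ _.
  by rewrite mul1r opprD addrACA subrr addr0.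
apply: (@filterS _ _ (ae_filter_ringOfSetsType mu) _ _ _ dP) => x H xab; have dx := H xab.
have := is_deriveD dx (is_derive_cst (c - P b) x (1:R)).
by rewrite addr0.
Qed.


Lemma primitive_exists a b g (c : R) :
  mu.-integrable `]a, b[%classic (EFin \o g) ->
  exists2 G, ac_deriv a b G g & G b = c.
Proof. by move=> /(indefinite_integral c)[G [G1 G2 _]]; exists G. Qed.

Definition ae_on a b (Q : R -> Prop) : Prop :=
  {ae mu, forall x, x \in `]a, b[ -> Q x}.

Lemma ae_on_imp a b (P Q : R -> Prop) :
  (forall x, x \in `]a, b[ -> P x -> Q x) -> ae_on a b P -> ae_on a b Q.
Proof.
move=> PQ; apply: (@filterS _ _ (ae_filter_ringOfSetsType mu)) => x H xab.
exact: PQ (H xab).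
Qed.

Lemma ae_onW a b (P : R -> Prop) : (forall x, x \in `]a, b[ -> P x) ->
  ae_on a b P.
Proof. by move=> H; apply: aeW. Qed.

Lemma ae_on_and a b (P Q : R -> Prop) :
  ae_on a b P -> ae_on a b Q -> ae_on a b (fun x => P x /\ Q x).
Proof.
apply: (@filterS2 _ _ (ae_filter_ringOfSetsType mu)) => x H1 H2 xab.
by split; [exact: H1|exact: H2].
Qed.

Lemma ae_on_sub a b a' b' (P : R -> Prop) : a <= a' -> b' <= b ->
  ae_on a b P -> ae_on a' b' P.
Proof.
move=> aa bb; apply: (@filterS _ _ (ae_filter_ringOfSetsType mu)) => x H.
rewrite in_itv/= => /andP[ax xb]; apply: H.
by rewrite in_itv/= (le_lt_trans aa)//= (lt_le_trans xb).
Qed.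

Lemma ac_deriv_sub a b a' b' f df : a <= a' -> b' <= b ->
  ac_deriv a b f df -> ac_deriv a' b' f df.
Proof.
by move=> aa bb [h1 h2]; split; [exact: abs_cont_sub h1|exact: ae_on_sub h2].
Qed.

Lemma ac_deriv_eq a b f df dg : ae_on a b (fun x => df x = dg x) ->
  ac_deriv a b f df -> ac_deriv a b f dg.
Proof.
move=> E [h1 h2]; split=> //.
by apply: ae_on_imp (ae_on_and E h2) => x _ [->].
Qed.

Lemma ac_deriv_cst a b (c : R) : ac_deriv a b (fun=> c) (fun=> 0).
Proof.
by split; [exact: abs_cont_cst|apply: ae_onW => x _; exact: is_derive_cst].
Qed.

Lemma ac_deriv_id a b : ac_deriv a b id (fun=> 1).
Proof.
by split; [exact: abs_cont_id|apply: ae_onW => x _; exact: is_derive_id].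
Qed.

Lemma ac_derivD a b f df g dg : ac_deriv a b f df -> ac_deriv a b g dg ->
  ac_deriv a b (fun x => f x + g x) (fun x => df x + dg x).
Proof.
move=> [f1 f2] [g1 g2]; split; first exact: abs_contD.
by apply: ae_on_imp (ae_on_and f2 g2) => x _ []; exact: is_deriveD.
Qed.

Lemma ac_derivM a b f df g dg : ac_deriv a b f df -> ac_deriv a b g dg ->
  ac_deriv a b (fun x => f x * g x) (fun x => df x * g x + f x * dg x).
Proof.
move=> [f1 f2] [g1 g2]; split; first exact: abs_contM.
apply: ae_on_imp (ae_on_and f2 g2) => x _ [dfx dgx].
have := is_deriveM dfx dgx.
by rewrite /GRing.scale/= addrC [g x * _]mulrC.
Qed.

Lemma ac_derivZ a b (c : R) f df : ac_deriv a b f df ->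
  ac_deriv a b (fun x => c * f x) (fun x => c * df x).
Proof.
move=> acf; apply: ac_deriv_eq (ac_derivM (ac_deriv_cst a b c) acf).
by apply: ae_onW => x _; rewrite mul0r add0r.
Qed.

Lemma ac_derivN a b f df : ac_deriv a b f df ->
  ac_deriv a b (fun x => - f x) (fun x => - df x).
Proof.
move=> /(ac_derivZ (-1)); rewrite (_ : (fun x => -1 * f x) = (fun x => - f x)).
  by apply: ac_deriv_eq; apply: ae_onW => x _; rewrite mulN1r.
by apply/funext => x; rewrite mulN1r.
Qed.

Lemma ac_derivB a b f df g dg : ac_deriv a b f df -> ac_deriv a b g dg ->
  ac_deriv a b (fun x => f x - g x) (fun x => df x - dg x).
Proof. by move=> acf acg; apply: ac_derivD => //; exact: ac_derivN. Qed.

Lemma ac_deriv_sum a b N (f df : 'I_N -> R -> R) :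
  (forall i, ac_deriv a b (f i) (df i)) ->
  ac_deriv a b (fun x => \sum_i f i x) (fun x => \sum_i df i x).
Proof.
elim: N f df => [|N IH] f df H.
  rewrite (_ : (fun x => _) = (fun=> 0)); last first.
    by apply/funext => x; rewrite big_ord0.
  apply: ac_deriv_eq (ac_deriv_cst a b 0).
  by apply: ae_onW => x _; rewrite big_ord0.
rewrite (_ : (fun x => _) =
    (fun x => f ord0 x + \sum_i f (lift ord0 i) x)); last first.
  by apply/funext => x; rewrite big_ord_recl.
apply: ac_deriv_eq (ac_derivD (H ord0) (IH _ _ (fun i => H (lift ord0 i)))).
by apply: ae_onW => x _; rewrite big_ord_recl.
Qed.

Lemma ac_deriv_expR a b f df : ac_deriv a b f df ->
  ac_deriv a b (fun x => expR (f x)) (fun x => df x * expR (f x)).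
Proof.
move=> [f1 f2]; split; first exact: abs_cont_expR.
apply: ae_on_imp f2 => x _ dfx; rewrite mulrC.
exact: is_derive1_comp.
Qed.

Lemma ac_mono a b f df x y : ac_deriv a b f df ->
  ae_on a b (fun x => 0 <= df x) -> a <= x -> x <= y -> y <= b -> f x <= f y.
Proof.
move=> [f1 f2] df0 ax xy yb; apply: ac_le xy _ _; first exact: abs_cont_sub f1.
apply: (ae_on_sub ax yb); apply: ae_on_imp (ae_on_and f2 df0) => z _ [h1 h2].
by exists (df z).
Qed.

(** Monotonicity of [g - f] and of [g + f]. This mean value inequality carries most of the norm
    estimates below. *)
Lemma ac_compare a b f df g dg x y : ac_deriv a b f df -> ac_deriv a b g dg ->
  ae_on a b (fun x => `|df x| <= dg x) -> a <= x -> x <= y -> y <= b ->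
  `|f y - f x| <= g y - g x.
Proof.
move=> acf acg fg ax xy yb.
have h1 := ac_mono (ac_derivB acg acf).
have h2 := ac_mono (ac_derivD acg acf).
have : g x - f x <= g y - f y.
  apply: h1 => //; apply: ae_on_imp fg => z _; rewrite ler_norml; lra.
have : g x + f x <= g y + f y.
  apply: h2 => //; apply: ae_on_imp fg => z _; rewrite ler_norml; lra.
rewrite ler_norml; lra.
Qed.

Lemma ac_const a b f df x y : ac_deriv a b f df ->
  ae_on a b (fun x => df x = 0) -> a <= x -> x <= b -> a <= y -> y <= b ->
  f x = f y.
Proof.
move=> acf df0.
suff W x' y' : a <= x' -> x' <= y' -> y' <= b -> f x' = f y'.
  move=> ax xb ay yb; have [xy|/ltW yx] := leP x y; first exact: W.
  by apply/esym; exact: W.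
move=> ax xy yb; apply/esym/eqP; rewrite -subr_eq0 -normr_le0.
rewrite -[leRHS](subrr (0:R)).
apply: (ac_compare acf (ac_deriv_cst a b 0)) => //.
by apply: ae_on_imp df0 => z _ ->; rewrite normr0.
Qed.

Definition L1 a b g := mu.-integrable `]a, b[%classic (EFin \o g).

Lemma L1_sub a b a' b' g : a <= a' -> b' <= b -> L1 a b g -> L1 a' b' g.
Proof.
move=> aa bb; apply: integrableS => //.
by apply: subset_itv; rewrite bnd_simp.
Qed.

Lemma L1_abs a b g : L1 a b g -> L1 a b (fun x => `|g x|).
Proof. by move=> /integrable_norm. Qed.

Lemma L1D a b g h : L1 a b g -> L1 a b h -> L1 a b (fun x => g x + h x).
Proof. by move=> ig ih; apply: (integrableD _ ig ih). Qed.

Lemma L1_sum a b N (g : 'I_N -> R -> R) : (forall i, L1 a b (g i)) ->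
  L1 a b (fun x => \sum_i g i x).
Proof.
move=> H; rewrite /L1 (_ : EFin \o _ = fun x => (\sum_i (g i x)%:E)%E).
  by apply: integrable_sum => // i _; exact: H.
by apply/funext => x /=; rewrite sumEFin.
Qed.

Lemma ac_bounded a b f : abs_cont a b f -> [bounded f x | x in `]a, b[%classic].
Proof.
move=> /abs_cont_bounded[M _ HM]; exists M; split; first exact: num_real.
move=> K MK x /=; rewrite in_itv/= => /andP[/ltW ax /ltW xb].
by rewrite (le_trans (HM _ ax xb))// ltW.
Qed.

Lemma ac_measurable a b f : abs_cont a b f -> measurable_fun `]a, b[%classic f.
Proof.
move=> /abs_cont_continuous cf; apply: open_continuous_measurable_fun.
  exact: interval_open.
by move=> x; rewrite inE; exact: cf.
Qed.

Lemma L1_bounded a b f : measurable_fun `]a, b[%classic f ->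
  [bounded f x | x in `]a, b[%classic] -> L1 a b f.
Proof.
move=> mf bf; apply: measurable_bounded_integrable => //.
suff : (mu `]a, b[%classic < +oo)%E by [].
by rewrite lebesgue_measure_itv/=; case: ifP => // _; rewrite -EFinB ltry.
Qed.

Lemma L1_mulr a b g f : L1 a b g -> measurable_fun `]a, b[%classic f ->
  [bounded f x | x in `]a, b[%classic] -> L1 a b (fun x => g x * f x).
Proof. by move=> ig mf bf; exact: (integrableMl _ ig mf bf). Qed.

Lemma L1_ac a b f : abs_cont a b f -> L1 a b f.
Proof. by move=> acf; apply: L1_bounded; [exact: ac_measurable|exact: ac_bounded]. Qed.

Lemma L1_mul_ac a b g f : L1 a b g -> abs_cont a b f ->
  L1 a b (fun x => g x * f x).
Proof.
by move=> ig acf; apply: L1_mulr ig _ _; [exact: ac_measurable|exact: ac_bounded].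
Qed.

Lemma L1Z a b (c : R) f : L1 a b f -> L1 a b (fun x => c * f x).
Proof.
move=> /L1_mul_ac/(_ (abs_cont_cst a b c)).
by under [fun x => _ * _]funext do rewrite mulrC.
Qed.

(** Primitives agree up to a constant, so any of them computes the integral. *)
Lemma L1_integral a b g G : a <= b -> L1 a b g -> ac_deriv a b G g ->
  (\int[mu]_(x in `]a, b[) (g x)%:E)%E = (G b - G a)%:E.
Proof.
move=> ab ig HG; have [P [HP _ HI]] := indefinite_integral 0 ig.
have -> : G b - G a = P b - P a.
  have := @ac_const _ _ _ _ a b (ac_derivB HG HP) _ (lexx a) ab ab (lexx b).
  have E0 : ae_on a b (fun x => g x - g x = 0) by apply: ae_onW => x _; rewrite subrr.
  by move=> /(_ E0); lra.
rewrite HI// /Rintegral fineK//.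
by apply: integrable_fin_num => //; exact: measurable_itv.
Qed.

End Primitive.

(** * Linear systems with integrable coefficients *)

Section LinearSystem.
Context {R : realType}.
Variables (N : nat) (a b : R).
Implicit Types (A : 'I_N -> 'I_N -> R -> R) (F Y : 'I_N -> R -> R).

Definition lin_sys A F Y : Prop := forall i,
  ac_deriv a b (Y i) (fun x => \sum_j A i j x * Y j x + F i x).

(** Gronwall's inequality run backwards, since data will be given at the right end. The norm is
    dominated by [q], its value at [b] plus the integral of a majorant of the derivatives, and
    [q * expR (K - K b) + Phi] is nondecreasing. *)
Lemma gronwall A F Y (K Phi : R -> R) : (forall i j, L1 a b (A i j)) ->
  (forall i, L1 a b (F i)) -> lin_sys A F Y ->
  ac_deriv a b K (fun x => \sum_i \sum_j `|A i j x|) ->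
  ac_deriv a b Phi (fun x => \sum_i `|F i x|) ->
  forall x, a <= x -> x <= b -> \sum_i `|Y i x| <=
    expR (K b - K x) * (\sum_i `|Y i b| + (Phi b - Phi x)).
Proof.
move=> iA iF HY HK HPhi x ax xb.
pose n x := \sum_i `|Y i x|.
have n0 t : 0 <= n t by apply: sumr_ge0.
have acY i : abs_cont a b (fun x => `|Y i x|).
  apply: (@abs_cont_lip _ _ _ (Y i) _ 1); last by have [] := HY i.
  by move=> s t _ _ _; rewrite mul1r ler_dist_dist.
(* The sum over all [k], wider than a bound on the derivative of [Y i] requires, makes the
   homogeneous part of [\sum_i m i] the product of the coefficient norm and [n]. *)
pose m i x := \sum_j \sum_k `|A i j x| * `|Y k x| + `|F i x|.
have im i : L1 a b (m i).
  apply: L1D; last exact: L1_abs.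
  by do 2 (apply: L1_sum => ?); apply: L1_mul_ac => //; exact: L1_abs.
have /choice[M HM] : forall i, exists G, ac_deriv a b G (m i).
  by move=> i; have [G HG _] := primitive_exists 0 (im i); exists G.
have mE t : \sum_i m i t = (\sum_i \sum_j `|A i j t|) * n t + \sum_i `|F i t|.
  rewrite big_split/=; congr (_ + _); rewrite mulr_suml; apply: eq_bigr => i _.
  rewrite mulr_suml; apply: eq_bigr => j _; by rewrite -mulr_sumr.
pose S t := \sum_i M i t.
have HS := ac_deriv_sum HM.
pose q t := n b + (S b - S t).
have nq t : a <= t -> t <= b -> n t <= q t.
  move=> at_ tb; rewrite /n /q /S -sumrB -big_split/=; apply: ler_sum => i _.
  have := ac_compare (HY i) (HM i) _ at_ tb (lexx b).
  have -> : `|Y i t| = `|Y i b - (Y i b - Y i t)| by congr `|_|; ring.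
  move=> H; rewrite (le_trans (ler_normB _ _))// lerD2l; apply: H.
  apply: ae_onW => y _; rewrite (le_trans (ler_normD _ _))// lerD2r.
  rewrite (le_trans (ler_norm_sum _ _ _))//; apply: ler_sum => j _.
  by rewrite normrM (bigD1 j)//= lerDl sumr_ge0.
have Kle t : a <= t -> t <= b -> K t <= K b.
  move=> at_ tb; apply: (ac_mono HK) => //; apply: ae_onW => y _.
  by do 2 (apply: sumr_ge0 => ? _).
have HG := ac_derivD (ac_derivM
   (ac_derivD (ac_deriv_cst a b (n b + S b)) (ac_derivN HS))
   (ac_deriv_expR (ac_derivD HK (ac_deriv_cst a b (- K b))))) HPhi.
have := @ac_mono _ _ _ _ _ x b HG _ ax xb (lexx b).
rewrite subrr expR0 mulr1 addrK => H.
have {}H : q x * expR (K x - K b) + Phi x <= n b + Phi b.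
  rewrite /q addrA; apply: H; apply: ae_onW => y; rewrite in_itv/=.
  move=> /andP[/ltW ay /ltW yb]; rewrite mE.
  have e1 : expR (K y - K b) <= 1 by rewrite -expR0 ler_expR subr_le0 Kle.
  have e0 : 0 < expR (K y - K b) := expR_gt0 _.
  have := nq y ay yb; rewrite /q addrA => nqy.
  have k0 : 0 <= \sum_i \sum_j `|A i j y| by do 2 (apply: sumr_ge0 => ? _).
  have p0 : 0 <= \sum_i `|F i y| by apply: sumr_ge0.
  move: e1 e0 nqy k0 p0; rewrite -/(S y).
  move: (expR _) (n y) (n b + S b - S y) (\sum_i _) (\sum_i `|_|) => e u v k p.
  move=> e1 e0 uv k0 p0; rewrite sub0r addr0.
  have -> : - (k * u + p) * e + v * (k * e) + p =
    k * e * (v - u) + p * (1 - e) by ring.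
  by rewrite addr_ge0// !mulr_ge0 ?subr_ge0// ltW.
apply: le_trans (nq x ax xb) _.
have -> : q x = expR (K b - K x) * (q x * expR (K x - K b)).
  by rewrite mulrCA -expRD addrC addrA subrK subrr expR0 mulr1.
rewrite ler_wpM2l ?expR_ge0//; rewrite -/(n b); lra.
Qed.

(** The intervals with centre [u k] and radius [d k], the tail of the geometric series, are nested;
    the limit is the supremum of their left ends. *)
Lemma geometric_limit (u : nat -> R) (c : R) :
  (forall k, `|u k.+1 - u k| <= c * (2^-1) ^+ k) ->
  exists l, forall k, `|l - u k| <= 2 * c * (2^-1) ^+ k.
Proof.
move=> H.
pose d k := 2 * c * (2^-1) ^+ k.
have dS k : d k = d k.+1 + c * 2^-1 ^+ k by rewrite /d exprS; field.
have d0 k : 0 <= d k.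
  have := le_trans (normr_ge0 _) (H k).
  by rewrite /d -mulrA => h; rewrite mulr_ge0.
have up m k : u (m + k)%N - d (m + k)%N <= u (m + k)%N + d (m + k)%N.
  by have := d0 (m + k)%N; lra.
have mon1 m k : u m - d m <= u (k + m)%N - d (k + m)%N.
  elim: k => [|k IH]; first by rewrite add0n.
  apply: le_trans IH _; rewrite addSn.
  by have := H (k + m)%N; rewrite (dS (k + m)%N) ler_norml; lra.
have mon2 m k : u (k + m)%N + d (k + m)%N <= u m + d m.
  elim: k => [|k IH]; first by rewrite add0n.
  apply: le_trans IH; rewrite addSn.
  by have := H (k + m)%N; rewrite (dS (k + m)%N) ler_norml; lra.
have cross m k : u m - d m <= u k + d k.
  apply: le_trans (mon1 m k) _; rewrite addnC; apply: le_trans (up m k) _.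
  exact: mon2.
pose S := range (fun k => u k - d k).
exists (sup S) => k; rewrite ler_norml; apply/andP; split.
  have : u k - d k <= sup S.
    apply: ub_le_sup; last by exists k.
    by exists (u k + d k) => _ [m _ <-].
  by rewrite -/(d k); lra.
have : sup S <= u k + d k.
  apply: ge_sup; first by exists (u k - d k); exists k.
  by move=> _ [m _ <-].
by rewrite -/(d k); lra.
Qed.

(** Picard iteration from [b]. Distances are weighted by [E x = expR (- (2 * K0 x))], with [K0] a
    primitive of the coefficient norm: in this weight one step contracts by one half on the whole
    interval, whatever the size of the coefficients. *)
Lemma lin_sys_exists A F (c : 'I_N -> R) : (forall i j, L1 a b (A i j)) ->
  (forall i, L1 a b (F i)) -> a <= b ->
  exists2 Y, lin_sys A F Y & forall i, Y i b = c i.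
Proof.
move=> iA iF ab.
(* As long as [A Y] is integrable, the default value of [xget] is not met. *)
pose T (Y : 'I_N -> R -> R) i : R -> R := xget (fun=> 0)
  [set G | ac_deriv a b G (fun x => \sum_j A i j x * Y j x + F i x) /\
           G b = c i].
have iAY Y : (forall i, L1 a b (fun x => \sum_j A i j x * Y j x)) ->
    forall i, ac_deriv a b (T Y i) (fun x => \sum_j A i j x * Y j x + F i x) /\
              T Y i b = c i.
  move=> HY i; rewrite /T; case: xgetP => [G _ //|H].
  have [G G1 G2] := primitive_exists (c i) (L1D (HY i) (iF i)).
  by have := H G; case.
pose Z k := iter k T (fun i _ => c i).
have acZ k i : abs_cont a b (Z k i) /\ Z k i b = c i.
  elim: k i => [|k IH] i; first by split=> //; exact: abs_cont_cst.
  have [] := iAY (Z k) _ i; last by case.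
  by move=> i'; apply: L1_sum => j; apply: L1_mul_ac => //; case: (IH j).
have dZ k i : ac_deriv a b (Z k.+1 i)
    (fun x => \sum_j A i j x * Z k j x + F i x).
  have [] := iAY (Z k) _ i => // i'; apply: L1_sum => j.
  by apply: L1_mul_ac => //; case: (acZ k j).
pose k0 x := \sum_i \sum_j `|A i j x|.
have k00 x : 0 <= k0 x by do 2 (apply: sumr_ge0 => ? _).
have ik0 : L1 a b k0 by do 2 (apply: L1_sum => ?); exact: L1_abs.
have [K0 HK0 K0b] := primitive_exists 0 ik0.
pose E x := expR (- (2 * K0 x)).
have HE : ac_deriv a b E (fun x => - (2 * k0 x) * E x).
  exact: ac_deriv_expR (ac_derivN (ac_derivZ 2 HK0)).
have Eb : E b = 1 by rewrite /E K0b mulr0 oppr0 expR0.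
have E0 x : 0 <= E x by exact: expR_ge0.
have E1 x : a <= x -> x <= b -> 1 <= E x.
  move=> ax xb; rewrite -expR0 ler_expR oppr_ge0 -(mulr0 2) ler_wpM2l//.
  by rewrite -K0b; apply: (ac_mono HK0) => //; apply: ae_onW.
(* one integration halves the weighted distance *)
have contr (u v : 'I_N -> R -> R) i f g (e : R) :
    (forall j x, a <= x -> x <= b -> `|u j x - v j x| <= e * E x) -> 0 <= e ->
    ac_deriv a b f (fun x => \sum_j A i j x * u j x + F i x) ->
    ac_deriv a b g (fun x => \sum_j A i j x * v j x + F i x) ->
    f b = g b ->
    forall x, a <= x -> x <= b -> `|f x - g x| <= e * 2^-1 * E x.
  move=> uv e0 Hf Hg fgb x ax xb.
  have := ac_compare (ac_derivB Hf Hg) (ac_derivZ (- (e * 2^-1)) HE) _ ax xb (lexx b).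
  rewrite fgb subrr sub0r normrN Eb mulr1 => H.
  have : `|f x - g x| <= - (e / 2) - - (e / 2) * E x.
    apply: H; apply: ae_onW => y; rewrite in_itv/= => /andP[/ltW ay /ltW yb].
    rewrite opprD addrACA subrr addr0 -sumrB.
    rewrite (le_trans (ler_norm_sum _ _ _))//.
    have -> : - (e / 2) * (- (2 * k0 y) * E y) = k0 y * (e * E y) by field.
    apply: (@le_trans _ _ ((\sum_j `|A i j y|) * (e * E y))).
      rewrite mulr_suml; apply: ler_sum => j _.
      by rewrite -mulrBr normrM ler_wpM2l//; exact: uv.
    rewrite ler_wpM2r ?mulr_ge0// /k0 [leRHS](bigD1 i)//= lerDl.
    by do 2 (apply: sumr_ge0 => ? _).
  have : 0 <= e / 2 by rewrite mulr_ge0// invr_ge0.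
  by lra.
have /choice[C HC] : forall i, exists C, 0 <= C /\
    forall x, a <= x -> x <= b -> `|Z 1%N i x - Z 0%N i x| <= C.
  move=> i.
  have [M M0 HM] := abs_cont_bounded (abs_contD (acZ 1%N i).1 (abs_contN (acZ 0%N i).1)).
  by exists M.
pose c0 := \sum_i C i.
have c00 : 0 <= c0 by apply: sumr_ge0 => i _; case: (HC i).
have step k i x : a <= x -> x <= b ->
    `|Z k.+1 i x - Z k i x| <= c0 * 2^-1 ^+ k * E x.
  elim: k i x => [|k IH] i x ax xb.
    rewrite expr0 mulr1; have [C0 HCi] := HC i.
    apply: le_trans (HCi x ax xb) _.
    have Cc : C i <= c0.
      rewrite /c0 (bigD1 i)//= lerDl sumr_ge0// => j _; by case: (HC j).
    by rewrite (le_trans Cc)// ler_peMr// E1.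
  rewrite exprSr mulrA; apply: (contr (Z k.+1) (Z k) i) => //.
  - by rewrite mulr_ge0// exprn_ge0// invr_ge0.
  - by rewrite (acZ k.+2 i).2 (acZ k.+1 i).2.
have /choice[Y HY] : forall i, exists Y : R -> R, forall x, a <= x -> x <= b ->
    forall k, `|Y x - Z k i x| <= 2 * c0 * 2^-1 ^+ k * E x.
  move=> i; suff /choice[Y HY] : forall x, exists y, a <= x -> x <= b ->
    forall k, `|y - Z k i x| <= 2 * c0 * 2^-1 ^+ k * E x by exists Y.
  move=> x; have [/andP[ax xb]|nab] := boolP (a <= x <= b); last first.
    by exists 0 => ax xb; rewrite ax xb in nab.
  have [|l Hl] := @geometric_limit (fun k => Z k i x) (c0 * E x).
    by move=> k; rewrite mulrAC; exact: step.
  by exists l => _ _ k; rewrite mulrAC -[2 * c0 * E x]mulrA.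
have half0 : (fun k : nat => 2^-1 ^+ k : R) @ \oo --> (0 : R).
  by apply: cvg_expr; rewrite ger0_norm ?invr_ge0// invf_lt1// ltr1n.
(* The limit is so far only a pointwise one. Being measurable and bounded, it still has [A Y]
   integrable, so that [T Y] is absolutely continuous; and [T Y] equals [Y] on [[a, b]]. *)
have mY i : measurable_fun `]a, b[%classic (Y i).
  apply: (measurable_fun_cvg (h := fun k => Z k i)).
    by move=> k; apply: ac_measurable; case: (acZ k i).
  move=> x /=; rewrite in_itv/= => /andP[/ltW ax /ltW xb].
  apply/cvgrPdist_le => e e0.
  have h : (fun k : nat => 2 * c0 * 2^-1 ^+ k * E x) @ \oo --> 2 * c0 * 0 * E x.
    by apply: cvgMl; apply: cvgMr.
  rewrite mulr0 mul0r in h.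
  near=> k; apply: le_trans (HY i x ax xb k) _.
  by near: k; exact: (cvgr_le _ h).
have bY i : [bounded Y i x | x in `]a, b[%classic].
  have [M M0 HM] := abs_cont_bounded (acZ 0%N i).1.
  have [M' M0' HM'] := abs_cont_bounded HE.1.
  exists (2 * c0 * M' + M); split; first exact: num_real.
  move=> k Mk x /=; rewrite in_itv/= => /andP[/ltW ax /ltW xb].
  rewrite (le_trans _ (ltW Mk))// -[Y i x](subrK (Z 0%N i x)).
  rewrite (le_trans (ler_normD _ _))// lerD ?HM//.
  apply: (le_trans (HY i x ax xb 0%N)); rewrite expr0 mulr1.
  by rewrite ler_wpM2l ?mulr_ge0// -[E x]ger0_norm// HM'.
have HT := iAY Y (fun i => L1_sum (fun j => L1_mulr (iA i j) (mY j) (bY j))).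
have TY i x : a <= x -> x <= b -> T Y i x = Y i x.
  move=> ax xb; apply/eqP; rewrite -subr_eq0 -normr_le0.
  apply/ler_addgt0Pr => e e0; rewrite add0r.
  have h : (fun k : nat => 2 * c0 * 2^-1 ^+ k * E x) @ \oo --> 2 * c0 * 0 * E x.
    by apply: cvgMl; apply: cvgMr.
  rewrite mulr0 mul0r in h.
  have e20 : 0 < e / 2 by rewrite divr_gt0.
  have [k _ Hk] := cvgr_le _ h _ e20.
  have {}Hk := Hk k (leqnn k).
  have H1 := HY i x ax xb k; have H2 := HY i x ax xb k.+1.
  have H3 : `|T Y i x - Z k.+1 i x| <= 2 * c0 * 2^-1 ^+ k * 2^-1 * E x.
    apply: (contr Y (Z k) i) => //.
    - by move=> j t at_ tb; exact: HY.
    - by rewrite !mulr_ge0// exprn_ge0// invr_ge0.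
    - exact: (HT i).1.
    - by rewrite (HT i).2 (acZ k.+1 i).2.
  rewrite exprS in H2.
  have -> : T Y i x - Y i x = (T Y i x - Z k.+1 i x) - (Y i x - Z k.+1 i x) by ring.
  rewrite (le_trans (ler_normB _ _))//; lra.
exists (T Y); last by move=> i; case: (HT i).
move=> i; apply: ac_deriv_eq (HT i).1.
apply: ae_onW => x; rewrite in_itv/= => /andP[/ltW ax /ltW xb].
by congr (_ + _); apply: eq_bigr => j _; rewrite TY.
Unshelve. all: by end_near. Qed.

End LinearSystem.

(** * The equation on one edge *)

Section ComplexParts.
Context {R : realType}.
Implicit Types (x y z : R[i]).

Lemma cRe_add x y : Re (x + y) = Re x + Re y. Proof. by case: x y => ? ? []. Qed.
Lemma cIm_add x y : Im (x + y) = Im x + Im y. Proof. by case: x y => ? ? []. Qed.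
Lemma cRe_opp x : Re (- x) = - Re x. Proof. by case: x. Qed.
Lemma cIm_opp x : Im (- x) = - Im x. Proof. by case: x. Qed.
Lemma cRe_mul x y : Re (x * y) = Re x * Re y - Im x * Im y.
Proof. by case: x y => ? ? []. Qed.
Lemma cIm_mul x y : Im (x * y) = Re x * Im y + Im x * Re y.
Proof. by case: x y => ? ? []. Qed.
Lemma cRe_real (r : R) : Re r%:C%C = r. Proof. by []. Qed.
Lemma cIm_real (r : R) : Im r%:C%C = 0. Proof. by []. Qed.
Lemma cRe_zero : Re (0 : R[i]) = 0. Proof. by []. Qed.
Lemma cIm_zero : Im (0 : R[i]) = 0. Proof. by []. Qed.
Lemma cRe_one : Re (1 : R[i]) = 1. Proof. by []. Qed.
Lemma cIm_one : Im (1 : R[i]) = 0. Proof. by []. Qed.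
Lemma cRe_conj x : Re (Num.conj x) = Re x. Proof. by case: x. Qed.
Lemma cIm_conj x : Im (Num.conj x) = - Im x. Proof. by case: x. Qed.

Definition partsE := (cRe_add, cIm_add, cRe_opp, cIm_opp, cRe_mul, cIm_mul, cRe_real, cIm_real, cRe_zero, cIm_zero, cRe_one, cIm_one,
  cRe_conj, cIm_conj).

Lemma parts_eq x y : Re x = Re y -> Im x = Im y -> x = y.
Proof. by case: x y => ? ? [? ?] /= -> ->. Qed.

Lemma normc_ge0 x : 0 <= normc x.
Proof. by case: x => a b /=; exact: sqrtr_ge0. Qed.

Lemma normc_re x : `|Re x| <= normc x.
Proof.
case: x => a b /=; rewrite -sqrtr_sqr ler_wsqrtr// lerDl sqr_ge0//.
Qed.

Lemma normc_im x : `|Im x| <= normc x.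
Proof.
case: x => a b /=; rewrite -sqrtr_sqr ler_wsqrtr// lerDr sqr_ge0//.
Qed.

Lemma normc_le x : normc x <= `|Re x| + `|Im x|.
Proof.
case: x => a b /=; have h : 0 <= `|a| + `|b| by rewrite addr_ge0.
rewrite -[leRHS]ger0_norm// -sqrtr_sqr ler_wsqrtr// sqrrD !real_normK ?num_real//.
by rewrite lerD2r lerDl mulrn_wge0// mulr_ge0.
Qed.

Lemma sqnormC_normc x : sqnormC x = normc x ^+ 2.
Proof.
case: x => a b; rewrite /sqnormC /= sqr_sqrtr// addr_ge0// sqr_ge0//.
Qed.

End ComplexParts.

Section Edge.
Context {R : realType}.
Variables (a b : R) (V : R -> R).
Implicit Types (lam : R[i]) (u p f : R -> R[i]).

Definition acC u du : Prop :=
  ac_deriv a b (fun x => Re (u x)) (fun x => Re (du x)) /\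
  ac_deriv a b (fun x => Im (u x)) (fun x => Im (du x)).

Definition L1C f : Prop :=
  L1 a b (fun x => Re (f x)) /\ L1 a b (fun x => Im (f x)).

(** First-order form of [(H - lam) u = f], where [p] is u'. *)
Definition esol lam u p f : Prop :=
  acC u p /\ acC p (fun x => ((V x)%:C%C - lam) * u x - f x).

(** The system in the real coordinates Re u, Im u, Re p, Im p, since [lin_sys] is real. *)
Definition coefA lam (i j : 'I_4) (x : R) : R :=
  match val i, val j with
  | 0, 2 => 1 | 1, 3 => 1
  | 2, 0 => V x - Re lam | 2, 1 => Im lam
  | 3, 0 => - Im lam | 3, 1 => V x - Re lam
  | _, _ => 0
  end.

Definition coefF f (i : 'I_4) (x : R) : R :=
  match val i with 2 => - Re (f x) | 3 => - Im (f x) | _ => 0 end.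

Definition coefY u p (i : 'I_4) (x : R) : R :=
  match val i with
  | 0 => Re (u x) | 1 => Im (u x) | 2 => Re (p x) | _ => Im (p x)
  end.

Lemma sum4 (g : 'I_4 -> R) : \sum_i g i =
  g (@Ordinal 4 0 isT) + g (@Ordinal 4 1 isT) + g (@Ordinal 4 2 isT) +
  g (@Ordinal 4 3 isT).
Proof.
rewrite !big_ord_recl big_ord0 addr0 !addrA.
by repeat congr (_ + _); congr (g _); apply: val_inj.
Qed.

Lemma esol_system lam u p f :
  lin_sys a b (coefA lam) (coefF f) (coefY u p) <-> esol lam u p f.
Proof.
have E i : (fun x => \sum_j coefA lam i j x * coefY u p j x + coefF f i x) =
  (fun x => match val i with
  | 0 => Re (p x) | 1 => Im (p x)
  | 2 => Re (((V x)%:C%C - lam) * u x - f x)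
  | _ => Im (((V x)%:C%C - lam) * u x - f x) end).
  apply/funext => x; rewrite sum4; case: i => -[|[|[|[|//]]]] hi;
  rewrite /coefA /coefY /coefF /= ?partsE; ring.
split=> [H|[[H0 H1] [H2 H3]]].
  have := H (@Ordinal 4 0 isT); have := H (@Ordinal 4 1 isT).
  have := H (@Ordinal 4 2 isT); have := H (@Ordinal 4 3 isT).
  by rewrite !E /= => h3 h2 h1 h0; split; split.
by case=> -[|[|[|[|//]]]] hi; rewrite E.
Qed.

Hypothesis ab : a <= b.
Hypothesis iV : L1 a b V.

Lemma L1_cst (c : R) : L1 a b (fun=> c).
Proof. exact/L1_ac/abs_cont_cst. Qed.

Lemma L1N (f : R -> R) : L1 a b f -> L1 a b (fun x => - f x).
Proof. by move=> /(L1Z (-1)); under [fun x => _ * _]funext do rewrite mulN1r. Qed.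

Lemma coefA_L1 lam i j : L1 a b (coefA lam i j).
Proof.
have h : L1 a b (fun x => V x - Re lam) by apply: L1D => //; exact: L1_cst.
by case: i j => -[|[|[|[|//]]]] hi [] [|[|[|[|//]]]] hj; rewrite /coefA //=;
  exact: L1_cst.
Qed.

Lemma coefF_L1 f i : L1C f -> L1 a b (coefF f i).
Proof.
move=> [h1 h2]; case: i => -[|[|[|[|//]]]] hi; rewrite /coefF /=;
  by [exact: L1_cst|exact: L1N].
Qed.

Lemma esol_exists lam f (u0 p0 : R[i]) : L1C f ->
  exists u p, [/\ esol lam u p f, u b = u0 & p b = p0].
Proof.
move=> Lf; have [Y HY Yb] := lin_sys_exists
  (fun i => match val i with
     | 0 => Re u0 | 1 => Im u0 | 2 => Re p0 | _ => Im p0 end)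
  (coefA_L1 lam) (fun i => coefF_L1 i Lf) ab.
pose y k (hk : (k < 4)%N) := Y (Ordinal hk).
exists (fun x => Complex (y 0%N isT x) (y 1%N isT x)).
exists (fun x => Complex (y 2%N isT x) (y 3%N isT x)); split.
- apply/esol_system.
  rewrite (_ : coefY _ _ = Y)//; apply/funext => i; apply/funext => x.
  by case: i => -[|[|[|[|//]]]] hi; rewrite /coefY /= /y; congr (Y _ x); apply: val_inj.
- by rewrite /y !Yb/=; case: (u0).
- by rewrite /y !Yb/=; case: (p0).
Qed.

(** Gronwall with a constant uniform on a disc of parameters, as the comparison of solutions at
    nearby parameters requires. The factor 2 in [C] converts between moduli and sums of absolute
    real and imaginary parts. *)
Lemma esol_bound (B : R) : exists2 C : R, 0 <= C &
  forall lam, normc lam <= B -> forall u p f, L1C f -> esol lam u p f ->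
  forall Phi, ac_deriv a b Phi (fun x => `|Re (f x)| + `|Im (f x)|) ->
  forall x, a <= x -> x <= b ->
    normc (u x) <= C * (normc (u b) + normc (p b) + (Phi b - Phi x)) /\
    normc (p x) <= C * (normc (u b) + normc (p b) + (Phi b - Phi x)).
Proof.
(* The entries of [coefA lam] have absolute values summing to 2 + 2 |V - Re lam| + 2 |Im lam|, which
   this function dominates. *)
have iG : L1 a b (fun x => 2 + 2 * `|V x| + 4 * B).
  apply: L1D; last exact: L1_cst.
  apply: L1D; first exact: L1_cst.
  exact/L1Z/L1_abs.
have [G HG _] := primitive_exists 0 iG.
exists (2 * expR (G b - G a)); first by rewrite mulr_ge0// expR_ge0.
move=> lam lamB u p f Lf /esol_system Hs Phi HPhi x ax xb.
have [K HK _] : exists2 K, ac_deriv a b K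
    (fun x => \sum_i \sum_j `|coefA lam i j x|) & K b = 0.
  apply: primitive_exists; do 2 (apply: L1_sum => ?).
  by apply: L1_abs; exact: coefA_L1.
have HPhi' : ac_deriv a b Phi (fun x => \sum_i `|coefF f i x|).
  apply: ac_deriv_eq HPhi; apply: ae_onW => y _.
  by rewrite sum4 /coefF/= !normrN normr0 !add0r.
have := gronwall (coefA_L1 lam) (fun i => coefF_L1 i Lf) Hs HK HPhi' ax xb.
rewrite !sum4 /coefY/= => H.
have P0 : 0 <= Phi b - Phi x.
  rewrite subr_ge0; apply: (ac_mono HPhi) => //.
  by apply: ae_onW => y _; rewrite addr_ge0.
have KG y : a <= y -> y <= b -> K b - K y <= G b - G y.
  move=> ay yb; apply: (le_trans (ler_norm _)).
  apply: (ac_compare HK HG) => //; apply: ae_onW => z _.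
  have h1 := le_trans (normc_re lam) lamB.
  have h2 := le_trans (normc_im lam) lamB.
  rewrite !sum4 /coefA/= !normr0 normr1 normrN.
  have h3 : `|V z - Re lam| <= `|V z| + B.
    by rewrite (le_trans (ler_normB _ _))// lerD2l.
  rewrite ger0_norm; first lra.
  by rewrite !addr_ge0.
have GG : G a <= G x.
  apply: (ac_mono HG) => //; apply: ae_onW => y _.
  have := normc_ge0 lam; have := normr_ge0 (V y); lra.
have E1 : expR (K b - K x) <= expR (G b - G a).
  by rewrite ler_expR; have := KG x ax xb; lra.
set n0 := `|_| + _ + _ + _ in H.
set m := _ + (Phi b - Phi x) in H.
have m0 : 0 <= m by rewrite addr_ge0// !addr_ge0.
have m2 : m <= 2 * (normc (u b) + normc (p b) + (Phi b - Phi x)).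
  rewrite /m; have := normc_re (u b); have := normc_im (u b).
  have := normc_re (p b); have := normc_im (p b); lra.
have n2 : n0 <= 2 * expR (G b - G a) * (normc (u b) + normc (p b) + (Phi b - Phi x)).
  apply: le_trans H _; rewrite -mulrA mulrCA.
  by apply: ler_pM => //; exact: expR_ge0.
split; apply: le_trans n2; apply: le_trans (normc_le _) _.
  by rewrite /n0 -[leRHS]addrA lerDl addr_ge0.
by rewrite /n0 -addrA lerDr addr_ge0.
Qed.

End Edge.

(** * Passage between the equation of the statement and its first-order form *)

Section EdgeTools.
Context {R : realType}.
Notation mu := (@lebesgue_measure R).
Implicit Types (a b x y : R) (f df g dg V : R -> R) (u p v q : R -> R[i]).

Lemma eps_is_derive f x d :
  (forall e : R, 0 < e -> exists2 r : R, 0 < r &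
    forall y, `|y - x| < r -> `|f y - f x - d * (y - x)| <= e * `|y - x|) ->
  is_derive x 1 f d.
Proof.
move=> H.
have cv : (fun h : R => h^-1 *: (f (h *: 1 + x) - f x)) @ 0^' --> d.
  apply/cvgrPdist_le => e e0; have [r r0 Hr] := H e e0.
  apply/nbhs_ballP; exists r => //= h; rewrite /ball/= sub0r normrN => hr h0.
  have := Hr (h + x); rewrite addrK => /(_ hr).
  rewrite /GRing.scale/= mulr1.
  have -> : f (h + x) - f x - d * h = - (d - h^-1 * (f (h + x) - f x)) * h.
    by field.
  by rewrite normrM normrN ler_pM2r// normr_gt0.
by split; [apply/cvg_ex; exists d|exact/cvg_lim].
Qed.

Lemma derivative_onP a b f df : derivative_on a b f df <->
  forall x, a <= x -> x <= b -> forall e : R, 0 < e -> exists2 r : R, 0 < r &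
    forall y, a <= y -> y <= b -> `|y - x| < r ->
      `|f y - f x - df x * (y - x)| <= e * `|y - x|.
Proof.
split=> H x.
  move=> ax xb e e0; have /H : x \in `[a, b] by rewrite in_itv/= ax.
  move=> /cvgrPdist_le/(_ e e0) /nbhs_ballP[r /= r0 Hr].
  exists r => // y ay yb yxr; have [->|nyx] := eqVneq y x.
    by rewrite !subrr mulr0 subr0 normr0 mulr0.
  have := Hr y; rewrite /ball/= distrC => /(_ yxr nyx).
  rewrite in_itv/= ay yb => /(_ isT) h.
  have yx0 : y - x != 0 by rewrite subr_eq0.
  have -> : f y - f x - df x * (y - x) =
    - (df x - (f y - f x) / (y - x)) * (y - x) by field.
  by rewrite normrM normrN ler_pM2r// normr_gt0.
rewrite in_itv/= => /andP[ax xb].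
apply/cvgrPdist_le => e e0; have [r r0 Hr] := H x ax xb e e0.
apply/nbhs_ballP; exists r => //= y; rewrite /ball/= distrC => yxr nyx.
rewrite in_itv/= => /andP[ay yb].
have yx0 : y - x != 0 by rewrite subr_eq0.
have := Hr y ay yb yxr.
have -> : f y - f x - df x * (y - x) =
  - (df x - (f y - f x) / (y - x)) * (y - x) by field.
by rewrite normrM normrN ler_pM2r// normr_gt0.
Qed.

Lemma derivative_on_ae a b f df : derivative_on a b f df ->
  ae_on a b (fun x => is_derive x 1 f (df x)).
Proof.
move=> /derivative_onP H; apply: ae_onW => x; rewrite in_itv/= => /andP[ax xb].
apply: eps_is_derive => e e0; have [r r0 Hr] := H x (ltW ax) (ltW xb) e e0.
exists (Num.min r (Num.min (x - a) (b - x))).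
  by rewrite !lt_min r0 !subr_gt0 ax xb.
move=> y; rewrite !lt_min => /and3P[h1 h2 h3]; apply: Hr => //.
  by move: h2; rewrite ltr_norml; lra.
by move: h3; rewrite ltr_norml; lra.
Qed.

(** By continuity of [df], the function [f - df x * id] has derivative at most [e] in absolute value
    near [x]. Hence pointwise and almost everywhere derivatives describe the same u'. *)
Lemma ac_derivative_on a b f df : ac_deriv a b f df -> abs_cont a b df ->
  derivative_on a b f df.
Proof.
move=> acf acdf; apply/derivative_onP => x ax xb e e0.
have [r r0 Hr] := abs_cont_eps acdf e0; exists r => // y ay yb yxr.
have acF := ac_derivB acf (ac_derivZ (df x) (ac_deriv_id a b)).
have acG := ac_derivZ e (ac_deriv_id a b).
have key s t : a <= s -> s <= t -> t <= b ->
    (forall z, s < z -> z < t -> `|z - x| < r) ->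
    `|(f t - df x * t) - (f s - df x * s)| <= e * t - e * s.
  move=> as_ st tb Hz.
  apply: (ac_compare (ac_deriv_sub as_ tb acF) (ac_deriv_sub as_ tb acG)) => //.
  apply: ae_onW => z; rewrite in_itv/= => /andP[sz zt].
  rewrite !mulr1 ltW//; apply: Hr => //; last exact: Hz.
    by rewrite (le_trans as_)// ltW.
  by rewrite (le_trans (ltW zt)).
have [xy|yx] := leP x y.
  have := key x y ax xy yb; rewrite [X in _ -> _ <= _ * X]ger0_norm ?subr_ge0//.
  have -> : f y - df x * y - (f x - df x * x) = f y - f x - df x * (y - x) by ring.
  have -> : e * y - e * x = e * (y - x) by ring.
  apply=> z xz zy; move: yxr; rewrite !ger0_norm ?subr_ge0// ?(ltW xz)//; lra.
have := key y x ay (ltW yx) xb.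
rewrite (ler0_norm (_ : y - x <= 0)) ?subr_le0 ?(ltW yx)// in yxr *.
have -> : f x - df x * x - (f y - df x * y) = - (f y - f x - df x * (y - x)).
  by ring.
rewrite normrN; have -> : e * x - e * y = e * - (y - x) by ring.
apply=> z yz zx; rewrite ltr0_norm ?subr_lt0//; lra.
Qed.

Definition edge_eq a b V u du (f : R -> R[i]) : Prop :=
  [/\ abs_contC a b u, derivative_onC a b u du, abs_contC a b du &
    {ae mu, forall x, x \in `]a, b[ -> exists2 ddu : R[i],
      is_deriveC du x ddu & - ddu + (V x)%:C%C * u x = f x}].

Lemma edge_eqP a b V lam u p (f : R -> R[i]) :
  edge_eq a b V u p (fun x => f x + lam * u x) <-> esol a b V lam u p f.
Proof.
split.
  case=> [[u1 u2] [d1 d2] [p1 p2] H].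
  split; split; split=> //; try exact: derivative_on_ae.
    apply: ae_on_imp H => x _ [z [h1 _] E].
    suff -> : ((V x)%:C%C - lam) * u x - f x = z by [].
    have -> : z = (V x)%:C%C * u x - (f x + lam * u x) by rewrite -E; ring.
    by ring.
  apply: ae_on_imp H => x _ [z [_ h1] E].
  suff -> : ((V x)%:C%C - lam) * u x - f x = z by [].
  have -> : z = (V x)%:C%C * u x - (f x + lam * u x) by rewrite -E; ring.
  by ring.
case=> [[u1 u2] [p1 p2]]; split.
- by split; [exact: u1.1|exact: u2.1].
- by split; apply: ac_derivative_on => //; [exact: p1.1|exact: p2.1].
- by split; [exact: p1.1|exact: p2.1].
- apply: ae_on_imp (ae_on_and p1.2 p2.2) => x _ [h1 h2].
  by exists (((V x)%:C%C - lam) * u x - f x) => //; ring.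
Qed.

End EdgeTools.

(** * Lagrange identity, energy and Riccati comparison *)

Section Wronskian.
Context {R : realType}.
Variables (a b : R).
Implicit Types (x y : R) (f g S V : R -> R) (u p v q du dv : R -> R[i]).

Lemma ac_deriv_congr (f g df dg : R -> R) : f =1 g ->
  ae_on a b (fun x => df x = dg x) -> ac_deriv a b f df -> ac_deriv a b g dg.
Proof. by move=> /funext ->; exact: ac_deriv_eq. Qed.

Lemma acC_congr (u v du dv : R -> R[i]) : u =1 v -> du =1 dv ->
  acC a b u du -> acC a b v dv.
Proof. by move=> /funext -> /funext ->. Qed.

Lemma esol_congr V lam u p (f : R -> R[i]) v q (g : R -> R[i]) :
  u =1 v -> p =1 q -> f =1 g -> esol a b V lam u p f -> esol a b V lam v q g.
Proof. by move=> /funext -> /funext -> /funext ->. Qed.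

Lemma acC_eq u du dv : ae_on a b (fun x => du x = dv x) ->
  acC a b u du -> acC a b u dv.
Proof.
by move=> E [h1 h2]; split; [move: h1|move: h2]; apply: ac_deriv_eq;
  apply: ae_on_imp E => x _ ->.
Qed.

Lemma acC_cst (c : R[i]) : acC a b (fun=> c) (fun=> 0).
Proof. by split; exact: ac_deriv_cst. Qed.

Lemma acCD u du v dv : acC a b u du -> acC a b v dv ->
  acC a b (fun x => u x + v x) (fun x => du x + dv x).
Proof.
move=> [u1 u2] [v1 v2]; split.
  apply: ac_deriv_congr (ac_derivD u1 v1) => [x|]; first by rewrite partsE.
  by apply: ae_onW => x _; rewrite partsE.
apply: ac_deriv_congr (ac_derivD u2 v2) => [x|]; first by rewrite partsE.
by apply: ae_onW => x _; rewrite partsE.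
Qed.

Lemma acCM u du v dv : acC a b u du -> acC a b v dv ->
  acC a b (fun x => u x * v x) (fun x => du x * v x + u x * dv x).
Proof.
move=> [u1 u2] [v1 v2]; split.
  apply: ac_deriv_congr (ac_derivB (ac_derivM u1 v1) (ac_derivM u2 v2)) => [x|].
    by rewrite partsE.
  by apply: ae_onW => x _; rewrite !partsE; ring.
apply: ac_deriv_congr (ac_derivD (ac_derivM u1 v2) (ac_derivM u2 v1)) => [x|].
  by rewrite partsE.
by apply: ae_onW => x _; rewrite !partsE; ring.
Qed.

Lemma acCZ (c : R[i]) u du : acC a b u du ->
  acC a b (fun x => c * u x) (fun x => c * du x).
Proof.
move=> acu; apply: acC_eq (acCM (acC_cst c) acu).
by apply: ae_onW => x _; rewrite mul0r add0r.
Qed.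

Lemma acCB u du v dv : acC a b u du -> acC a b v dv ->
  acC a b (fun x => u x - v x) (fun x => du x - dv x).
Proof.
move=> acu /(acCZ (-1)) acv.
by apply: acC_congr (acCD acu acv) => x; rewrite mulN1r.
Qed.

Lemma acCJ u du : acC a b u du ->
  acC a b (fun x => Num.conj (u x)) (fun x => Num.conj (du x)).
Proof.
move=> [u1 u2]; split.
  apply: ac_deriv_congr u1 => [x|]; first by rewrite partsE.
  by apply: ae_onW => x _; rewrite partsE.
apply: ac_deriv_congr (ac_derivN u2) => [x|]; first by rewrite partsE.
by apply: ae_onW => x _; rewrite partsE.
Qed.

Lemma acC_real f df : ac_deriv a b f df ->
  acC a b (fun x => (f x)%:C%C) (fun x => (df x)%:C%C).
Proof. by move=> acf; split=> //; exact: ac_deriv_cst. Qed.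

Lemma acC_const u du : acC a b u du -> ae_on a b (fun x => du x = 0) ->
  forall x y, a <= x -> x <= b -> a <= y -> y <= b -> u x = u y.
Proof.
move=> [u1 u2] E x y ax xb ay yb; apply: parts_eq.
  by apply: (ac_const u1) => //; apply: ae_on_imp E => z _ ->.
by apply: (ac_const u2) => //; apply: ae_on_imp E => z _ ->.
Qed.

Lemma acC_abs u du : acC a b u du ->
  abs_cont a b (fun x => Re (u x)) /\ abs_cont a b (fun x => Im (u x)).
Proof. by move=> [[? _] [? _]]. Qed.

Lemma abs_contC_L1C u : abs_cont a b (fun x => Re (u x)) /\
  abs_cont a b (fun x => Im (u x)) -> L1C a b u.
Proof. by move=> [h1 h2]; split; exact: L1_ac. Qed.

Lemma esol_lin V lam (c : R[i]) u p (f : R -> R[i]) v q (g : R -> R[i]) :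
  esol a b V lam u p f -> esol a b V lam v q g ->
  esol a b V lam (fun x => c * u x + v x) (fun x => c * p x + q x)
    (fun x => c * f x + g x).
Proof.
move=> [u1 u2] [v1 v2]; split; first exact: acCD (acCZ c u1) v1.
apply: acC_eq (acCD (acCZ c u2) v2).
by apply: ae_onW => x _; ring.
Qed.

Lemma esol0 V lam : esol a b V lam (fun=> 0) (fun=> 0) (fun=> 0).
Proof.
split; first exact: acC_cst.
by apply: acC_eq (acC_cst 0); apply: ae_onW => x _; rewrite mulr0 subr0.
Qed.

Lemma esolZ V lam (c : R[i]) u p (f : R -> R[i]) :
  esol a b V lam u p f ->
  esol a b V lam (fun x => c * u x) (fun x => c * p x) (fun x => c * f x).
Proof.
by move=> H; apply: esol_congr (esol_lin c H (esol0 V lam)) => x; rewrite addr0.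
Qed.

Lemma esolB V lam u p (f : R -> R[i]) v q (g : R -> R[i]) :
  esol a b V lam u p f -> esol a b V lam v q g ->
  esol a b V lam (fun x => u x - v x) (fun x => p x - q x)
    (fun x => f x - g x).
Proof.
by move=> Hu Hv; apply: esol_congr (esol_lin (-1) Hv Hu) => x; ring.
Qed.

(** With solutions at two parameters, this gives the equation of their difference quotient. *)
Lemma esol_shift V lam mu u p (f : R -> R[i]) :
  esol a b V lam u p f ->
  esol a b V mu u p (fun x => f x + (lam - mu) * u x).
Proof.
move=> [h1 h2]; split=> //; apply: acC_eq h2; apply: ae_onW => x _; ring.
Qed.

(** The terms with the potential cancel because it is real. *)
Lemma lagrange V lam mu u p (f : R -> R[i]) v q (g : R -> R[i]) :
  esol a b V lam u p f -> esol a b V mu v q g ->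
  acC a b (fun x => p x * Num.conj (v x) - u x * Num.conj (q x))
    (fun x => (Num.conj mu - lam) * (u x * Num.conj (v x))
              - f x * Num.conj (v x) + u x * Num.conj (g x)).
Proof.
move=> [u1 u2] [v1 v2].
apply: acC_eq (acCB (acCM u2 (acCJ v1)) (acCM u1 (acCJ v2))).
apply: ae_onW => x _.
rewrite rmorphB rmorphM rmorphB /=.
have -> : Num.conj (V x)%:C%C = (V x)%:C%C by apply: parts_eq; rewrite !partsE ?oppr0.
ring.
Qed.

Lemma ac_pos S f x0 : a < b -> ac_deriv a b S f -> abs_cont a b f ->
  a <= x0 -> x0 <= b -> 0 < f x0 ->
  exists s t, [/\ a <= s, s < t, t <= b & S s < S t].
Proof.
move=> ab acS acf ax xb f0.
have f20 : 0 < f x0 / 2 by rewrite divr_gt0.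
have [r r0 Hr] := abs_cont_eps acf f20.
pose s := Num.max a (x0 - r / 2); pose t := Num.min b (x0 + r / 2).
have r20 : 0 < r / 2 by rewrite divr_gt0.
have as_ : a <= s by rewrite le_max lexx.
have tb : t <= b by rewrite ge_min lexx.
have sx : s <= x0 by rewrite ge_max ax/= gerBl ltW.
have xt : x0 <= t by rewrite le_min xb/= lerDl ltW.
have st : s < t.
  rewrite gt_max !lt_min ab/=; apply/and3P; split; lra.
exists s, t; split=> //.
have sr : x0 - r / 2 <= s by rewrite le_max lexx orbT.
have tr : t <= x0 + r / 2 by rewrite ge_min lexx orbT.
have : f x0 / 2 * s < f x0 / 2 * t by rewrite ltr_pM2l.
move=> h1.
have := ac_mono (ac_deriv_sub as_ tb (ac_derivB acS (ac_derivZ (f x0 / 2) (ac_deriv_id a b)))).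
move=> /(_ s t) H; have : S s - f x0 / 2 * s <= S t - f x0 / 2 * t.
  apply: H => //; last exact: ltW.
  apply: ae_onW => z; rewrite in_itv/= => /andP[sz zt]; rewrite mulr1.
  have : `|f z - f x0| < f x0 / 2.
    apply: Hr => //; rewrite ?(le_trans as_) ?(le_trans _ tb) ?ltW//.
    by rewrite ltr_norml; apply/andP; split; lra.
  by rewrite ltr_norml; lra.
lra.
Qed.

Lemma ac_deriv_zero S f : a < b -> ac_deriv a b S f -> abs_cont a b f ->
  (forall x, a <= x -> x <= b -> S x = S a) ->
  forall x, a <= x -> x <= b -> f x = 0.
Proof.
move=> ab acS acf Sa x ax xb.
have [fx|fx|//] := ltgtP (f x) 0.
  have [|s [t [as_ st tb]]] := ac_pos ab (ac_derivN acS) (abs_contN acf) ax xb.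
    by rewrite /= oppr_gt0.
  rewrite !Sa ?ltxx// ?(le_trans (ltW st))// ?(le_trans as_)// ltW//.
have [s [t [as_ st tb]]] := ac_pos ab acS acf ax xb fx.
by rewrite !Sa ?ltxx// ?(le_trans (ltW st))// ?(le_trans as_)// ltW//.
Qed.

Lemma abs_cont_sqnormC u du : acC a b u du ->
  abs_cont a b (fun x => sqnormC (u x)).
Proof.
move=> [[u1 _] [u2 _]].
apply: abs_cont_ext (abs_contD (abs_contM u1 u1) (abs_contM u2 u2)).
by move=> x _ _; rewrite /sqnormC !expr2.
Qed.

Lemma sqnormC_ge0 (z : R[i]) : 0 <= sqnormC z.
Proof. by rewrite addr_ge0// sqr_ge0. Qed.

Lemma sqnormC_eq0 (z : R[i]) : sqnormC z = 0 -> z = 0.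
Proof.
move=> /eqP; rewrite paddr_eq0 ?sqr_ge0// !sqrf_eq0 => /andP[/eqP h1 /eqP h2].
exact: parts_eq.
Qed.

Lemma mulJ (z : R[i]) : z * Num.conj z = (sqnormC z)%:C%C.
Proof. by apply: parts_eq; rewrite !partsE /sqnormC; ring. Qed.

(** A vanishing integral of |v|^2 would force v, then its derivative q, to vanish on the edge,
    against the data at [b]. *)
Lemma esol_pos V lam v q S : a < b -> esol a b V lam v q (fun=> 0) ->
  ac_deriv a b S (fun x => sqnormC (v x)) ->
  ~ (v b = 0 /\ q b = 0) -> S a < S b.
Proof.
move=> ab [v1 v2] acS nz; rewrite ltNge; apply/negP => SbSa; apply: nz.
have Smono x y : a <= x -> x <= y -> y <= b -> S x <= S y.
  by move=> *; apply: (ac_mono acS) => //; apply: ae_onW => z _; exact: sqnormC_ge0.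
have Sc x : a <= x -> x <= b -> S x = S a.
  move=> ax xb; apply/le_anti; rewrite (Smono a x)// andbT.
  by apply: le_trans SbSa; exact: Smono.
have v0 x : a <= x -> x <= b -> v x = 0.
  move=> ax xb; apply: sqnormC_eq0.
  exact: (ac_deriv_zero ab acS (abs_cont_sqnormC v1)).
split; first exact: v0 (ltW ab) (lexx b).
have [q1 q2] := acC_abs v2.
by apply: parts_eq; [apply: (ac_deriv_zero ab v1.1 q1)|
  apply: (ac_deriv_zero ab v1.2 q2)]; rewrite ?lexx ?(ltW ab)// => x ax xb;
  rewrite !v0// ltW.
Qed.

Lemma sqnormC_prim v dv : acC a b v dv ->
  exists S, ac_deriv a b S (fun x => sqnormC (v x)).
Proof.
move=> /abs_cont_sqnormC/L1_ac h; have [S HS _] := primitive_exists 0 h.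
by exists S.
Qed.

Lemma acC_increment (Phi : R -> R[i]) (c : R[i]) S f : a <= b ->
  acC a b Phi (fun x => c * (f x)%:C%C) -> ac_deriv a b S f ->
  Phi b - Phi a = c * (S b - S a)%:C%C.
Proof.
move=> ab H /acC_real/(acCZ c) H2.
have E : Phi a - c * (S a)%:C%C = Phi b - c * (S b)%:C%C.
  apply: (acC_const (acCB H H2)) => //.
  by apply: ae_onW => x _; rewrite subrr.
rewrite rmorphB mulrBr; apply/eqP; rewrite -subr_eq0; apply/eqP.
transitivity ((Phi b - c * (S b)%:C%C) - (Phi a - c * (S a)%:C%C)); first ring.
by rewrite E subrr.
Qed.

(** The Lagrange identity of a solution with itself, integrated. When the integral of |v|^2 is
    positive the right-hand side vanishes for real [lam] only, which is why eigenvalues are real. *)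
Lemma wronskian_self V lam v q S : a <= b ->
  esol a b V lam v q (fun=> 0) -> ac_deriv a b S (fun x => sqnormC (v x)) ->
  let W x := q x * Num.conj (v x) - v x * Num.conj (q x) in
  W b - W a = (Num.conj lam - lam) * (S b - S a)%:C%C.
Proof.
move=> ab Hv HS W; apply: (acC_increment (Phi := W) ab _ HS).
apply: acC_eq (lagrange Hv Hv); apply: ae_onW => x _.
by rewrite -mulJ mul0r conjC0 mulr0 subr0 addr0.
Qed.

(** [r] stands for the derivative of [v] in the spectral parameter: source [v] and zero data at [b].
    The sign of this Wronskian is what excludes Jordan chains. *)
Lemma wronskian_derivative V (lam : R) v q r dr S : a <= b ->
  esol a b V lam%:C%C v q (fun=> 0) ->
  esol a b V lam%:C%C r dr v -> r b = 0 -> dr b = 0 ->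
  ac_deriv a b S (fun x => sqnormC (v x)) ->
  dr a * Num.conj (v a) - r a * Num.conj (q a) = (S b - S a)%:C%C.
Proof.
move=> ab Hv Hr r0 dr0 HS.
have := @acC_increment (fun x => dr x * Num.conj (v x) - r x * Num.conj (q x)) (-1)
  S (fun x => sqnormC (v x)) ab.
rewrite r0 dr0 !mul0r subr0 sub0r mulN1r => /(_ _ HS) H.
apply: oppr_inj; apply: H.
apply: acC_eq (lagrange Hr Hv); apply: ae_onW => x _.
rewrite -mulJ conjC0 mulr0 addr0 mulN1r.
have -> : Num.conj lam%:C%C = lam%:C%C by apply: parts_eq; rewrite !partsE ?oppr0.
by rewrite subrr mul0r sub0r.
Qed.

(* kappa is a subsolution of the Riccati equation k' = V - lam - k^2, so that
   Re (p conj u) - kappa |u|^2 - int |u|^2 is nondecreasing; it exists for lam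
   very negative, with kappa a <= - (C + 1) and kappa b >= C. *)
Lemma riccati V (C : R) : a < b -> L1 a b V -> 0 <= C ->
  exists lam0 : R, forall lam : R, lam <= lam0 -> forall u p,
    esol a b V lam%:C%C u p (fun=> 0) ->
    Re (p b * Num.conj (u b)) <= C * sqnormC (u b) ->
    forall S, ac_deriv a b S (fun x => sqnormC (u x)) ->
    Re (p a * Num.conj (u a)) <= - (C + 1) * sqnormC (u a) - (S b - S a).
Proof.
move=> ab iV C0; have [W HW Wb] := primitive_exists 0 iV.
have [M M0 HM] := abs_cont_bounded HW.1.
(* [W] is a primitive of [V] bounded by [M]. Adding the affine function that runs from [- D] at [a]
   to [D] at [b] gives kappa its boundary values whatever [W] is. *)
pose D := C + 1 + M; pose sl := 2 * D / (b - a).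
have ba0 : 0 < b - a by rewrite subr_gt0.
pose kap x := W x + (sl * x + (D - sl * b)).
have Hkap : ac_deriv a b kap (fun x => V x + sl).
  have := ac_derivD HW (ac_derivD (ac_derivZ sl (ac_deriv_id a b))
    (ac_deriv_cst a b (D - sl * b))).
  by apply: ac_deriv_eq; apply: ae_onW => x _; rewrite mulr1 addr0.
have D0 : 0 <= D by rewrite !addr_ge0.
have sl0 : 0 <= sl by rewrite divr_ge0 ?mulr_ge0// ltW.
have slE : sl * (b - a) = 2 * D by rewrite /sl; field; rewrite gt_eqF.
have kapM x : a <= x -> x <= b -> `|kap x| <= M + D.
  move=> ax xb; apply: (le_trans (ler_normD _ _)); apply: lerD; first exact: HM.
  have h1 : sl * (b - x) <= 2 * D by rewrite -slE ler_wpM2l// lerD2l lerN2.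
  have h2 : 0 <= sl * (b - x) by rewrite mulr_ge0// subr_ge0.
  rewrite ler_norml; lra.
(* As kappa' = V + sl, the derivative of the comparison function is |p - kappa u|^2 + (- lam - sl -
   kappa^2 - 1) |u|^2, and |kappa| is at most [M + D]. *)
exists (- ((M + D) ^+ 2 + sl + 1)) => lam laml u p Hu Hb S HS.
have [u1 u2] := Hu.
have HP := (acCM u2 (acCJ u1)).1.
have HN : ac_deriv a b (fun x => sqnormC (u x))
    (fun x => 2 * Re (p x * Num.conj (u x))).
  apply: ac_deriv_congr (ac_derivD (ac_derivM u1.1 u1.1) (ac_derivM u1.2 u1.2)).
    by move=> x; rewrite /sqnormC; ring.
  by apply: ae_onW => x _; rewrite !partsE; ring.
have HPsi := ac_derivB (ac_derivB HP (ac_derivM Hkap HN)) HS.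
have := @ac_mono _ _ _ _ _ a b HPsi _ (lexx a) (ltW ab) (lexx b).
have Wa := HM a (lexx a) (ltW ab); have Wb' := HM b (ltW ab) (lexx b).
have ka : kap a <= - (C + 1).
  have -> : kap a = W a + D - sl * (b - a) by rewrite /kap; ring.
  rewrite slE; move: Wa; rewrite ler_norml /D; lra.
have kb : C <= kap b.
  have -> : kap b = W b + D by rewrite /kap; ring.
  move: Wb'; rewrite ler_norml /D; lra.
move=> H; have {}H : Re (p a * Num.conj (u a)) - kap a * sqnormC (u a) - S a <=
   Re (p b * Num.conj (u b)) - kap b * sqnormC (u b) - S b.
  apply: H; apply: ae_onW => x; rewrite in_itv/= => /andP[/ltW ax /ltW xb].
  have := kapM x ax xb; move: laml; rewrite !partsE /sqnormC.
  move: (kap x) (V x) (Re (u x)) (Im (u x)) (Re (p x)) (Im (p x)) => k w ur ui pr pi laml kM.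
  have k2 : k ^+ 2 <= (M + D) ^+ 2.
    by rewrite -[k ^+ 2]real_normK ?num_real// lerXn2r// ?nnegrE// addr_ge0.
  have c0 : 0 <= - lam - sl - k ^+ 2 - 1 by lra.
  set A := (X in _ <= X).
  have -> : A = (pr - k * ur) ^+ 2 + (pi - k * ui) ^+ 2 +
     (- lam - sl - k ^+ 2 - 1) * (ur ^+ 2 + ui ^+ 2) by rewrite /A; ring.
  by rewrite addr_ge0// ?addr_ge0 ?sqr_ge0// mulr_ge0// addr_ge0 ?sqr_ge0.
have na := sqnormC_ge0 (u a); have nb := sqnormC_ge0 (u b).
nra.
Qed.

End Wronskian.

(** * Holomorphic dependence on the spectral parameter *)

Section SpectralParameter.
Context {R : realType}.

Lemma lipschitz_quotient_derivable (F : R[i] -> R[i]) (w D : R[i]) (K : R) :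
  (forall t, t != 0 -> normc t <= 1 ->
    normc ((F (w + t) - F w) / t - D) <= K * normc t) ->
  derivable (F : R[i]^o -> R[i]^o) w 1.
Proof.
move=> H; apply/cvg_ex; exists D; apply/cvgrPdist_le => e e0.
(* Norms and radii in [R[i]] are complex numbers that happen to be real; the estimate is moved to
   [R]. *)
have eE : e = (Re e)%:C%C.
  by move: e0; case: e => x y; rewrite ltcE/= => /andP[/eqP -> _].
have cRe_zero : 0 < Re e by move: e0; rewrite ltcE/= => /andP[].
pose r := Num.min 1 (Re e / (`|K| + 1)).
have K0 : 0 < `|K| + 1 by rewrite ltr_wpDl.
have r0 : 0 < r by rewrite lt_min ltr01 divr_gt0.
apply/nbhs_ballP; exists r%:C%C => /=; first by rewrite ltcR.
move=> t; rewrite /ball/= sub0r normrN => tr t0.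
have {}tr : normc t < r.
  by rewrite -ltcR; exact: tr.
have t1 : normc t <= 1 by rewrite ltW// (lt_le_trans tr)// ge_min lexx.
have te : normc t * (`|K| + 1) <= Re e.
  by rewrite -ler_pdivlMr// ltW// (lt_le_trans tr)// ge_min lexx orbT.
have := H t t0 t1.
have -> : t *: 1 + w = w + t by rewrite /GRing.scale/= mulr1 addrC.
rewrite /GRing.scale/= [t^-1 * _]mulrC distrC eE => h.
suff : normc ((F (w + t) - F w) / t - D) <= Re e by rewrite -lecR.
apply: le_trans h _; apply: le_trans te; rewrite mulrC ler_wpM2l ?normc_ge0//.
by rewrite (le_trans (ler_norm _))// lerDl.
Qed.

Variables (a b : R) (V : R -> R).
Hypotheses (ab : a <= b) (iV : L1 a b V).
Implicit Types (u p f : R -> R[i]).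

Lemma esol_bound_sup (B : R) : exists2 C : R, 0 <= C &
  forall lam, normc lam <= B -> forall u p f (m : R), L1C a b f ->
  (forall x, a <= x -> x <= b -> normc (f x) <= m) -> esol a b V lam u p f ->
  forall x, a <= x -> x <= b ->
    normc (u x) <= C * (normc (u b) + normc (p b) + m) /\
    normc (p x) <= C * (normc (u b) + normc (p b) + m).
Proof.
have [C C0 HC] := esol_bound iV B.
exists (C * (1 + 2 * (b - a))); first by rewrite mulr_ge0// addr_ge0// mulr_ge0// subr_ge0.
move=> lam lamB u p f m Lf fm Hu x ax xb.
have m0 : 0 <= m := le_trans (normc_ge0 _) (fm a (lexx a) ab).
have [Phi HPhi _] := primitive_exists 0 (L1D (L1_abs Lf.1) (L1_abs Lf.2)).
have P : Phi b - Phi x <= 2 * m * (b - x).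
  rewrite mulrBr; apply: (le_trans (ler_norm _)).
  apply: (ac_compare HPhi (ac_derivZ (2 * m) (ac_deriv_id a b))) => //.
  apply: ae_onW => y; rewrite in_itv/= => /andP[/ltW ay /ltW yb].
  rewrite ger0_norm ?addr_ge0//.
  have := fm y ay yb; have := normc_re (f y); have := normc_im (f y); lra.
have P2 : 2 * m * (b - x) <= 2 * m * (b - a).
  by rewrite ler_wpM2l ?mulr_ge0// lerD2l lerN2.
have key : C * (normc (u b) + normc (p b) + (Phi b - Phi x)) <=
    C * (1 + 2 * (b - a)) * (normc (u b) + normc (p b) + m).
  rewrite -mulrA ler_wpM2l//.
  have h1 := normc_ge0 (u b); have h2 := normc_ge0 (p b).
  have h3 : 0 <= (b - a) by rewrite subr_ge0.
  have : 0 <= (b - a) * (normc (u b) + normc (p b)) by rewrite mulr_ge0// addr_ge0.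
  lra.
by have [h1 h2] := HC lam lamB u p f Lf Hu Phi HPhi x ax xb; split;
  apply: le_trans key.
Qed.

Lemma L1C0 : L1C a b (fun=> 0 : R[i]).
Proof. by split; exact: L1_cst. Qed.

Lemma L1C_lin (c : R[i]) f g : L1C a b f -> L1C a b g ->
  L1C a b (fun x => c * f x + g x).
Proof.
move=> [f1 f2] [g1 g2].
split.
  under [fun x => _]funext do rewrite !partsE.
  by apply: L1D => //; apply: L1D; [|apply: L1N]; exact: L1Z.
under [fun x => _]funext do rewrite !partsE.
by apply: L1D => //; apply: L1D; exact: L1Z.
Qed.

Lemma L1CB f g : L1C a b f -> L1C a b g -> L1C a b (fun x => f x - g x).
Proof.
move=> Lf Lg; have := L1C_lin (-1) Lg Lf.
by under [fun x => _ * _ + _]funext do rewrite mulN1r addrC.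
Qed.

Lemma esol_unique lam u p v q f : L1C a b f ->
  esol a b V lam u p f -> esol a b V lam v q f -> u b = v b -> p b = q b ->
  forall x, a <= x -> x <= b -> u x = v x /\ p x = q x.
Proof.
move=> Lf Hu Hv uv pq x ax xb.
have [C C0 HC] := esol_bound_sup (normc lam).
have H : esol a b V lam (fun x => u x - v x) (fun x => p x - q x) (fun=> 0).
  by apply: esol_congr (esolB Hu Hv) => // y; rewrite subrr.
have [] := HC lam (lexx _) _ _ _ 0 L1C0 _ H x ax xb.
  by move=> y _ _; rewrite normc0.
rewrite uv pq !subrr normc0 !addr0 mulr0 => h1 h2.
have z0 (z : R[i]) : normc z <= 0 -> z = 0.
  by move=> h; apply: eq0_normc; apply/le_anti; rewrite h normc_ge0.
by split; apply/eqP; rewrite -subr_eq0; apply/eqP; exact: z0.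
Qed.

(** A chosen solution. For an integrable source [esol_exists] rules out the default, and
    [esol_unique] fixes the values on [[a, b]]. *)
Definition usol lam f (u0 p0 : R[i]) : (R -> R[i]) * (R -> R[i]) :=
  xget (fun=> 0, fun=> 0) [set up | [/\ esol a b V lam up.1 up.2 f,
    up.1 b = u0 & up.2 b = p0]].

Lemma usolP lam f (u0 p0 : R[i]) : L1C a b f ->
  [/\ esol a b V lam (usol lam f u0 p0).1 (usol lam f u0 p0).2 f,
    (usol lam f u0 p0).1 b = u0 & (usol lam f u0 p0).2 b = p0].
Proof.
move=> Lf; rewrite /usol; case: xgetP => [up _ //|H].
have [u [p Hup]] := esol_exists ab iV lam u0 p0 Lf.
by have := H (u, p).
Qed.

Lemma esol_L1C lam u p f : esol a b V lam u p f -> L1C a b u.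
Proof. by case=> /acC_abs/abs_contC_L1C. Qed.

(* Differentiability in the spectral parameter reduces to this: difference
   quotients solve an inhomogeneous problem with a bounded source. *)
Lemma esol_quotient w t u p v q f : t != 0 ->
  esol a b V (w + t) u p f -> esol a b V w v q f ->
  esol a b V w (fun x => t^-1 * (u x - v x)) (fun x => t^-1 * (p x - q x)) u.
Proof.
move=> t0 /(@esol_shift _ _ _ _ _ w) Hu Hv.
apply: esol_congr (esolZ t^-1 (esolB Hu Hv)) => // x.
by rewrite addrAC subrr add0r [w + t]addrC addrK mulKf.
Qed.

(** The derivative is [r], which has the solution at [w] as source and zero data at [b]. The bound
    is used twice: it shows that the solutions at [w + t] and [w] differ by O(t), and this
    difference is the source of the difference quotient minus [r]. *)
Lemma usol_derivable f (u0 p0 w : R[i]) : L1C a b f ->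
  derivable ((fun lam => (usol lam f u0 p0).1 a) : R[i]^o -> R[i]^o) w 1 /\
  derivable ((fun lam => (usol lam f u0 p0).2 a) : R[i]^o -> R[i]^o) w 1.
Proof.
move=> Lf; have [C C0 HC] := esol_bound iV (normc w + 1).
have [C' C'0 HC'] := esol_bound_sup (normc w + 1).
have [Phi HPhi _] := primitive_exists 0 (L1D (L1_abs Lf.1) (L1_abs Lf.2)).
pose m := C * (normc u0 + normc p0 + (Phi b - Phi a)).
have um z : normc z <= normc w + 1 -> forall x, a <= x -> x <= b ->
    normc ((usol z f u0 p0).1 x) <= m.
  move=> zw x ax xb; have [Hu ub pb] := usolP z u0 p0 Lf.
  have [h _] := HC z zw _ _ f Lf Hu Phi HPhi x ax xb.
  apply: le_trans h _; rewrite ub pb /m ler_wpM2l// lerD2l lerD2l lerN2.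
  by apply: (ac_mono HPhi) => //; apply: ae_onW => y _; rewrite addr_ge0.
have [Hw wb wb'] := usolP w u0 p0 Lf.
have ww : normc w <= normc w + 1 by rewrite lerDl.
have [H0 rb rb'] := usolP w 0 0 (esol_L1C Hw).
set r := usol w _ 0 0 in H0 rb rb'.
have key t : t != 0 -> normc t <= 1 ->
    normc (t^-1 * ((usol (w + t) f u0 p0).1 a - (usol w f u0 p0).1 a) - r.1 a) <=
      C' * C' * m * normc t /\
    normc (t^-1 * ((usol (w + t) f u0 p0).2 a - (usol w f u0 p0).2 a) - r.2 a) <=
      C' * C' * m * normc t.
  move=> t0 t1.
  have wt : normc (w + t) <= normc w + 1.
    by rewrite (le_trans (le_normcD _ _))// lerD2l.
  have [Ht tb tb'] := usolP (w + t) u0 p0 Lf.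
  have Hq := esol_quotient t0 Ht Hw.
  have Hd := esolB Hq H0.
  have dm x : a <= x -> x <= b ->
      normc ((usol (w + t) f u0 p0).1 x - (usol w f u0 p0).1 x) <=
        C' * m * normc t.
    move=> ax xb.
    have [] := HC' w ww _ _ _ m (esol_L1C Ht) (um _ wt) Hq x ax xb.
    rewrite tb wb tb' wb' !subrr !mulr0 normc0 !add0r => h _.
    have -> : (usol (w + t) f u0 p0).1 x - (usol w f u0 p0).1 x =
      t * (t^-1 * ((usol (w + t) f u0 p0).1 x - (usol w f u0 p0).1 x)).
      by rewrite mulVKf.
    by rewrite normcM mulrC ler_wpM2r// normc_ge0.
  have := HC' w ww _ _ _ (C' * m * normc t) _ dm Hd a (lexx a) ab.
  rewrite tb wb tb' wb' rb rb' !subrr !mulr0 subr0 normc0 !add0r.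
  rewrite !mulrA; apply.
  exact: L1CB (esol_L1C Ht) (esol_L1C Hw).
split.
  apply: (lipschitz_quotient_derivable (D := r.1 a) (K := C' * C' * m)) => t t0 t1.
  by rewrite [_ / t]mulrC; have [] := key t t0 t1.
apply: (lipschitz_quotient_derivable (D := r.2 a) (K := C' * C' * m)) => t t0 t1.
by rewrite [_ / t]mulrC; have [] := key t t0 t1.
Qed.

End SpectralParameter.

(** * Entire functions and zeros of determinants *)

Section Entire.
Context {R : realType}.
Implicit Types (F G : R[i] -> R[i]).

Definition derivableC F (w : R[i]) : Prop := derivable (F : R[i]^o -> R[i]^o) w 1.

Definition entire F : Prop := forall w, derivableC F w.

Lemma entire_cst (c : R[i]) : entire (fun=> c).
Proof. by move=> w; exact: derivable_cst. Qed.

Lemma entire_id : entire id.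
Proof. by move=> w; exact: derivable_id. Qed.

Lemma derivableCD F G w : derivableC F w -> derivableC G w -> derivableC (fun z => F z + G z) w.
Proof. by move=> hF hG; exact: (@derivableD _ R[i]^o R[i]^o F G w 1 hF hG). Qed.

Lemma derivableCM F G w : derivableC F w -> derivableC G w -> derivableC (fun z => F z * G z) w.
Proof.
move=> hF hG.
exact: (@derivableM _ R[i]^o (F : R[i]^o -> R[i]) (G : R[i]^o -> R[i]) w 1 hF hG).
Qed.

Lemma derivableCV F w : F w != 0 -> derivableC F w -> derivableC (fun z => (F z)^-1) w.
Proof. by move=> F0 hF; exact: (@derivableV _ R[i]^o (F : R[i]^o -> R[i]) w 1 F0 hF). Qed.

Lemma entireD F G : entire F -> entire G -> entire (fun z => F z + G z).
Proof. by move=> hF hG w; exact: derivableCD. Qed.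

Lemma entireM F G : entire F -> entire G -> entire (fun z => F z * G z).
Proof. by move=> hF hG w; exact: derivableCM. Qed.

Lemma entire_ext F G : F =1 G -> entire F -> entire G.
Proof. by move=> /funext ->. Qed.

Lemma entire_sum (I : finType) (F : I -> R[i] -> R[i]) :
  (forall i, entire (F i)) -> entire (fun z => \sum_i F i z).
Proof.
move=> H; elim: (index_enum I) => [|i s IH].
  by under [fun z => _]funext do rewrite big_nil; exact: entire_cst.
rewrite (_ : (fun z => _) = (fun z => F i z + \sum_(j <- s) F j z)).
  exact: entireD (H i) IH.
by apply/funext => z; rewrite big_cons.
Qed.

Lemma entire_prod (I : finType) (F : I -> R[i] -> R[i]) :
  (forall i, entire (F i)) -> entire (fun z => \prod_i F i z).
Proof.
move=> H; elim: (index_enum I) => [|i s IH].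
  by under [fun z => _]funext do rewrite big_nil; exact: entire_cst.
rewrite (_ : (fun z => _) = (fun z => F i z * \prod_(j <- s) F j z)).
  exact: entireM (H i) IH.
by apply/funext => z; rewrite big_cons.
Qed.

Lemma entire_mulmx (m n p : nat) (A : R[i] -> 'M[R[i]]_(m, n))
    (B : R[i] -> 'M[R[i]]_(n, p)) :
  (forall i j, entire (fun z => A z i j)) ->
  (forall i j, entire (fun z => B z i j)) ->
  forall i j, entire (fun z => (A z *m B z) i j).
Proof.
move=> hA hB i j; under [fun z => _]funext do rewrite mxE.
by apply: entire_sum => k; exact: entireM.
Qed.

Lemma entire_det n (A : R[i] -> 'M[R[i]]_n) :
  (forall i j, entire (fun z => A z i j)) -> entire (fun z => \det (A z)).
Proof.
move=> H; apply: entire_sum => s; apply: entireM; first exact: entire_cst.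
exact: entire_prod.
Qed.

Lemma derivableC_continuous F w : derivableC F w -> {for w, continuous (F : R[i]^o -> R[i]^o)}.
Proof.
by move=> h; exact: (differentiable_continuous ((iffLR (@derivable1_diffP _ _ _ _)) h)).
Qed.

Lemma entire_near_neq0 F (z : R[i]) : entire F -> F z != 0 ->
  \forall w \near (z : R[i]^o), F w != 0.
Proof.
move=> hF Fz; have := derivableC_continuous (hF z).
by move=> h; exact: (@cvgr_neq0 _ _ _ _ _ _ _ h Fz).
Qed.

End Entire.

Section DetFactor.
Context {R : realType}.

Lemma prod_step (n r : nat) (x : R[i]) : (r <= n)%N ->
  \prod_(i < n) (if (i < r)%N then 1 else x) = x ^+ (n - r).
Proof.
move=> rn; rewrite -(big_mkord xpredT (fun i => if (i < r)%N then 1 else x)).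
rewrite (big_cat_nat _ rn)//= big_nat big1 ?mul1r; last by move=> i /andP[_ ->].
rewrite -prodr_const_nat big_nat [RHS]big_nat; apply: eq_bigr => i /andP[ri _].
by rewrite ltnNge ri.
Qed.

(* Writing A0 = L (pid_mx r) U, the last n - r rows of pid_mx r + (w - z) Q'
   are divisible by w - z. *)
Lemma det_factor n (A0 : 'M[R[i]]_n) (Q : R[i] -> 'M[R[i]]_n) (z : R[i]) :
  (forall i j, entire (fun w => Q w i j)) ->
  (forall c y : 'cV_n, A0 *m c = 0 -> Q z *m c = A0 *m y -> c = 0) ->
  exists E, [/\ entire E, E z != 0 & forall w,
    \det (A0 + (w - z) *: Q w) = (w - z) ^+ (n - \rank A0) * E w].
Proof.
move=> hQ H; set r := \rank A0.
have [L [U [uL uU A0E]]] : exists L U : 'M[R[i]]_n,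
    [/\ L \in unitmx, U \in unitmx & A0 = L *m pid_mx r *m U].
  exists (col_ebase A0), (row_ebase A0).
  by rewrite col_ebase_unit row_ebase_unit mulmx_ebase.
pose Q' w := invmx L *m Q w *m invmx U.
have QE w : Q w = L *m Q' w *m U.
  by rewrite /Q' !mulmxA (mulmxKV uU) (mulmxV uL) mul1mx.
have hQ' i j : entire (fun w => Q' w i j).
  have cst (X : 'M[R[i]]_n) k l : entire (fun=> X k l) by exact: entire_cst.
  have h := @entire_mulmx R n n n (fun=> invmx L) Q (cst _) hQ.
  exact: (@entire_mulmx R n n n (fun w => invmx L *m Q w) (fun=> invmx U) h (cst _)).
clearbody Q'.
pose B w := \matrix_(i, j) (if (i < r)%N then
  (pid_mx r : 'M[R[i]]_n) i j + (w - z) * Q' w i j else Q' w i j).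
have hB i j : entire (fun w => B w i j).
  have h1 := @entireM R _ _ (@entireD R _ _ (@entire_id R) (@entire_cst R (- z))) (hQ' i j).
  have h2 := @entireD R _ _ (@entire_cst R ((pid_mx r : 'M[R[i]]_n) i j)) h1.
  rewrite (_ : (fun w => B w i j) = (fun w => if (i < r)%N then
    (pid_mx r : 'M[R[i]]_n) i j + (w - z) * Q' w i j else Q' w i j)); last first.
    by apply/funext => w; rewrite mxE.
  by case: (i < r)%N; [exact: h2|exact: hQ'].
exists (fun w => \det L * \det (B w) * \det U); split.
- have h1 := @entireM R _ _ (@entire_cst R (\det L)) (@entire_det R n B hB).
  exact: (@entireM R _ _ h1 (@entire_cst R (\det U))).
- have uL0 : \det L != 0 by rewrite -unitfE -unitmxE.
  have uU0 : \det U != 0 by rewrite -unitfE -unitmxE.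
  suff B0 : \det (B z) != 0 by rewrite mulf_neq0// mulf_neq0.
  (* If [B z] kills [y], its first rows say that [pid_mx r] kills [y], and its last rows that
     [Q' z *m y] lies in the range of [pid_mx r]. Undoing [L] and [U] gives the chain excluded by
     [H]. *)
  apply/negP; rewrite -det_tr => /det0P[v vn0 vB].
  pose y := v^T.
  have By : B z *m y = 0 by apply: trmx_inj; rewrite trmx_mul trmxK vB trmx0.
  have BE : B z = \matrix_(i, j) (if (i < r)%N then (pid_mx r : 'M[R[i]]_n) i j else Q' z i j).
    by apply/matrixP => i j; rewrite !mxE subrr mul0r addr0.
  have pidy : (pid_mx r : 'M[R[i]]_n) *m y = 0.
    apply/matrixP => i j; have := congr1 (fun X : 'cV_n => X i j) By.
    rewrite BE !mxE; case: (ltnP i r) => ir.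
      move=> h; rewrite -[RHS]h; apply: eq_bigr => k _; by rewrite !mxE ir.
    move=> _; rewrite big1// => k _.
    by rewrite !mxE ltnNge ir andbF mul0r.
  have Qy : Q' z *m y = (pid_mx r : 'M[R[i]]_n) *m (Q' z *m y).
    apply/matrixP => i j; rewrite [RHS]mxE (bigD1 i)//= big1 ?addr0; last first.
      by move=> k ki; rewrite [pid_mx r i k]mxE val_eqE eq_sym (negbTE ki) mul0r.
    rewrite [pid_mx r i i]mxE eqxx/=; case: (ltnP i r) => ir; first by rewrite mul1r.
    have := congr1 (fun X : 'cV_n => X i j) By.
    rewrite BE [X in X = _ -> _]mxE [X in _ = X -> _]mxE mul0r => h; rewrite -[RHS]h [LHS]mxE.
    by apply: eq_bigr => k _; rewrite !mxE ltnNge ir.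
  have c0 : invmx U *m y = 0.
    apply: (H _ (invmx U *m (Q' z *m y))).
      by rewrite A0E -!mulmxA (mulKVmx uU) pidy mulmx0.
    rewrite QE A0E -[in LHS]mulmxA (mulKVmx uU) -[in LHS]mulmxA [in LHS]Qy.
    by rewrite [RHS]mulmxA (mulmxK uU) [LHS]mulmxA.
  move: vn0; rewrite -[v]trmxK -/y.
  have -> : y = 0 by rewrite -[y](mulKVmx uU) c0 mulmx0.
  by rewrite trmx0 eqxx.
- move=> w.
  pose d := \row_(i < n) (if (i < r)%N then 1 else w - z).
  have -> : A0 + (w - z) *: Q w = L *m (diag_mx d *m B w) *m U.
    rewrite A0E QE scalemxAl scalemxAr -mulmxDl -mulmxDr.
    congr (_ *m _ *m _); apply/matrixP => i j; rewrite mul_diag_mx !mxE.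
    case: ifP => ir; first by rewrite mul1r.
    by rewrite andbF add0r.
  rewrite !det_mulmx det_diag.
  under eq_bigr do rewrite mxE.
  by rewrite prod_step ?rank_leq_row// [in LHS]mulrCA -[LHS]mulrA.
Qed.

End DetFactor.

(** * Star graphs *)

Section VertexCondition.
Context {R : realType}.
Variables (n : nat) (a1 a2 : 'M[R[i]]_n).
Hypothesis rk : \rank (row_mx a1 a2) = n.
Hypothesis sa : a1 *m map_mx Num.conj a2^T = a2 *m map_mx Num.conj a1^T.
Implicit Types (U W X : 'cV[R[i]]_n).

Let a1s := map_mx Num.conj a1^T.
Let a2s := map_mx Num.conj a2^T.

Lemma adjK m p (A : 'M[R[i]]_(m, p)) :
  map_mx Num.conj (map_mx Num.conj A^T)^T = A.
Proof. by apply/matrixP => i j; rewrite !mxE conjCK. Qed.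

Lemma adjM m p q (A : 'M[R[i]]_(m, p)) (B : 'M[R[i]]_(p, q)) :
  map_mx Num.conj (A *m B)^T =
  map_mx Num.conj B^T *m map_mx Num.conj A^T.
Proof. by rewrite trmx_mul map_mxM. Qed.

(* The self-adjoint condition has a null space of dimension n, which therefore
   is the range of (a2^*, - a1^* ). *)
Lemma vertex_param U W : a1 *m U + a2 *m W = 0 ->
  exists d : 'cV_n, U = a2s *m d /\ W = - (a1s *m d).
Proof.
move=> H; pose J := row_mx a2s^T (- a1s^T).
pose M := row_mx a1 a2.
have JM : (J <= kermx M^T)%MS.
  apply/sub_kermxP; rewrite /J /M tr_row_mx mul_row_col mulNmx.
  rewrite -!trmx_mul -raddfB/= -/a1s -/a2s; apply/eqP.
  by rewrite trmx_eq0 subr_eq0; apply/eqP; rewrite /a1s /a2s sa.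
have rJ : \rank J = n.
  apply/eqP; change (row_free J); apply: inj_row_free => v.
  rewrite mul_mx_row -(row_mx0 _ 1 n n) => /eq_row_mx[v2 v1].
  have rfM : row_free M by rewrite /row_free rk.
  have cv (A : 'M[R[i]]_n) : v *m (map_mx Num.conj A^T)^T = 0 -> map_mx Num.conj v *m A = 0.
    move=> /(congr1 (map_mx Num.conj)); by rewrite map_mxM map_mx0 adjK.
  have w2 := cv _ v2.
  have w1 : map_mx Num.conj v *m a1 = 0.
    by apply: cv; apply: oppr_inj; rewrite -mulmxN v1 oppr0.
  have : map_mx Num.conj v = 0.
    by apply: (row_free_inj rfM); rewrite mul0mx mul_mx_row w1 w2 row_mx0.
  move=> /(congr1 (map_mx Num.conj)); rewrite map_mx0 => <-.
  by apply/matrixP => i j; rewrite !mxE conjCK.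
have eqJ : (kermx M^T <= J)%MS.
  rewrite -(geq_leqif (mxrank_leqif_sup JM)) mxrank_ker mxrank_tr rk rJ.
  by rewrite addnK.
have : ((col_mx U W)^T <= J)%MS.
  apply: submx_trans eqJ; apply/sub_kermxP.
  by rewrite -trmx_mul mul_row_col H trmx0.
case/submxP => D /(congr1 trmx); rewrite trmxK trmx_mul /J tr_row_mx mul_col_mx.
rewrite raddfN/= !trmxK => /eq_col_mx[-> ->].
by exists D^T; rewrite mulNmx.
Qed.

(** Writing W = a2^* d and W' = - a1^* d turns the sum into d^* (a1 U + a2 U'). *)
Lemma vertex_pairing U U' W W' :
  a1 *m U + a2 *m U' = 0 -> a1 *m W + a2 *m W' = 0 ->
  \sum_i (U' i 0 * Num.conj (W i 0) - U i 0 * Num.conj (W' i 0)) = 0.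
Proof.
move=> HU /vertex_param[d [-> ->]].
transitivity ((map_mx Num.conj d^T *m (a1 *m U + a2 *m U')) 0 0); last first.
  by rewrite HU mulmx0 mxE.
rewrite mulmxDr !mulmxA.
have -> : map_mx Num.conj d^T *m a1 = map_mx Num.conj (a1s *m d)^T.
  by rewrite adjM /a1s adjK.
have -> : map_mx Num.conj d^T *m a2 = map_mx Num.conj (a2s *m d)^T.
  by rewrite adjM /a2s adjK.
rewrite [RHS]mxE [X in _ = X + _]mxE [X in _ = _ + X]mxE -big_split/=.
move: (a1s *m d) (a2s *m d) => p q; apply: eq_bigr => i _.
by rewrite !mxE rmorphN/= mulrN opprK addrC mulrC [X in _ + X]mulrC.
Qed.

Lemma normc_conj (z : R[i]) : normc (Num.conj z) = normc z.
Proof. by case: z => x y /=; rewrite sqrrN. Qed.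

Lemma normc_sum (I : Type) (s : seq I) (F : I -> R[i]) :
  normc (\sum_(i <- s) F i) <= \sum_(i <- s) normc (F i).
Proof.
elim: s => [|i s IH]; first by rewrite !big_nil normc0.
by rewrite !big_cons (le_trans (le_normcD _ _))// lerD2l.
Qed.

(** Although U' need not be a function of U, the number U^* U' is a quadratic form in U: it equals -
    d^* a2 a1^* d with U = a2^* d, and a2 a1^* = a1 a2^* factors through a2^* on the right, so that
    a pseudo-inverse recovers U. The constant is the sum of the moduli of the entries of [K]. *)
Lemma vertex_bound : exists2 C : R, 0 <= C & forall U U',
  a1 *m U + a2 *m U' = 0 ->
  - C * \sum_i sqnormC (U i 0) <= Re (\sum_i U' i 0 * Num.conj (U i 0)).
Proof.
pose K := a1s *m pinvmx a2s.
exists (\sum_i \sum_j normc (K i j)).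
  by do 2 (apply: sumr_ge0 => ? _); exact: normc_ge0.
move=> U U' /vertex_param[d [HU HU']].
have sa' : a2 *m a1s = a2 *m K *m a2s.
  have sa'' : a1 *m a2s = a2 *m a1s := sa.
  by rewrite /K mulmxA -sa'' -!(mulmxA a1) mulmxKpV// submx_refl.
have E : map_mx Num.conj U^T *m U' = - (map_mx Num.conj U^T *m K *m U).
  have -> : map_mx Num.conj U^T = map_mx Num.conj d^T *m a2.
    by rewrite HU adjM adjK.
  rewrite HU' HU mulmxN; congr (- _); move: (map_mx Num.conj d^T) => D.
  rewrite [LHS]mulmxA -(mulmxA D a2 a1s) sa'.
  by rewrite [RHS]mulmxA; congr (_ *m d); rewrite !mulmxA.
have S : \sum_i U' i 0 * Num.conj (U i 0) =
    - \sum_j (\sum_i Num.conj (U i 0) * K i j) * U j 0.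
  transitivity ((map_mx Num.conj U^T *m U') 0 0).
    by rewrite mxE; apply: eq_bigr => i _; rewrite !mxE mulrC.
  rewrite E mxE; congr (- _); rewrite mxE; apply: eq_bigr => j _; rewrite mxE; congr (_ * _).
  by apply: eq_bigr => i _; rewrite !mxE.
rewrite S cRe_opp mulNr lerN2; set N2 := \sum_i sqnormC _.
apply: (le_trans (ler_norm _)); apply: (le_trans (normc_re _)).
apply: (le_trans (normc_sum _ _)).
rewrite exchange_big/= mulr_suml; apply: ler_sum => j _.
rewrite normcM (le_trans (ler_wpM2r (normc_ge0 _) (normc_sum _ _)))//.
rewrite !mulr_suml; apply: ler_sum => i _.
rewrite normcM normc_conj.
have N2i k : normc (U k 0) ^+ 2 <= N2.
  rewrite -sqnormC_normc /N2 (bigD1 k)//= lerDl sumr_ge0// => l _.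
  exact: sqnormC_ge0.
rewrite [_ * normc (K i j)]mulrC -mulrA ler_wpM2l ?normc_ge0//.
have := N2i i; have := N2i j; have := normc_ge0 (U i 0); have := normc_ge0 (U j 0).
have := sqr_ge0 (normc (U i 0) - normc (U j 0)).
move: (normc _) (normc _) => x y; nra.
Qed.

End VertexCondition.

Lemma usol_entire (R : realType) (a b : R) (V : R -> R) (f : R -> R[i])
    (u0 p0 : R[i]) : a <= b -> L1 a b V -> L1C a b f ->
  entire (fun lam => (usol a b V lam f u0 p0).1 a) /\
  entire (fun lam => (usol a b V lam f u0 p0).2 a).
Proof.
move=> ab iV Lf; split=> w; have H := usol_derivable ab iV u0 p0 w Lf.
  exact: (proj1 H).
exact: (proj2 H).
Qed.

Section StarGraph.
Context {R : realType}.
Variables (n : nat) (G : star_graph R n) (a1 a2 : 'M[R[i]]_n) (g h : 'rV[R[i]]_n).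
Hypothesis len : forall i, vertex G i < tip G i.
Hypothesis iV : forall i, L1 (vertex G i) (tip G i) (potential G i).
Hypothesis rk : \rank (row_mx a1 a2) = n.
Hypothesis sa : a1 *m map_mx Num.conj a2^T = a2 *m map_mx Num.conj a1^T.
Hypothesis bsa : forall i, g 0 i * Num.conj (h 0 i) = h 0 i * Num.conj (g 0 i).
Hypothesis bnz : forall i, ~ (g 0 i = 0 /\ h 0 i = 0).

Definition psi i (lam : R[i]) := usol (vertex G i) (tip G i) (potential G i)
  lam (fun=> 0) (h 0 i) (- g 0 i).

(* The difference quotient ((psi_i w) - (psi_i z)) / (w - z), defined through
   the equation that it solves so that w = z is allowed. *)
Definition dpsi i (z w : R[i]) := usol (vertex G i) (tip G i) (potential G i)
  w (psi i z).1 0 0.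

(* c is in the kernel of Amat lam iff (c_i psi_i)_i satisfies the vertex
   condition, as psi_i spans the solutions satisfying the tip condition. *)
Definition bmat (u p : 'rV[R[i]]_n) := a1 *m diag_mx u + a2 *m diag_mx p.

Definition Amat lam := bmat (\row_i (psi i lam).1 (vertex G i))
  (\row_i (psi i lam).2 (vertex G i)).

Definition Qmat z w := bmat (\row_i (dpsi i z w).1 (vertex G i))
  (\row_i (dpsi i z w).2 (vertex G i)).

Definition charD lam := \det (Amat lam).

(** The nullity of [Amat lam], the common value of the order of the zero and the dimension of the
    eigenspace. *)
Definition mult lam := (n - \rank (Amat lam))%N.

Lemma psiP i lam : [/\ esol (vertex G i) (tip G i) (potential G i) lam
   (psi i lam).1 (psi i lam).2 (fun=> 0), (psi i lam).1 (tip G i) = h 0 i &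
   (psi i lam).2 (tip G i) = - g 0 i].
Proof. by apply: usolP => //; [exact: ltW|exact: L1C0]. Qed.

Lemma psi_L1C i lam : L1C (vertex G i) (tip G i) (psi i lam).1.
Proof. by have [/esol_L1C] := psiP i lam. Qed.

Lemma dpsiP i z w : [/\ esol (vertex G i) (tip G i) (potential G i) w
   (dpsi i z w).1 (dpsi i z w).2 (psi i z).1, (dpsi i z w).1 (tip G i) = 0 &
   (dpsi i z w).2 (tip G i) = 0].
Proof. by apply: usolP => //; [exact: ltW|exact: psi_L1C]. Qed.

(** Both sides solve the same equation with the same tip data. *)
Lemma psi_diff i z w x : vertex G i <= x -> x <= tip G i ->
  (psi i w).1 x = (psi i z).1 x + (w - z) * (dpsi i z w).1 x /\
  (psi i w).2 x = (psi i z).2 x + (w - z) * (dpsi i z w).2 x.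
Proof.
have [H1 e1 e1'] := psiP i w; have [H2 e2 e2'] := psiP i z.
have [H3 e3 e3'] := dpsiP i z w.
have H4 := esol_lin (w - z) H3 (esol_shift w H2).
have H5 : esol (vertex G i) (tip G i) (potential G i) w
    (fun x => (psi i z).1 x + (w - z) * (dpsi i z w).1 x)
    (fun x => (psi i z).2 x + (w - z) * (dpsi i z w).2 x) (fun=> 0).
  apply: esol_congr H4 => y; [exact: addrC|exact: addrC|].
  by rewrite add0r -mulrDl addrA subrK subrr mul0r.
apply: (esol_unique (ltW (len i)) (iV i) (@L1C0 _ _ _) H1 H5).
  by rewrite e1 e2 e3 mulr0 addr0.
by rewrite e1' e2' e3' mulr0 addr0.
Qed.

Lemma bmat_mulE u p (c : 'cV_n) : bmat u p *m c =
  a1 *m (\col_i (u 0 i * c i 0)) + a2 *m (\col_i (p 0 i * c i 0)).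
Proof.
have E (v : 'rV[R[i]]_n) : diag_mx v *m c = \col_i (v 0 i * c i 0).
  by apply/matrixP => i j; rewrite mul_diag_mx !mxE !ord1.
by rewrite /bmat mulmxDl -(mulmxA a1) -(mulmxA a2) !E.
Qed.

Lemma bmat_entry u p i j : bmat u p i j = a1 i j * u 0 j + a2 i j * p 0 j.
Proof. by rewrite /bmat mxE !mul_mx_diag !mxE. Qed.

Lemma bmat_lin u p u' p' (x : R[i]) :
  bmat (u + x *: u') (p + x *: p') = bmat u p + x *: bmat u' p'.
Proof.
have D (v w : 'rV[R[i]]_n) : diag_mx (v + x *: w) = diag_mx v + x *: diag_mx w.
  by apply/matrixP => i j; rewrite !mxE mulrnDl mulrnAr.
by rewrite /bmat !D !mulmxDr -!scalemxAr scalerDr addrACA.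
Qed.

Lemma Amat_diff z w : Amat w = Amat z + (w - z) *: Qmat z w.
Proof.
rewrite /Amat /Qmat -bmat_lin; congr (bmat _ _); apply/rowP => i; rewrite !mxE;
by have [] := psi_diff z w (lexx (vertex G i)) (ltW (len i)).
Qed.

Lemma entire_bmat (u p : R[i] -> 'rV[R[i]]_n) :
  (forall j, entire (fun w => u w 0 j)) -> (forall j, entire (fun w => p w 0 j)) ->
  forall i j, entire (fun w => bmat (u w) (p w) i j).
Proof.
move=> hu hp i j.
have h1 := @entireM R _ _ (@entire_cst R (a1 i j)) (hu j).
have h2 := @entireM R _ _ (@entire_cst R (a2 i j)) (hp j).
by apply: entire_ext (@entireD R _ _ h1 h2) => w; rewrite bmat_entry.
Qed.

Lemma Qmat_entire z i j : entire (fun w => Qmat z w i j).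
Proof.
have H k := usol_entire 0 0 (ltW (len k)) (iV k) (psi_L1C k z).
apply: entire_bmat => k; [apply: entire_ext (H k).1|apply: entire_ext (H k).2];
by move=> w; rewrite mxE.
Qed.

(* E is the integral of |psi_i|^2 over the edge. *)
Lemma psi_energy i lam : exists2 E : R, 0 < E & exists S,
  [/\ ac_deriv (vertex G i) (tip G i) S (fun x => sqnormC ((psi i lam).1 x)) &
      S (tip G i) - S (vertex G i) = E].
Proof.
have [H1 e1 e1'] := psiP i lam.
have [S HS] := sqnormC_prim H1.1.
exists (S (tip G i) - S (vertex G i)); last by exists S.
rewrite subr_gt0; apply: (esol_pos (len i) H1 HS); rewrite e1 e1' => -[h0 g0].
case: (bnz (i := i)); split; last exact: h0.
by apply: oppr_inj; rewrite g0 oppr0.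
Qed.

Lemma psi_neq0 i lam : exists2 x, vertex G i <= x <= tip G i & (psi i lam).1 x != 0.
Proof.
have [E E0 [S [HS SE]]] := psi_energy i lam.
apply: contrapT => H.
suff : E = 0 by move=> E00; rewrite E00 ltxx in E0.
rewrite -SE; apply/eqP; rewrite subr_eq0; apply/eqP.
apply: (ac_const HS); rewrite ?lexx ?(ltW (len i))//.
apply: ae_onW => x; rewrite in_itv/= => /andP[/ltW ax /ltW xb].
have -> : (psi i lam).1 x = 0.
  by apply/eqP/negPn/negP => nz; apply: H; exists x => //; rewrite ax.
by rewrite /sqnormC/= expr0n/= addr0.
Qed.

Lemma tip_wronskian i lam :
  (psi i lam).2 (tip G i) * Num.conj ((psi i lam).1 (tip G i)) -
  (psi i lam).1 (tip G i) * Num.conj ((psi i lam).2 (tip G i)) = 0.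
Proof.
have [_ -> ->] := psiP i lam.
by rewrite rmorphN/= mulNr mulrN opprK bsa addNr.
Qed.

Lemma vertex_wronskian i lam : exists2 E : R, 0 < E &
  (psi i lam).2 (vertex G i) * Num.conj ((psi i lam).1 (vertex G i)) -
  (psi i lam).1 (vertex G i) * Num.conj ((psi i lam).2 (vertex G i)) =
  (lam - Num.conj lam) * E%:C%C.
Proof.
have [E E0 [S [HS SE]]] := psi_energy i lam; exists E => //.
have [H1 e1 e1'] := psiP i lam.
have /= := wronskian_self (ltW (len i)) H1 HS.
rewrite tip_wronskian sub0r SE => /(congr1 -%R); rewrite opprK => ->.
by rewrite -mulNr opprB.
Qed.

Lemma conjC_realC (x : R) : Num.conj x%:C%C = x%:C%C.
Proof. by apply: parts_eq; rewrite !partsE ?oppr0. Qed.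

Lemma sum_sqnormC_eq0 (c : 'cV[R[i]]_n) (E : 'I_n -> R) :
  (forall i, 0 < E i) -> \sum_i sqnormC (c i 0) * E i = 0 -> c = 0.
Proof.
move=> E0 /eqP; rewrite psumr_eq0; last first.
  by move=> i _; rewrite mulr_ge0 ?sqnormC_ge0// ltW.
move=> /allP H; apply/matrixP => i j; rewrite ord1 mxE; apply: sqnormC_eq0.
have /eqP := implyP (H i (mem_index_enum i)) isT.
by move/eqP; rewrite mulf_eq0 (gt_eqF (E0 i)) orbF => /eqP.
Qed.

Lemma sum_realC (F : 'I_n -> R) : \sum_i (F i)%:C%C = (\sum_i F i)%:C%C.
Proof. by rewrite rmorph_sum. Qed.

Lemma Re_sum (F : 'I_n -> R[i]) : Re (\sum_i F i) = \sum_i Re (F i).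
Proof.
elim: (index_enum _) => [|i s IH]; first by rewrite !big_nil.
by rewrite !big_cons cRe_add IH.
Qed.

(** Pairing the vertex condition of the functions c_i psi_i with itself gives (lam - conj lam) times
    the sum of |c_i|^2 int |psi_i|^2, which must vanish. *)
Lemma kernel_nonreal lam (c : 'cV_n) : Im lam != 0 -> Amat lam *m c = 0 -> c = 0.
Proof.
move=> lamI; rewrite bmat_mulE => K.
have := vertex_pairing rk sa K K.
have /choice[E HE] : forall i, exists E : R, 0 < E /\
    (psi i lam).2 (vertex G i) * Num.conj ((psi i lam).1 (vertex G i)) -
    (psi i lam).1 (vertex G i) * Num.conj ((psi i lam).2 (vertex G i)) =
    (lam - Num.conj lam) * E%:C%C.
  by move=> i; have [E E0 HE] := vertex_wronskian i lam; exists E.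
under eq_bigr => i _.
  rewrite !mxE !rmorphM /=.
  rewrite [X in X - _]mulrACA [X in _ - X]mulrACA -mulrBl (HE i).2 mulJ -mulrA -rmorphM/=.
over.
rewrite -mulr_sumr sum_realC => /eqP; rewrite mulf_eq0 => /orP[|/eqP h0].
  rewrite subr_eq0 => /eqP lamE.
  have h0 : Im lam = - Im lam by rewrite -cIm_conj -lamE.
  move: lamI; have -> : Im lam = 0 by lra.
  by rewrite eqxx.
apply: (sum_sqnormC_eq0 (E := E)) => [i|]; first by case: (HE i).
under eq_bigr do rewrite mulrC.
by case: h0.
Qed.

(* There are no Jordan chains: pairing the two vertex conditions and using the
   Lagrange identity for dpsi and psi gives sum |c_i|^2 int |psi_i|^2 = 0. *)
Lemma kernel_simple (lam : R) (c y : 'cV_n) : Amat lam%:C%C *m c = 0 ->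
  Qmat lam%:C%C lam%:C%C *m c = Amat lam%:C%C *m y -> c = 0.
Proof.
set z := lam%:C%C => Kc Ky; move: (Kc); rewrite bmat_mulE => K2.
have K1 : a1 *m (\col_i ((dpsi i z z).1 (vertex G i) * c i 0 -
      (psi i z).1 (vertex G i) * y i 0)) +
    a2 *m (\col_i ((dpsi i z z).2 (vertex G i) * c i 0 -
      (psi i z).2 (vertex G i) * y i 0)) = 0.
  move: Ky; rewrite !bmat_mulE => /eqP; rewrite -subr_eq0 opprD addrACA -!mulmxBr.
  move=> /eqP E; rewrite -[RHS]E; congr (a1 *m _ + a2 *m _);
  by apply/matrixP => i j; rewrite !mxE.
have := vertex_pairing rk sa K1 K2.
have /choice[E HE] : forall i, exists E : R, 0 < E /\
    (dpsi i z z).2 (vertex G i) * Num.conj ((psi i z).1 (vertex G i)) -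
    (dpsi i z z).1 (vertex G i) * Num.conj ((psi i z).2 (vertex G i)) = E%:C%C.
  move=> i; have [E E0 [S [HS SE]]] := psi_energy i z; exists E; split=> //.
  have [H1 _ _] := psiP i z; have [H2 r0 r0'] := dpsiP i z z.
  by rewrite (wronskian_derivative (ltW (len i)) H1 H2 r0 r0' HS) SE.
have W0 i : (psi i z).2 (vertex G i) * Num.conj ((psi i z).1 (vertex G i)) =
    (psi i z).1 (vertex G i) * Num.conj ((psi i z).2 (vertex G i)).
  have [E' _] := vertex_wronskian i z.
  by rewrite conjC_realC subrr mul0r => /eqP; rewrite subr_eq0 => /eqP.
under eq_bigr => i _.
  rewrite !mxE !rmorphM /=.
  rewrite (_ : _ - _ = (sqnormC (c i 0) * E i)%:C%C); last first.
    rewrite rmorphM/= -(HE i).2 -mulJ.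
    move: (W0 i).
    move: ((psi i z).1 _) ((psi i z).2 _) ((dpsi i z z).1 _) ((dpsi i z z).2 _).
    move: (c i 0) (y i 0) => ci yi u p r q W.
    move: (Num.conj u) (Num.conj p) (Num.conj ci) W => u' p' ci' W.
    transitivity (ci * ci' * (q * u' - r * p') - (p * u' - u * p') * (yi * ci')).
      by ring.
    by rewrite W subrr mul0r subr0.
  over.
rewrite sum_realC => -[h0].
by apply: (sum_sqnormC_eq0 (E := E)) => // i; case: (HE i).
Qed.

(** The hypothesis of [det_factor] on chains comes from [kernel_simple] at real points; at the
    others the kernel is already trivial. *)
Lemma charD_order z : exists E, [/\ entire E, E z != 0 &
  forall w, charD w = (w - z) ^+ mult z * E w].
Proof.
have [E [E1 E2 E3]] : exists E, [/\ entire E, E z != 0 & forall w,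
    \det (Amat z + (w - z) *: Qmat z w) = (w - z) ^+ (n - \rank (Amat z)) * E w].
  apply: det_factor; first exact: Qmat_entire.
  have [zr|zi] := eqVneq (Im z) 0.
    have -> : z = (Re z)%:C%C by apply: parts_eq; rewrite !partsE.
    exact: kernel_simple.
  by move=> c y Kc _; exact: (kernel_nonreal zi).
by exists E; split=> // w; rewrite /charD (Amat_diff z w) E3.
Qed.

Lemma charD_neq0 z : (charD z != 0) = (mult z == 0%N).
Proof.
have [E [_ E0 ->]] := charD_order z; rewrite subrr.
case: (mult z) => [|m]; first by rewrite expr0 mul1r E0.
by rewrite expr0n/= mul0r eqxx.
Qed.

Lemma mult0P z : (forall c : 'cV_n, Amat z *m c = 0 -> c = 0) -> mult z = 0%N.
Proof.
move=> H; apply/eqP; rewrite -charD_neq0 /charD -det_tr; apply/negP => /det0P[v v0 vA].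
move: v0; rewrite -[v]trmxK (H v^T) ?trmx0 ?eqxx//.
by apply: trmx_inj; rewrite trmx_mul trmxK vA trmx0.
Qed.

Lemma normc_sqr_prod (c z : R[i]) : sqnormC (c * z) = sqnormC c * sqnormC z.
Proof. by rewrite !sqnormC_normc normcM exprMn. Qed.

(** At the tips, Re (psi_i' conj psi_i) is at most a fixed multiple of |psi_i|^2. For very negative
    parameters the Riccati comparison turns this into an upper bound at the common vertex that
    contradicts [vertex_bound] unless all coefficients vanish. *)
Lemma mult_bounded_below : exists mu0 : R, forall mu, mu <= mu0 -> mult mu%:C%C = 0%N.
Proof.
have [C C0 HC] := vertex_bound rk sa.
have tipC i : exists2 D : R, 0 <= D & forall lam,
    Re ((psi i lam).2 (tip G i) * Num.conj ((psi i lam).1 (tip G i))) <=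
    D * sqnormC ((psi i lam).1 (tip G i)).
  have [h0|h0] := eqVneq (h 0 i) 0.
    exists 0 => // lam; have [_ -> ->] := psiP i lam.
    by rewrite h0 conjC0 mulr0 mul0r.
  (* The tip data do not depend on [lam], so the quotient of the two sides serves as constant. *)
  exists (`|Re (- g 0 i * Num.conj (h 0 i))| / sqnormC (h 0 i)).
    by rewrite divr_ge0// sqnormC_ge0.
  move=> lam; have [_ -> ->] := psiP i lam.
  rewrite divfK ?ler_norm//; apply/eqP => /sqnormC_eq0 /eqP.
  by rewrite (negbTE h0).
have /choice[m Hm] : forall i, exists m : R, forall lam, lam <= m ->
    forall S, ac_deriv (vertex G i) (tip G i) S (fun x => sqnormC ((psi i lam%:C%C).1 x)) ->
    Re ((psi i lam%:C%C).2 (vertex G i) * Num.conj ((psi i lam%:C%C).1 (vertex G i))) <=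
    - C * sqnormC ((psi i lam%:C%C).1 (vertex G i)) - (S (tip G i) - S (vertex G i)).
  move=> i; have [D D0 HD] := tipC i.
  (* The constant [C + D] serves both ends: it is at least [D] at the tip and yields at most [- C]
     at the vertex. *)
  have [m Hm] := riccati (len i) (iV i) (addr_ge0 C0 D0).
  exists m => lam lamm S HS; have [H1 _ _] := psiP i lam%:C%C.
  have N0 x : 0 <= sqnormC ((psi i lam%:C%C).1 x) by exact: sqnormC_ge0.
  apply: (le_trans (Hm lam lamm _ _ H1 _ S HS)).
    by apply: (le_trans (HD _)); rewrite ler_wpM2r// lerDr.
  by rewrite lerD2r ler_wpM2r// lerN2; lra.
exists (- \sum_i `|m i|) => mu mule; apply: mult0P => c; rewrite bmat_mulE => K.
have mum i : mu <= m i.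
  apply: (le_trans mule); rewrite (bigD1 i)//= opprD.
  have : 0 <= \sum_(i0 < n | i0 != i) `|m i0| by apply: sumr_ge0.
  have := ler_norm (- m i); rewrite normrN; lra.
have /choice[E HE] : forall i, exists E : R, 0 < E /\
    Re ((psi i mu%:C%C).2 (vertex G i) * Num.conj ((psi i mu%:C%C).1 (vertex G i))) <=
    - C * sqnormC ((psi i mu%:C%C).1 (vertex G i)) - E.
  move=> i; have [E E0 [S [HS SE]]] := psi_energy i mu%:C%C.
  by exists E; split=> //; rewrite -SE; exact: Hm.
have := HC _ _ K; rewrite (_ : \sum_i _ * _ = \sum_i (sqnormC (c i 0))%:C%C *
   ((psi i mu%:C%C).2 (vertex G i) * Num.conj ((psi i mu%:C%C).1 (vertex G i)))); last first.
  apply: eq_bigr => i _; rewrite !mxE rmorphM/= -mulJ [LHS]mulrACA.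
  exact: mulrC.
rewrite Re_sum => Hle.
apply: (sum_sqnormC_eq0 (E := E)) => [i|]; first by case: (HE i).
apply/le_anti/andP; split; last first.
  by apply: sumr_ge0 => i _; rewrite mulr_ge0 ?sqnormC_ge0// ltW//; case: (HE i).
have : \sum_i Re ((sqnormC (c i 0))%:C%C * ((psi i mu%:C%C).2 (vertex G i) *
      Num.conj ((psi i mu%:C%C).1 (vertex G i)))) <=
    \sum_i (- C * sqnormC ((\col_i0 ((\row_i1 (psi i1 mu%:C%C).1 (vertex G i1)) 0 i0 *
      c i0 0)) i 0) - sqnormC (c i 0) * E i).
  apply: ler_sum => i _; rewrite !mxE normc_sqr_prod cRe_mul cRe_real cIm_real mul0r subr0.
  have := ler_wpM2l (sqnormC_ge0 (c i 0)) (HE i).2; lra.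
rewrite sumrB -mulr_sumr; lra.
Qed.

Lemma real_near (P : R[i] -> Prop) (x : R) :
  (\forall w \near (x%:C%C : R[i]^o), P w) ->
  exists2 r : R, 0 < r & forall y : R, `|y - x| < r -> P y%:C%C.
Proof.
move=> /nbhs_ballP[e /= e0 H].
have eE : e = (Re e)%:C%C.
  by move: e0; case: (e) => u v; rewrite ltcE/= => /andP[/eqP -> _].
exists (Re e); first by move: e0; rewrite ltcE/= => /andP[].
move=> y yx; apply: H; rewrite /ball/= eE -rmorphB/=.
suff : normc (x - y)%:C%C < Re e by rewrite -ltcR.
by rewrite /= expr0n/= addr0 sqrtr_sqr distrC.
Qed.

(** In the factorization at [x] the cofactor stays nonzero nearby by continuity. *)
Lemma mult_isolated (x : R) : exists2 r : R, 0 < r &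
  forall y, `|y - x| < r -> y != x -> mult y%:C%C = 0%N.
Proof.
have [E [E1 E2 E3]] := charD_order x%:C%C.
have [r r0 Hr] := real_near (entire_near_neq0 E1 E2).
exists r => // y yr yx; apply/eqP; rewrite -charD_neq0 E3 mulf_neq0 ?Hr//.
rewrite expf_neq0// -rmorphB/=; apply/eqP => -[/eqP]; rewrite subr_eq0.
by rewrite (negbTE yx).
Qed.

(** The lower bound confines the zeros to a compact interval, in which every point has a
    neighbourhood containing at most one of them. *)
Lemma mult_finite (lam : R) : finite_set [set mu : R | mu <= lam /\ mult mu%:C%C != 0%N].
Proof.
have [mu0 Hmu0] := mult_bounded_below.
pose Q s t := finite_set [set mu : R | s <= mu <= t /\ mult mu%:C%C != 0%N].
have [lm|ml] := leP lam mu0.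
  rewrite (_ : [set _ | _] = set0)//; apply/seteqP; split=> // mu [mul].
  by rewrite Hmu0 ?eqxx// (le_trans mul).
suff : Q mu0 lam.
  apply: sub_finite_set => mu [mul mm]; split=> //; rewrite mul andbT.
  by rewrite leNgt; apply/negP => /ltW/Hmu0 E; rewrite E eqxx in mm.
apply: interval_additive (ltW ml) _ _.
  move=> s t r _ st tr _ Q1 Q2; rewrite /Q.
  suff -> : [set mu : R | s <= mu <= r /\ mult mu%:C%C != 0%N] =
    [set mu : R | s <= mu <= t /\ mult mu%:C%C != 0%N] `|`
    [set mu : R | t <= mu <= r /\ mult mu%:C%C != 0%N].
    by rewrite finite_setU.
  apply/seteqP; split=> mu /=.
    move=> [/andP[smu mur] mm]; have [mt|tm] := leP mu t.
      by left; rewrite smu.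
    by right; rewrite (ltW tm).
  by case=> -[/andP[h1 h2] mm]; rewrite ?h1 ?h2 ?andbT/=; split=> //;
    [rewrite (le_trans h2)|rewrite (le_trans st)].
move=> x _ _; have [r r0 Hr] := mult_isolated x; exists r => // s t _ _ sx xt xs tx.
apply: (sub_finite_set _ (finite_set1 x)) => mu [/andP[smu mut] mm].
apply/eqP; apply: contraNT mm => mux; apply/eqP; apply: Hr => //.
by rewrite ltr_norml; apply/andP; split; lra.
Qed.

End StarGraph.

(** * Square integrable functions *)

Section SquareIntegrable.
Context {R : realType}.
Notation mu := (@lebesgue_measure R).
Variables (a b : R).
Hypothesis ab : a <= b.
Implicit Types (u f : R -> R[i]).

Lemma measurable_sqnormC f :
  measurable_fun `]a, b[%classic (fun x => Re (f x)) ->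
  measurable_fun `]a, b[%classic (fun x => Im (f x)) ->
  measurable_fun `]a, b[%classic (fun x => sqnormC (f x)).
Proof.
by move=> h1 h2; apply: measurable_funD; exact: measurable_funX.
Qed.

Lemma square_integrableP f : square_integrable a b f <->
  [/\ measurable_fun `]a, b[%classic (fun x => Re (f x)),
      measurable_fun `]a, b[%classic (fun x => Im (f x)) &
      L1 a b (fun x => sqnormC (f x))].
Proof.
split=> -[h1 h2 h3]; split=> //.
  apply/integrableP; split; first by apply/measurable_EFinP; exact: measurable_sqnormC.
  by under eq_integral do rewrite /= ger0_norm ?sqnormC_ge0//.
move/integrableP : h3 => [_].
by under eq_integral do rewrite /= ger0_norm ?sqnormC_ge0//.
Qed.

Lemma L1_le (f g : R -> R) : measurable_fun `]a, b[%classic f ->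
  (forall x, `|f x| <= g x) -> L1 a b g -> L1 a b f.
Proof.
move=> mf fg ig; apply: (le_integrable _ _ _ ig) => //.
  by apply/measurable_EFinP.
move=> x _ /=; rewrite lee_fin (le_trans (fg x))// ler_norm//.
Qed.

Lemma square_integrable_L1C f : square_integrable a b f -> L1C a b f.
Proof.
move=> /square_integrableP[h1 h2 h3].
have h4 : L1 a b (fun x => 1 + sqnormC (f x)) by apply: L1D => //; exact: L1_cst.
have key (x y : R) : `|x| <= 1 + (x ^+ 2 + y ^+ 2).
  have := sqr_ge0 (x - 1); have := sqr_ge0 (x + 1); have := sqr_ge0 y.
  have := sqr_ge0 x; rewrite ler_norml; nra.
split; apply: L1_le h4 => // x; rewrite /sqnormC //; last rewrite [X in _ + X]addrC;
  exact: key.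
Qed.

Lemma ac_square_integrable u : abs_cont a b (fun x => Re (u x)) ->
  abs_cont a b (fun x => Im (u x)) -> square_integrable a b u.
Proof.
move=> u1 u2; apply/square_integrableP; split; try exact: ac_measurable.
apply: L1_ac; apply: abs_cont_ext (abs_contD (abs_contM u1 u1) (abs_contM u2 u2)).
by move=> x _ _; rewrite /sqnormC !expr2.
Qed.

Lemma square_integrable_lin (c : R[i]) f g : square_integrable a b f ->
  square_integrable a b g -> square_integrable a b (fun x => f x + c * g x).
Proof.
move=> /square_integrableP[f1 f2 f3] /square_integrableP[g1 g2 g3].
have m1 : measurable_fun `]a, b[%classic (fun x => Re (f x + c * g x)).
  rewrite (_ : (fun x : R => Re _) = fun x => Re (f x) + (Re c * Re (g x) - Im c * Im (g x))).
    by apply: measurable_funD => //; apply: measurable_funB; exact: measurable_funM.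
  by apply/funext => x; rewrite partsE cRe_mul.
have m2 : measurable_fun `]a, b[%classic (fun x => Im (f x + c * g x)).
  rewrite (_ : (fun x : R => Im _) = fun x => Im (f x) + (Re c * Im (g x) + Im c * Re (g x))).
    by apply: measurable_funD => //; apply: measurable_funD; exact: measurable_funM.
  by apply/funext => x; rewrite partsE cIm_mul.
apply/square_integrableP; split=> //.
apply: (@L1_le _ (fun x => 2 * sqnormC (f x) + (2 * sqnormC c) * sqnormC (g x))).
- exact: measurable_sqnormC.
- move=> x; rewrite ger0_norm ?sqnormC_ge0// -mulrA -normc_sqr_prod.
  rewrite !sqnormC_normc.
  have h1 := le_normcD (f x) (c * g x).
  have := normc_ge0 (f x + c * g x); have := normc_ge0 (f x).
  have := normc_ge0 (c * g x); move: h1.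
  move: (normc (f x + _)) (normc (f x)) (normc (c * g x)) => p q r h1 h2 h3 h4.
  have := sqr_ge0 (q - r); nra.
- by apply: L1D; exact: L1Z.
Qed.

Lemma integral_sqnormC f (S : R -> R) : square_integrable a b f ->
  ac_deriv a b S (fun x => sqnormC (f x)) ->
  (\int[mu]_(x in `]a, b[%classic) (sqnormC (f x))%:E)%E = (S b - S a)%:E.
Proof. by move=> /square_integrableP[_ _ h]; exact: L1_integral. Qed.

(** This passes from the L^1 to the L^2 norm of a source, for the bound on the resolvent. The factor
    2 comes from using |Re f| + |Im f| in place of |f|. *)
Lemma cauchy_schwarz f (Phi S : R -> R) :
  ac_deriv a b Phi (fun x => `|Re (f x)| + `|Im (f x)|) ->
  ac_deriv a b S (fun x => sqnormC (f x)) ->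
  Phi b - Phi a <= Num.sqrt (2 * (b - a)) * Num.sqrt (S b - S a).
Proof.
move=> HPhi HS; set I := Phi b - Phi a; set J := S b - S a.
have I0 : 0 <= I.
  rewrite subr_ge0; apply: (ac_mono HPhi) => //; apply: ae_onW => x _.
  by rewrite addr_ge0.
have J0 : 0 <= J.
  rewrite subr_ge0; apply: (ac_mono HS) => //; apply: ae_onW => x _.
  exact: sqnormC_ge0.
have L0 : 0 <= b - a by rewrite subr_ge0.
(* integrate x + y <= t + (x^2 + y^2) / (2 t), then optimize t *)
have key (t : R) : 0 < t -> 2 * t * I <= t ^+ 2 * (2 * (b - a)) + J.
  move=> t0.
  have H := ac_compare HPhi (ac_derivD (ac_derivZ t (ac_deriv_id a b))
    (ac_derivZ (2 * t)^-1 HS)) _ (lexx a) ab (lexx b).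
  have {}H : I <= (t * b + (2 * t)^-1 * S b) - (t * a + (2 * t)^-1 * S a).
    apply: (le_trans (ler_norm _)); apply: H; apply: ae_onW => x _.
    rewrite ger0_norm ?addr_ge0// /sqnormC mulr1.
    rewrite -[_ ^+ 2]real_normK ?num_real// -[Im _ ^+ 2]real_normK ?num_real//.
    move: `|Re (f x)| `|Im (f x)| => p q; rewrite -subr_ge0.
    set A := (X in _ <= X).
    have -> : A = (2 * t)^-1 * ((t - p) ^+ 2 + (t - q) ^+ 2).
      rewrite /A.
      by field; rewrite gt_eqF.
    by rewrite mulr_ge0 ?invr_ge0 ?addr_ge0 ?sqr_ge0// mulr_ge0// ltW.
  have t20 : 0 < 2 * t by rewrite mulr_gt0.
  have := ler_wpM2l (ltW t20) H.
  have -> : 2 * t * (t * b + (2 * t)^-1 * S b - (t * a + (2 * t)^-1 * S a)) =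
    t ^+ 2 * (2 * (b - a)) + J by rewrite /J; field; rewrite gt_eqF.
  by [].
rewrite -sqrtrM ?mulr_ge0// -[leLHS]ger0_norm// -sqrtr_sqr ler_wsqrtr//.
have [->|I1] := eqVneq I 0; first by rewrite expr0n/= !mulr_ge0.
have {}I1 : 0 < I by rewrite lt_neqAle eq_sym I1.
have [L1'|L1'] := eqVneq (b - a) 0.
  have Iba : I = 0.
    by rewrite /I (_ : b = a) ?subrr//; apply/eqP; rewrite -subr_eq0 L1'.
  by rewrite Iba ltxx in I1.
have {}L1' : 0 < 2 * (b - a) by rewrite mulr_gt0// lt_neqAle eq_sym L1'.
(* This [t] makes [2 * t * I - t ^+ 2 * (2 * (b - a))] largest. *)
have := key (I / (2 * (b - a))) (divr_gt0 I1 L1').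
move: (2 * (b - a)) L1' => L L1' H.
have := ler_wpM2l (ltW L1') H.
have -> : L * (2 * (I / L) * I) = 2 * I ^+ 2 by field; rewrite gt_eqF.
have -> : L * ((I / L) ^+ 2 * L + J) = I ^+ 2 + L * J by field; rewrite gt_eqF.
lra.
Qed.

End SquareIntegrable.

(** * Eigenspaces and resolvent set through the characteristic matrix *)

Section Operator.
Context {R : realType}.
Notation mu := (@lebesgue_measure R).
Variables (n : nat) (G : star_graph R n) (a1 a2 : 'M[R[i]]_n) (g h : 'rV[R[i]]_n).
Hypothesis len : forall i, vertex G i < tip G i.
Hypothesis iV : forall i, L1 (vertex G i) (tip G i) (potential G i).
Hypothesis rk : \rank (row_mx a1 a2) = n.
Hypothesis sa : a1 *m map_mx Num.conj a2^T = a2 *m map_mx Num.conj a1^T.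
Hypothesis bsa : forall i, g 0 i * Num.conj (h 0 i) = h 0 i * Num.conj (g 0 i).
Hypothesis bnz : forall i, ~ (g 0 i = 0 /\ h 0 i = 0).

Let B := BoundaryCond a1 a2 (diag_mx g) (diag_mx h).
Let le_len i : vertex G i <= tip G i := ltW (len i).
Local Notation psi := (psi G g h).
Local Notation Amat := (Amat G a1 a2 g h).
Local Notation mult := (mult G a1 a2 g h).
Local Notation edge_sol i := (esol (vertex G i) (tip G i) (potential G i)).

Lemma tip_condP (u du : graph_fun R n) : tip_cond G B u du <->
  forall i, g 0 i * u i (tip G i) + h 0 i * du i (tip G i) = 0.
Proof.
rewrite /tip_cond /=.
have E : diag_mx g *m (\col_i u i (tip G i)) + diag_mx h *m (\col_i du i (tip G i)) =
  \col_i (g 0 i * u i (tip G i) + h 0 i * du i (tip G i)).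
  by apply/matrixP => i j; rewrite mxE !mul_diag_mx !mxE.
rewrite E; split=> [H i|H].
  by have := congr1 (fun X : 'cV[R[i]]_n => X i 0) H; rewrite !mxE.
by apply/matrixP => i j; rewrite !mxE H.
Qed.

Lemma shifted_operatorP lam (u f : graph_fun R n) :
  shifted_operator G B lam u f <->
  in_L2 G (fun i x => f i x + lam * u i x) /\ exists du : graph_fun R n,
    [/\ forall i, edge_sol i lam (u i) (du i) (f i),
        a1 *m (\col_i u i (vertex G i)) + a2 *m (\col_i du i (vertex G i)) = 0 &
        forall i, g 0 i * u i (tip G i) + h 0 i * du i (tip G i) = 0].
Proof.
split=> -[h1 [du [h2 h3 h4]]]; split=> //; exists du; split=> //.
- by move=> i; apply/edge_eqP; exact: h2.
- exact/tip_condP.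
- by move=> i; apply/edge_eqP; exact: h2.
- exact/tip_condP.
Qed.

(** As (g_i, h_i) is nonzero, the tip condition confines the data at the tip to the line spanned by
    (h_i, - g_i); uniqueness does the rest. *)
Lemma edge_kernel lam i (u du : R -> R[i]) :
  edge_sol i lam u du (fun=> 0) ->
  g 0 i * u (tip G i) + h 0 i * du (tip G i) = 0 ->
  exists c : R[i], forall x, vertex G i <= x -> x <= tip G i ->
    u x = c * (psi i lam).1 x /\ du x = c * (psi i lam).2 x.
Proof.
move=> Hu; have [H1 e1 e2] := psiP g h len iV i lam => Ht.
have [c [c1 c2]] : exists c, u (tip G i) = c * h 0 i /\ du (tip G i) = c * - g 0 i.
  move: Ht; move: (u (tip G i)) (du (tip G i)) => a b ab0.
  have [h0|h0] := eqVneq (h 0 i) 0.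
    have g0 : g 0 i != 0 by apply/negP => /eqP g0; apply: (bnz (i := i)).
    exists (- b / g 0 i); rewrite h0 mulr0; split.
      by move: ab0; rewrite h0 mul0r addr0 => /eqP; rewrite mulf_eq0 (negbTE g0) => /eqP.
    by rewrite mulrN divfK// opprK.
  exists (a / h 0 i); split; first by rewrite divfK.
  apply: (mulfI h0); rewrite mulrA [h 0 i * (a / _)]mulrC divfK// mulrN.
  by apply/eqP; rewrite -addr_eq0 addrC [a * _]mulrC ab0.
exists c.
have H2 : edge_sol i lam (fun x => c * (psi i lam).1 x)
    (fun x => c * (psi i lam).2 x) (fun=> 0).
  by apply: esol_congr (esolZ c H1) => // y; rewrite mulr0.
apply: (esol_unique (le_len i) (iV i) (@L1C0 _ _ _) Hu H2).
  by rewrite e1.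
by rewrite e2.
Qed.

Lemma sol_kernel lam (u du : graph_fun R n) :
  (forall i, edge_sol i lam (u i) (du i) (fun=> 0)) ->
  (forall i, g 0 i * u i (tip G i) + h 0 i * du i (tip G i) = 0) ->
  exists c : 'cV[R[i]]_n, forall i x, vertex G i <= x -> x <= tip G i ->
    u i x = c i 0 * (psi i lam).1 x /\ du i x = c i 0 * (psi i lam).2 x.
Proof.
move=> Hu Ht.
have /choice[c Hc] := fun i => edge_kernel (Hu i) (Ht i).
by exists (\col_i c i) => i x ax xb; rewrite mxE; exact: Hc.
Qed.

Lemma kernel_vertex lam (u du : graph_fun R n) (c : 'cV[R[i]]_n) :
  (forall i x, vertex G i <= x -> x <= tip G i ->
    u i x = c i 0 * (psi i lam).1 x /\ du i x = c i 0 * (psi i lam).2 x) ->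
  a1 *m (\col_i u i (vertex G i)) + a2 *m (\col_i du i (vertex G i)) =
  Amat lam *m c.
Proof.
move=> H; rewrite bmat_mulE; congr (a1 *m _ + a2 *m _);
apply/matrixP => i j; rewrite !mxE.
  by rewrite (H i _ (lexx _) (le_len i)).1 mulrC.
by rewrite (H i _ (lexx _) (le_len i)).2 mulrC.
Qed.

Lemma esol_square_integrable i lam u p (f : R -> R[i]) :
  edge_sol i lam u p f -> square_integrable (vertex G i) (tip G i) u.
Proof. by move=> [/acC_abs[h1 h2] _]; exact: ac_square_integrable. Qed.

Lemma kernel_shifted lam (c : 'cV[R[i]]_n) : Amat lam *m c = 0 ->
  shifted_operator G B lam (fun i x => c i 0 * (psi i lam).1 x) (fun _ _ => 0).
Proof.
move=> Kc; apply/shifted_operatorP.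
have H i : edge_sol i lam (fun x => c i 0 * (psi i lam).1 x)
    (fun x => c i 0 * (psi i lam).2 x) (fun=> 0).
  have [H1 _ _] := psiP g h len iV i lam.
  by apply: esol_congr (esolZ (c i 0) H1) => // y; rewrite mulr0.
split.
  move=> i; apply: square_integrable_lin; last exact: esol_square_integrable (H i).
  by apply: ac_square_integrable; exact: abs_cont_cst.
exists (fun i x => c i 0 * (psi i lam).2 x); split=> //.
  rewrite -[RHS]Kc; exact: (@kernel_vertex lam
    (fun i x => c i 0 * (psi i lam).1 x) (fun i x => c i 0 * (psi i lam).2 x)).
move=> i; have [_ -> ->] := psiP g h len iV i lam.
by rewrite mulrN mulrN mulrCA [X in _ - X]mulrCA [g 0 i * h 0 i]mulrC subrr.
Qed.

Lemma shifted_kernel lam (u : graph_fun R n) :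
  shifted_operator G B lam u (fun _ _ => 0) ->
  exists2 c : 'cV[R[i]]_n, Amat lam *m c = 0 &
    eq_on_graph G u (fun i x => c i 0 * (psi i lam).1 x).
Proof.
move=> /shifted_operatorP[_ [du [H1 H2 H3]]].
have [c Hc] := sol_kernel H1 H3.
exists c; first by rewrite -(kernel_vertex Hc).
by move=> i x; rewrite in_itv/= => /andP[ax xb]; rewrite (Hc i x ax xb).1.
Qed.

Lemma psi_coord_inj lam (c d : 'cV[R[i]]_n) :
  eq_on_graph G (fun i x => c i 0 * (psi i lam).1 x)
    (fun i x => d i 0 * (psi i lam).1 x) -> c = d.
Proof.
move=> H; apply/matrixP => i j; rewrite ord1.
have [x xab nz] := psi_neq0 len iV bnz i lam.
by apply: (mulIf nz); apply: (H i x); rewrite in_itv.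
Qed.

(** A basis of the kernel of [Amat], read as coordinates with respect to the psi_i, is a basis of
    the eigenspace. The transpose appears because [kermx] acts on rows. *)
Lemma eigen_multP (m : R) : eigen_mult G B m (mult m%:C%C).
Proof.
pose K := row_base (kermx (Amat m%:C%C)^T).
have -> : mult m%:C%C = \rank (kermx (Amat m%:C%C)^T).
  by rewrite mxrank_ker mxrank_tr.
exists (fun k i x => K k i * (psi i m%:C%C).1 x).
  move=> k /=.
  have := @kernel_shifted m%:C%C (row k K)^T.
  rewrite (_ : (fun i x => (row k K)^T i 0 * _) = (fun i x => K k i * (psi i m%:C%C).1 x)); last first.
    by apply/funext => i; apply/funext => x; rewrite !mxE.
  apply; apply: trmx_inj; rewrite trmx_mul trmxK trmx0.
  apply/sub_kermxP; apply: submx_trans (row_sub _ _) _.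
  by rewrite eq_row_base.
move=> u /= /shifted_kernel[c Kc Hc].
have : (c^T <= K)%MS.
  by rewrite eq_row_base; apply/sub_kermxP; rewrite -trmx_mul Kc trmx0.
case/submxP => D cD.
have sumE (E : 'rV_(\rank (kermx (Amat m%:C%C)^T))) i x :
    \sum_k E 0 k * (K k i * (psi i m%:C%C).1 x) = (E *m K)^T i 0 * (psi i m%:C%C).1 x.
  by rewrite !mxE mulr_suml; apply: eq_bigr => k _; rewrite mulrA.
exists D; split.
  by move=> i x xab; rewrite (Hc i x xab) sumE -cD trmxK.
move=> E HE.
have : c = (E *m K)^T.
  apply: (@psi_coord_inj m%:C%C) => i x xab.
  by rewrite -(Hc i x xab) (HE i x xab) sumE.
move=> /(congr1 trmx); rewrite trmxK cD => /(row_free_inj (row_base_free _)).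
exact.
Qed.

(** A nonzero kernel vector would give a second solution of the problem with zero source. *)
Lemma resolvent_mult0 lam : resolvent_set G B lam -> mult lam = 0%N.
Proof.
move=> [c Hc]; apply: mult0P => // d Kd.
have L0 : in_L2 G (fun _ _ => 0).
  by move=> i; apply: ac_square_integrable; exact: abs_cont_cst.
have [u [_ _ Hu]] := Hc _ L0.
have h1 := Hu _ (kernel_shifted Kd).
have h2 := Hu _ (kernel_shifted (mulmx0 _ _)).
apply: (@psi_coord_inj lam) => i x xab.
by rewrite (h1 i x xab) -(h2 i x xab).
Qed.

End Operator.

Section Resolvent.
Context {R : realType}.
Notation mu := (@lebesgue_measure R).
Variables (n : nat) (G : star_graph R n) (a1 a2 : 'M[R[i]]_n) (g h : 'rV[R[i]]_n).
Hypothesis len : forall i, vertex G i < tip G i.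
Hypothesis iV : forall i, L1 (vertex G i) (tip G i) (potential G i).
Hypothesis rk : \rank (row_mx a1 a2) = n.
Hypothesis sa : a1 *m map_mx Num.conj a2^T = a2 *m map_mx Num.conj a1^T.
Hypothesis bsa : forall i, g 0 i * Num.conj (h 0 i) = h 0 i * Num.conj (g 0 i).
Hypothesis bnz : forall i, ~ (g 0 i = 0 /\ h 0 i = 0).

Let B := BoundaryCond a1 a2 (diag_mx g) (diag_mx h).
Let le_len i : vertex G i <= tip G i := ltW (len i).
Local Notation psi := (psi G g h).
Local Notation Amat := (Amat G a1 a2 g h).
Local Notation mult := (mult G a1 a2 g h).
Local Notation edge_sol i := (esol (vertex G i) (tip G i) (potential G i)).

Lemma ler_sum_term (F : 'I_n -> R) i : (forall j, 0 <= F j) -> F i <= \sum_j F j.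
Proof. by move=> F0; rewrite (bigD1 i)//= lerDl sumr_ge0. Qed.

Lemma L2_sqnormE (f : graph_fun R n) (S : 'I_n -> R -> R) : in_L2 G f ->
  (forall i, ac_deriv (vertex G i) (tip G i) (S i) (fun x => sqnormC (f i x))) ->
  L2_sqnorm G f = (\sum_i (S i (tip G i) - S i (vertex G i)))%:E.
Proof.
move=> Lf HS; rewrite /L2_sqnorm -sumEFin; apply: eq_bigr => i _.
exact: (integral_sqnormC (le_len i) (Lf i) (HS i)).
Qed.

(** Zero tip data leave only the source term of [esol_bound], which [cauchy_schwarz] controls in
    L^2. *)
Lemma source_bound lam : exists2 C : 'I_n -> R, (forall i, 0 <= C i) &
  forall i u p f, L1C (vertex G i) (tip G i) f -> edge_sol i lam u p f ->
  u (tip G i) = 0 -> p (tip G i) = 0 ->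
  forall Phi S, ac_deriv (vertex G i) (tip G i) Phi (fun x => `|Re (f x)| + `|Im (f x)|) ->
  ac_deriv (vertex G i) (tip G i) S (fun x => sqnormC (f x)) ->
  forall x, vertex G i <= x -> x <= tip G i ->
  normc (u x) <= C i * Num.sqrt (S (tip G i) - S (vertex G i)) /\
  normc (p x) <= C i * Num.sqrt (S (tip G i) - S (vertex G i)).
Proof.
have /choice[C HC] : forall i, exists C : R, 0 <= C /\
  forall u p f, L1C (vertex G i) (tip G i) f -> edge_sol i lam u p f ->
  u (tip G i) = 0 -> p (tip G i) = 0 ->
  forall Phi S, ac_deriv (vertex G i) (tip G i) Phi (fun x => `|Re (f x)| + `|Im (f x)|) ->
  ac_deriv (vertex G i) (tip G i) S (fun x => sqnormC (f x)) ->
  forall x, vertex G i <= x -> x <= tip G i ->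
  normc (u x) <= C * Num.sqrt (S (tip G i) - S (vertex G i)) /\
  normc (p x) <= C * Num.sqrt (S (tip G i) - S (vertex G i)).
  move=> i; have [C C0 HC] := esol_bound (iV i) (normc lam).
  exists (C * Num.sqrt (2 * (tip G i - vertex G i))); split.
    by rewrite mulr_ge0// sqrtr_ge0.
  move=> u p f Lf Hu ub pb Phi S HPhi HS x ax xb.
  have [h1 h2] := HC lam (lexx _) u p f Lf Hu Phi HPhi x ax xb.
  have key : C * (normc (u (tip G i)) + normc (p (tip G i)) + (Phi (tip G i) - Phi x)) <=
      C * Num.sqrt (2 * (tip G i - vertex G i)) * Num.sqrt (S (tip G i) - S (vertex G i)).
    rewrite ub pb normc0 !add0r -mulrA ler_wpM2l//.
    apply: le_trans (cauchy_schwarz (le_len i) HPhi HS).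
    rewrite lerD2l lerN2; apply: (ac_mono HPhi) => //.
    by apply: ae_onW => y _; rewrite addr_ge0.
  by split; [exact: le_trans h1 key|exact: le_trans h2 key].
by exists C => i; [case: (HC i)|exact: (HC i).2].
Qed.

(** The solution is [phi], with the given source and zero tip data, plus the combination of the
    psi_i whose coefficients [c] cancel the vertex defect of [phi] through the inverse of [Amat].
    Two solutions differ by a kernel vector, hence agree. *)
Lemma mult0_resolvent lam : mult lam = 0%N -> resolvent_set G B lam.
Proof.
move=> m0.
have uA : Amat lam \in unitmx.
  have : charD G a1 a2 g h lam != 0 by rewrite charD_neq0// m0.
  by rewrite unitmxE unitfE.
have [C C0 HC] := source_bound lam.
have /choice[M HM] : forall i, exists M : R, 0 <= M /\
    forall x, vertex G i <= x -> x <= tip G i -> normc ((psi i lam).1 x) <= M.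
  move=> i; have [[/acC_abs[p1 p2] _] _ _] := psiP g h len iV i lam.
  have [M1 M10 HM1] := abs_cont_bounded p1; have [M2 M20 HM2] := abs_cont_bounded p2.
  exists (M1 + M2); split; first by rewrite addr_ge0.
  move=> x ax xb; rewrite (le_trans (normc_le _))// lerD//; [exact: HM1|exact: HM2].
pose E1 := invmx (Amat lam) *m a1; pose E2 := invmx (Amat lam) *m a2.
pose D := \sum_i \sum_j (normc (E1 i j) + normc (E2 i j)).
pose Cs := \sum_i C i; pose Ms := \sum_i M i.
have N0 i j : 0 <= normc (E1 i j) + normc (E2 i j) by rewrite addr_ge0// normc_ge0.
have D0 : 0 <= D by do 2 (apply: sumr_ge0 => ? _).
have Cs0 : 0 <= Cs by apply: sumr_ge0.
have Ms0 : 0 <= Ms by apply: sumr_ge0 => i _; case: (HM i).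
pose Z := Cs + D * Cs * Ms.
have Z0 : 0 <= Z by rewrite addr_ge0// !mulr_ge0.
(* Pointwise, |u_i|^2 is at most [Z ^+ 2] times the squared norm of [f]; integration contributes the
   lengths of the edges. *)
exists (Z ^+ 2 * \sum_i (tip G i - vertex G i)) => f Lf.
have LfC i : L1C (vertex G i) (tip G i) (f i) := square_integrable_L1C (Lf i).
have /choice[S HS] : forall i, exists S,
    ac_deriv (vertex G i) (tip G i) S (fun x => sqnormC (f i x)).
  move=> i; have /square_integrableP[_ _ h3] := Lf i.
  by have [S HS _] := primitive_exists 0 h3; exists S.
pose T := \sum_i (S i (tip G i) - S i (vertex G i)).
have S0 i : 0 <= S i (tip G i) - S i (vertex G i).
  rewrite subr_ge0; apply: (ac_mono (HS i)) => //; apply: ae_onW => x _.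
  exact: sqnormC_ge0.
have T0 : 0 <= T by apply: sumr_ge0.
pose phi i := usol (vertex G i) (tip G i) (potential G i) lam (f i) 0 0.
have phiP i := usolP (le_len i) (iV i) lam 0 0 (LfC i).
have phi_bound i x : vertex G i <= x -> x <= tip G i ->
    normc ((phi i).1 x) <= Cs * Num.sqrt T /\ normc ((phi i).2 x) <= Cs * Num.sqrt T.
  move=> ax xb; have [H1 e1 e2] := phiP i.
  have [Phi HPhi _] := primitive_exists 0 (L1D (L1_abs (LfC i).1) (L1_abs (LfC i).2)).
  have [h1 h2] := HC i _ _ _ (LfC i) H1 e1 e2 _ _ HPhi (HS i) x ax xb.
  have key : C i * Num.sqrt (S i (tip G i) - S i (vertex G i)) <= Cs * Num.sqrt T.
    apply: ler_pM; [exact: C0|exact: sqrtr_ge0|exact: ler_sum_term|].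
    rewrite ler_wsqrtr//.
    exact: (ler_sum_term (F := fun i => S i (tip G i) - S i (vertex G i))).
  by split; [exact: le_trans h1 key|exact: le_trans h2 key].
pose w1 := \col_i (phi i).1 (vertex G i); pose w2 := \col_i (phi i).2 (vertex G i).
pose c := - (E1 *m w1 + E2 *m w2).
have cb i : normc (c i 0) <= D * Cs * Num.sqrt T.
  rewrite /c mxE normcN mxE [X in normc (X + _)]mxE [X in normc (_ + X)]mxE.
  rewrite -big_split/= (le_trans (normc_sum _ _))//.
  apply: (@le_trans _ _ (\sum_j (normc (E1 i j) + normc (E2 i j)) * (Cs * Num.sqrt T))).
    apply: ler_sum => j _; rewrite (le_trans (le_normcD _ _))// !normcM mulrDl.
    have [h1 h2] := phi_bound j (vertex G j) (lexx _) (le_len j).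
    by rewrite !mxE; apply: lerD; rewrite ler_wpM2l ?normc_ge0.
  rewrite -mulr_suml -mulrA ler_wpM2r// ?mulr_ge0// ?sqrtr_ge0//.
  apply: (ler_sum_term (F := fun i => \sum_j (normc (E1 i j) + normc (E2 i j)))) => k.
  by apply: sumr_ge0.
have cE : c = - (E1 *m w1 + E2 *m w2) by [].
clearbody c.
pose u i x := (phi i).1 x + c i 0 * (psi i lam).1 x.
pose du i x := (phi i).2 x + c i 0 * (psi i lam).2 x.
have Hu i : edge_sol i lam (u i) (du i) (f i).
  have [H1 _ _] := phiP i; have [H2 _ _] := psiP g h len iV i lam.
  apply: esol_congr (esol_lin (c i 0) H2 H1) => x; [exact: addrC|exact: addrC|].
  by rewrite mulr0 add0r.
have ub i x : vertex G i <= x -> x <= tip G i -> sqnormC (u i x) <= Z ^+ 2 * T.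
  move=> ax xb; have [h1 _] := phi_bound i x ax xb.
  have h2 : normc (u i x) <= Z * Num.sqrt T.
    rewrite /u (le_trans (le_normcD _ _))// normcM /Z mulrDl lerD//.
    have -> : D * Cs * Ms * Num.sqrt T = (D * Cs * Num.sqrt T) * Ms by rewrite mulrAC.
    apply: ler_pM; [exact: normc_ge0|exact: normc_ge0|exact: cb|].
    have [M0 HMi] := HM i; apply: (le_trans (HMi x ax xb)); apply: (ler_sum_term (F := M)) => k.
    by case: (HM k).
  rewrite sqnormC_normc -[T]sqr_sqrtr// -exprMn lerXn2r// ?nnegrE ?normc_ge0//.
  by rewrite mulr_ge0// sqrtr_ge0.
have Lu : in_L2 G u by move=> i; exact: esol_square_integrable (Hu i).
have vu : a1 *m (\col_i u i (vertex G i)) + a2 *m (\col_i du i (vertex G i)) = 0.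
  have e1 : \col_i u i (vertex G i) = w1 + \col_i (c i 0 * (psi i lam).1 (vertex G i)).
    by apply/matrixP => i j; rewrite /w1 !mxE.
  have e2 : \col_i du i (vertex G i) = w2 + \col_i (c i 0 * (psi i lam).2 (vertex G i)).
    by apply/matrixP => i j; rewrite /w2 !mxE.
  rewrite e1 e2 !mulmxDr addrACA.
  have := @kernel_vertex R n G a1 a2 g h len lam
    (fun i x => c i 0 * (psi i lam).1 x) (fun i x => c i 0 * (psi i lam).2 x) c.
  move=> ->; last by [].
  rewrite cE mulmxN mulmxDr /E1 /E2 -(mulmxA _ a1) -(mulmxA _ a2).
  by rewrite !(mulKVmx uA) subrr.
have tu i : g 0 i * u i (tip G i) + h 0 i * du i (tip G i) = 0.
  have [_ e1 e2] := phiP i; have [_ e3 e4] := psiP g h len iV i lam.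
  rewrite /u /du e1 e2 e3 e4 !add0r.
  by rewrite mulrN mulrN mulrCA [X in _ - X]mulrCA [g 0 i * h 0 i]mulrC subrr.
exists u; split.
- apply/shifted_operatorP; split; first by move=> i; exact: square_integrable_lin.
  by exists du.
- have /choice[SU HSU] : forall i, exists S,
      ac_deriv (vertex G i) (tip G i) S (fun x => sqnormC (u i x)).
    by move=> i; exact: sqnormC_prim (Hu i).1.
  rewrite (L2_sqnormE Lu HSU) (L2_sqnormE Lf HS) -EFinM lee_fin.
  rewrite mulrAC -/T mulr_sumr; apply: ler_sum => i _.
  rewrite mulrBr; apply: (le_trans (ler_norm _)).
  apply: (ac_compare (HSU i) (ac_derivZ (Z ^+ 2 * T) (ac_deriv_id _ _))) => //.
  apply: ae_onW => x; rewrite in_itv/= => /andP[/ltW ax /ltW xb].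
  by rewrite ger0_norm ?sqnormC_ge0// mulr1 ub.
- move=> v /shifted_operatorP[_ [dv [v1 v2 v3]]].
  have Hd i : edge_sol i lam (fun x => v i x - u i x) (fun x => dv i x - du i x) (fun=> 0).
    by apply: esol_congr (esolB (v1 i) (Hu i)) => // x; rewrite subrr.
  have td i : g 0 i * (v i (tip G i) - u i (tip G i)) +
      h 0 i * (dv i (tip G i) - du i (tip G i)) = 0.
    by rewrite !mulrBr addrACA -opprD v3 tu subrr.
  have [d Hd'] := sol_kernel len iV bnz Hd td.
  have := kernel_vertex a1 a2 len Hd'.
  have -> : \col_i (v i (vertex G i) - u i (vertex G i)) =
      \col_i v i (vertex G i) - \col_i u i (vertex G i).
    by apply/matrixP => i j; rewrite !mxE.
  have -> : \col_i (dv i (vertex G i) - du i (vertex G i)) =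
      \col_i dv i (vertex G i) - \col_i du i (vertex G i).
    by apply/matrixP => i j; rewrite !mxE.
  rewrite !mulmxBr addrACA -opprD v2 vu subrr => /esym/(congr1 (mulmx (invmx (Amat lam)))).
  rewrite (mulKmx uA) mulmx0 => d0 i x; rewrite in_itv/= => /andP[ax xb].
  apply/eqP; rewrite -subr_eq0; apply/eqP.
  by rewrite (Hd' i x ax xb).1 d0 mxE mul0r.
Qed.

End Resolvent.

(** * Splitting the graph *)

Section ColumnReplacement.
Variables (F : fieldType) (n : nat).
Implicit Types (M : 'M[F]_n) (v w c : 'cV[F]_n).

Definition colset M (j : 'I_n) v : 'M[F]_n :=
  \matrix_(i, k) (if k == j then v i 0 else M i k).

Lemma colsetE M j v i k : colset M j v i k = if k == j then v i 0 else M i k.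
Proof. by rewrite mxE. Qed.

Lemma det_colset_lin M j v w (b c : F) :
  \det (colset M j (b *: v + c *: w)) =
  b * \det (colset M j v) + c * \det (colset M j w).
Proof.
rewrite -det_tr -[\det (colset M j v)]det_tr -[\det (colset M j w)]det_tr.
apply: (determinant_multilinear (i0 := j)).
- by apply/rowP => k; rewrite !mxE eqxx.
- by apply/matrixP => i k; rewrite !mxE eq_sym (negbTE (neq_lift _ _)).
- by apply/matrixP => i k; rewrite !mxE eq_sym (negbTE (neq_lift _ _)).
Qed.

Lemma colset_id M j : colset M j (col j M) = M.
Proof. by apply/matrixP => i k; rewrite !mxE; case: eqP => // ->. Qed.

Lemma det0_kernel M : \det M = 0 <-> exists2 c : 'cV_n, c != 0 & M *m c = 0.
Proof.
rewrite -det_tr; split=> [/eqP/det0P[v v0 vM]|[c c0 Mc]].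
  exists v^T; first by rewrite trmx_eq0.
  by apply: trmx_inj; rewrite trmx_mul trmxK vM trmx0.
apply/eqP/det0P; exists c^T; first by rewrite trmx_eq0.
by rewrite -trmx_mul Mc trmx0.
Qed.

Lemma colset_mul0 M j v c : c j 0 = 0 -> colset M j v *m c = M *m c.
Proof.
move=> cj; apply/matrixP => i k; rewrite !mxE ord1; apply: eq_bigr => m _.
by rewrite mxE; case: eqP => // ->; rewrite cj !mulr0.
Qed.

(** A kernel vector with zero [j]-th coordinate does not see the replaced column, so it would lie in
    the kernel of [M]; any other can be normalized. *)
Lemma det_colset0 M j v : \det M != 0 ->
  \det (colset M j v) = 0 <-> exists2 c : 'cV_n, c j 0 = 1 & colset M j v *m c = 0.
Proof.
move=> M0; rewrite det0_kernel; split=> [[c c0 Mc]|[c cj Mc]]; last first.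
  exists c => //; apply/eqP => c0; move: cj; rewrite c0 mxE => /esym/eqP.
  by rewrite oner_eq0.
have [cj|cj] := eqVneq (c j 0) 0.
  move: M0; suff -> : \det M = 0 by rewrite eqxx.
  by apply/det0_kernel; exists c => //; rewrite -(colset_mul0 _ v cj).
exists ((c j 0)^-1 *: c); first by rewrite mxE mulVf.
by rewrite -scalemxAr Mc scaler0.
Qed.

End ColumnReplacement.

Lemma Amat_entry (R : realType) (n : nat) (G : star_graph R n)
    (a1 a2 : 'M[R[i]]_n) (g h : 'rV[R[i]]_n) lam i k :
  Amat G a1 a2 g h lam i k =
  a1 i k * (psi G g h k lam).1 (vertex G k) + a2 i k * (psi G g h k lam).2 (vertex G k).
Proof. by rewrite /Amat bmat_entry !mxE. Qed.

Section Splitting.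
Context {R : realType}.
Variables (n : nat) (l : 'I_n -> R) (V : 'I_n -> R -> R) (a1 a2 : 'M[R[i]]_n)
  (g h : 'rV[R[i]]_n) (j : 'I_n) (s : R).
Hypothesis l_gt0 : forall i, 0 < l i.
Hypothesis iV : forall i, L1 0 (l i) (V i).
Hypothesis rk : \rank (row_mx a1 a2) = n.
Hypothesis sa : a1 *m map_mx Num.conj a2^T = a2 *m map_mx Num.conj a1^T.
Hypothesis bsa : forall i, g 0 i * Num.conj (h 0 i) = h 0 i * Num.conj (g 0 i).
Hypothesis bnz : forall i, ~ (g 0 i = 0 /\ h 0 i = 0).
Hypothesis s_gt0 : 0 < s.
Hypothesis s_lt : s < l j.

Let G0 := Omega l V.
Let G1 := Omega1 l V j s.
Let G2 := Omega2 l V j s.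
Definition tip1 (x : 'rV[R[i]]_n) : 'rV[R[i]]_1 := const_mx (x 0 j).
(** With [y = 1] for [g] and [y = 0] for [h] this encodes the Dirichlet condition at [s]. *)
Definition tip2 (x : 'rV[R[i]]_n) (y : R[i]) : 'rV[R[i]]_n :=
  \row_i (if i == j then y else x 0 i).

Lemma len0 i : vertex G0 i < tip G0 i. Proof. exact: l_gt0. Qed.
Lemma len1 i : vertex G1 i < tip G1 i. Proof. exact: s_lt. Qed.
Lemma len2 i : vertex G2 i < tip G2 i. Proof. by rewrite /=; case: ifP. Qed.

Lemma iV0 i : L1 (vertex G0 i) (tip G0 i) (potential G0 i).
Proof. exact: iV. Qed.

Lemma iV1 i : L1 (vertex G1 i) (tip G1 i) (potential G1 i).
Proof. by apply: L1_sub (iV j) => //; exact: ltW. Qed.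

Lemma iV2 i : L1 (vertex G2 i) (tip G2 i) (potential G2 i).
Proof. by apply: L1_sub (iV i) => //=; case: eqP => // ->; exact: ltW. Qed.

Lemma rk1 : \rank (row_mx (1%:M : 'M[R[i]]_1) (0 : 'M[R[i]]_1)) = 1%N.
Proof.
apply/eqP; rewrite eqn_leq rank_leq_row/= lt0n mxrank_eq0; apply/eqP.
move=> /(congr1 (fun X : 'M[R[i]]_(1, 1 + 1) => X 0 (lshift 1 0))).
by rewrite row_mxEl !mxE eqxx => /eqP; rewrite oner_eq0.
Qed.

Lemma sa1 : (1%:M : 'M[R[i]]_1) *m map_mx Num.conj (0 : 'M[R[i]]_1)^T =
  0 *m map_mx Num.conj (1%:M : 'M[R[i]]_1)^T.
Proof. by rewrite mul0mx mul1mx trmx0 map_mx0. Qed.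

Lemma bsa1 (i : 'I_1) : tip1 g 0 i * Num.conj (tip1 h 0 i) = tip1 h 0 i * Num.conj (tip1 g 0 i).
Proof. by rewrite !mxE. Qed.

Lemma bnz1 (i : 'I_1) : ~ (tip1 g 0 i = 0 /\ tip1 h 0 i = 0).
Proof. rewrite !mxE; exact: bnz. Qed.

Lemma bsa2 (i : 'I_n) : tip2 g 1 0 i * Num.conj (tip2 h 0 0 i) =
  tip2 h 0 0 i * Num.conj (tip2 g 1 0 i).
Proof. by rewrite !mxE; case: ifP => // _; rewrite conjC0 mulr0 mul0r. Qed.

Lemma bnz2 (i : 'I_n) : ~ (tip2 g 1 0 i = 0 /\ tip2 h 0 0 i = 0).
Proof.
rewrite !mxE; case: ifP => [_ [/eqP]|_]; last exact: bnz.
by rewrite oner_eq0.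
Qed.

Lemma esol_sub a b a' b' W lam u p (f : R -> R[i]) : a <= a' -> b' <= b ->
  esol a b W lam u p f -> esol a' b' W lam u p f.
Proof.
by move=> aa bb [[h1 h2] [h3 h4]]; split; split; exact: ac_deriv_sub aa bb _.
Qed.

Definition D0 := charD G0 a1 a2 g h.
Definition D1 := charD G1 1%:M 0 (tip1 g) (tip1 h).
Definition D2 := charD G2 a1 a2 (tip2 g 1) (tip2 h 0).

Local Notation psi1 := (psi G1 (tip1 g) (tip1 h) ord0).

(* The solution on [0, s] with u(s) = 1 and u'(s) = y; M_2 is the y for which
   it can be completed to a solution on Omega_2. *)
Definition omega (y : R[i]) lam := usol 0 s (V j) lam (fun=> 0) 1 y.

(** Column [j] of [bmat] when the function on edge [j] has value [x] and derivative [y] at the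
    common vertex. *)
Definition colv (x y : R[i]) : 'cV[R[i]]_n := x *: col j a1 + y *: col j a2.

Local Notation A2 := (Amat G2 a1 a2 (tip2 g 1) (tip2 h 0)).

Lemma psi2P lam : [/\ esol 0 s (V j) lam
    (psi G2 (tip2 g 1) (tip2 h 0) j lam).1 (psi G2 (tip2 g 1) (tip2 h 0) j lam).2 (fun=> 0),
    (psi G2 (tip2 g 1) (tip2 h 0) j lam).1 s = 0 &
    (psi G2 (tip2 g 1) (tip2 h 0) j lam).2 s = -1].
Proof. by have := psiP (tip2 g 1) (tip2 h 0) len2 iV2 j lam; rewrite !mxE /= eqxx. Qed.

Lemma omegaP y lam : [/\ esol 0 s (V j) lam (omega y lam).1 (omega y lam).2 (fun=> 0),
    (omega y lam).1 s = 1 & (omega y lam).2 s = y].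
Proof.
apply: usolP; [exact: ltW|have := iV2 j; by rewrite /= eqxx|exact: L1C0].
Qed.

Lemma uniq_s lam u p v q : esol 0 s (V j) lam u p (fun=> 0) ->
  esol 0 s (V j) lam v q (fun=> 0) -> u s = v s -> p s = q s ->
  forall x, 0 <= x -> x <= s -> u x = v x /\ p x = q x.
Proof.
move=> Hu Hv; apply: (esol_unique (ltW s_gt0) _ (@L1C0 _ _ _) Hu Hv).
by have := iV2 j; rewrite /= eqxx.
Qed.

Lemma psi2_neq lam i : i != j ->
  psi G2 (tip2 g 1) (tip2 h 0) i lam = psi G0 g h i lam.
Proof. by move=> ij; rewrite /psi !mxE /= (negbTE ij). Qed.

(* On [0, s], psi_j equals psi_j(s) omega_0 - psi_j'(s) psi2_j. *)
Lemma psi_split lam :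
  colv ((psi G0 g h j lam).1 0) ((psi G0 g h j lam).2 0) =
  (psi1 lam).1 s *: colv ((omega 0 lam).1 0) ((omega 0 lam).2 0) +
  - (psi1 lam).2 s *: colv ((psi G2 (tip2 g 1) (tip2 h 0) j lam).1 0)
                           ((psi G2 (tip2 g 1) (tip2 h 0) j lam).2 0).
Proof.
have [H0 e0 e0'] := psiP g h len0 iV0 j lam.
have [H1 e1 e1'] := psiP (tip1 g) (tip1 h) len1 iV1 ord0 lam.
rewrite !mxE /= in e0 e0' e1 e1'.
have sl : s <= l j := ltW s_lt.
have [f1 f2] : (psi G0 g h j lam).1 s = (psi1 lam).1 s /\
    (psi G0 g h j lam).2 s = (psi1 lam).2 s.
  apply: (esol_unique sl (iV1 ord0) (@L1C0 _ _ _)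
     (esol_sub (ltW s_gt0) (lexx (l j)) H0) H1) => //.
    by rewrite e0 e1.
  by rewrite e0' e1'.
have [Ho o1 o2] := omegaP 0 lam; have [H2 p1 p2] := psi2P lam.
have H3 := esol_lin (- (psi1 lam).2 s) H2 (esolZ ((psi1 lam).1 s) Ho).
have H3' : esol 0 s (V j) lam _ _ (fun=> 0) :=
  esol_congr (fun=> erefl) (fun=> erefl)
    (fun x => etrans (congr2 +%R (mulr0 _) (mulr0 _)) (addr0 _)) H3.
have [] := uniq_s (esol_sub (lexx 0) sl H0) H3' _ _ (lexx 0) (ltW s_gt0).
- by rewrite p1 o1 mulr0 add0r mulr1.
- by rewrite p2 o2 mulr0 addr0 mulrN1 opprK.
move=> -> ->; rewrite /colv !scalerDr !scalerDl !scalerA.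
rewrite [LHS]addrACA; exact: addrC.
Qed.

Lemma omega_split m lam :
  colv ((omega m lam).1 0) ((omega m lam).2 0) =
  1 *: colv ((omega 0 lam).1 0) ((omega 0 lam).2 0) +
  - m *: colv ((psi G2 (tip2 g 1) (tip2 h 0) j lam).1 0)
              ((psi G2 (tip2 g 1) (tip2 h 0) j lam).2 0).
Proof.
have [Ho o1 o2] := omegaP 0 lam; have [H2 p1 p2] := psi2P lam.
have [Hm m1 m2] := omegaP m lam.
have H3 := esol_lin (- m) H2 Ho.
have H3' : esol 0 s (V j) lam _ _ (fun=> 0) :=
  esol_congr (fun=> erefl) (fun=> erefl)
    (fun x => etrans (congr2 +%R (mulr0 _) erefl) (addr0 _)) H3.
have [] := uniq_s Hm H3' _ _ (lexx 0) (ltW s_gt0).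
- by rewrite p1 o1 m1 mulr0 add0r.
- by rewrite p2 o2 m2 addr0 mulrN1 opprK.
move=> -> ->; rewrite /colv scale1r !scalerDr !scalerDl !scalerA.
rewrite [LHS]addrACA; exact: addrC.
Qed.

Lemma colset_A2 lam x y u : (forall i, i != j -> u i = psi G0 g h i lam) ->
  (u j).1 0 = x -> (u j).2 0 = y ->
  colset (A2 lam) j (colv x y) =
  bmat a1 a2 (\row_i (u i).1 0) (\row_i (u i).2 0).
Proof.
move=> ui uj1 uj2; apply/matrixP => i k; rewrite bmat_entry colsetE.
have [->|kj] := eqVneq k j.
  by rewrite !mxE uj1 uj2 mulrC [X in _ + X]mulrC.
by rewrite Amat_entry psi2_neq// !mxE ui.
Qed.

Lemma Amat0E lam : Amat G0 a1 a2 g h lam =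
  colset (A2 lam) j (colv ((psi G0 g h j lam).1 0) ((psi G0 g h j lam).2 0)).
Proof.
by rewrite (colset_A2 (u := fun i => psi G0 g h i lam)).
Qed.

Lemma A2E lam : A2 lam = colset (A2 lam) j
  (colv ((psi G2 (tip2 g 1) (tip2 h 0) j lam).1 0)
        ((psi G2 (tip2 g 1) (tip2 h 0) j lam).2 0)).
Proof.
rewrite -[LHS](colset_id _ j); congr colset; apply/matrixP => i k.
by rewrite mxE Amat_entry !mxE mulrC [X in _ + X]mulrC.
Qed.

Lemma D1E lam : D1 lam = (psi1 lam).1 s.
Proof.
by rewrite /D1 /charD det_mx11 Amat_entry !mxE eqxx /= mul0r addr0 mul1r.
Qed.

(** The characteristic determinant of Omega_2 with a Neumann in place of the Dirichlet condition at
    [s]: [omega 0] has data (1, 0) there. *)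
Definition D3 lam := \det (colset (A2 lam) j
  (colv ((omega 0 lam).1 0) ((omega 0 lam).2 0))).

Lemma D0E lam : D0 lam = (psi1 lam).1 s * D3 lam - (psi1 lam).2 s * D2 lam.
Proof.
rewrite /D0 /charD Amat0E psi_split det_colset_lin mulNr.
by congr (_ - _ * _); rewrite -A2E.
Qed.

Lemma D3E m lam :
  \det (colset (A2 lam) j (colv ((omega m lam).1 0) ((omega m lam).2 0))) =
  D3 lam - m * D2 lam.
Proof.
by rewrite omega_split det_colset_lin mul1r mulNr; congr (_ - _ * _); rewrite -A2E.
Qed.

Lemma solutionP m (G : star_graph R m) lam (u du : graph_fun R m) :
  solution G lam u du <->
  forall i, esol (vertex G i) (tip G i) (potential G i) lam (u i) (du i) (fun=> 0).
Proof.
have E i : (fun x => lam * u i x) = (fun x => 0 + lam * u i x).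
  by apply/funext => x; rewrite add0r.
split=> H i.
  by apply/edge_eqP; rewrite -E; exact: H.
suff : edge_eq (vertex G i) (tip G i) (potential G i) (u i) (du i)
  (fun x => lam * u i x) by [].
by rewrite E; apply/edge_eqP; exact: H.
Qed.

(** Solutions satisfying the condition at l_j are multiples of [psi1], so the set defining [M1] is a
    singleton. *)
Lemma M1E lam : D1 lam != 0 ->
  M1 l V g h j s lam = - (psi1 lam).2 s / (psi1 lam).1 s.
Proof.
rewrite D1E => p0.
have [H1 e1 e1'] := psiP (tip1 g) (tip1 h) len1 iV1 ord0 lam.
apply: xget_unique => [f|m /(_ 1)[u [du [/solutionP Hu us tu dus]]]].
  exists (fun _ x => f / (psi1 lam).1 s * (psi1 lam).1 x).
  exists (fun _ x => f / (psi1 lam).1 s * (psi1 lam).2 x).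
  split.
  - apply/solutionP => i; rewrite ord1.
    by apply: esol_congr (esolZ _ H1) => // x; rewrite mulr0.
  - by rewrite divfK.
  - have -> : (psi1 lam).1 (l j) = h 0 j by rewrite [LHS]e1 mxE.
    have -> : (psi1 lam).2 (l j) = - g 0 j by rewrite [LHS]e1' mxE.
    by rewrite mulrN mulrN mulrCA [X in _ - X]mulrCA [g 0 j * _]mulrC subrr.
  - by rewrite mulNr mulNr mulrAC [_ * f]mulrC mulrA.
have tu' : tip1 g 0 ord0 * u ord0 (tip G1 ord0) + tip1 h 0 ord0 * du ord0 (tip G1 ord0) = 0.
  by rewrite !mxE.
have [c Hc] := edge_kernel len1 iV1 bnz1 (Hu ord0) tu'.
have [us' dus'] := Hc s (lexx s) (ltW s_lt).
move: dus; rewrite mulr1 => <-; apply: (mulIf p0); rewrite divfK// dus' mulNr.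
by rewrite mulrAC -us' us mul1r.
Qed.

(** A number m qualifies for [M2] exactly when [A2] with column [j] built from [omega m] has a
    kernel vector of [j]-th coordinate 1. By [det_colset0] and [D3E] this means
    [D3 - m * D2 = 0]. *)
Lemma M2E lam : D2 lam != 0 -> M2 l V a1 a2 g h j s lam = D3 lam / D2 lam.
Proof.
move=> d0.
have colE m c : colset (A2 lam) j (colv ((omega m lam).1 0) ((omega m lam).2 0)) *m c =
   a1 *m (\col_i ((if i == j then omega m lam else psi G0 g h i lam).1 0 * c i 0)) +
   a2 *m (\col_i ((if i == j then omega m lam else psi G0 g h i lam).2 0 * c i 0)).
  rewrite (colset_A2 (u := fun i => if i == j then omega m lam else psi G0 g h i lam)).
  - rewrite bmat_mulE; congr (a1 *m _ + a2 *m _);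
    by apply/matrixP => i k; rewrite !mxE.
  - by move=> i /negbTE ->.
  - by rewrite eqxx.
  - by rewrite eqxx.
apply: xget_unique => [f|m /(_ 1)[u [du [/solutionP Hu vu tu us dus]]]].
  set m := D3 lam / D2 lam.
  have /(det_colset0 _ _ d0)[c cj] :
      \det (colset (A2 lam) j (colv ((omega m lam).1 0) ((omega m lam).2 0))) = 0.
    by rewrite D3E /m divfK// subrr.
  rewrite colE => Kc.
  pose U i := if i == j then omega m lam else psi G0 g h i lam.
  exists (fun i x => f * c i 0 * (U i).1 x), (fun i x => f * c i 0 * (U i).2 x).
  have [Ho o1 o2] := omegaP m lam.
  split.
  - apply/solutionP => i.
    have H : esol (vertex G2 i) (tip G2 i) (potential G2 i) lam (U i).1 (U i).2 (fun=> 0).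
      rewrite /U /=; have [->|ij] := eqVneq i j; first exact: Ho.
      by have [] := psiP g h len0 iV0 i lam.
    by apply: esol_congr (esolZ _ H) => // x; rewrite mulr0.
  - have -> : \col_i (f * c i 0 * (U i).1 0) = f *: (\col_i ((U i).1 0 * c i 0)).
      by apply/matrixP => i k; rewrite !mxE -mulrA [c i 0 * _]mulrC.
    have -> : \col_i (f * c i 0 * (U i).2 0) = f *: (\col_i ((U i).2 0 * c i 0)).
      by apply/matrixP => i k; rewrite !mxE -mulrA [c i 0 * _]mulrC.
    by rewrite -!scalemxAr -scalerDr Kc scaler0.
  - move=> i ij; rewrite /U (negbTE ij).
    have [_ e1 e2] := psiP g h len0 iV0 i lam; rewrite /= in e1 e2; rewrite e1 e2.
    by rewrite mulrN mulrN mulrCA [X in _ - X]mulrCA [g 0 i * _]mulrC subrr.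
  - by rewrite /U eqxx o1 cj !mulr1.
  - by rewrite /U eqxx o2 cj mulr1 mulrC.
have [Hm m1 m2] := omegaP m lam.
have Hj : esol 0 s (V j) lam (u j) (du j) (fun=> 0).
  have := Hu j; have -> : tip (Omega2 l V j s) j = s by rewrite /= eqxx.
  exact.
have [uj duj] : u j 0 = (omega m lam).1 0 /\ du j 0 = (omega m lam).2 0.
  apply: (uniq_s Hj Hm _ _ (lexx 0) (ltW s_gt0)); first by rewrite us m1.
  by rewrite dus m2 mulr1.
have /choice[c Hc] : forall i, exists c : R[i], i != j ->
    u i 0 = c * (psi G0 g h i lam).1 0 /\ du i 0 = c * (psi G0 g h i lam).2 0.
  (* The value at [j] is a placeholder; that coordinate is set to 1 below. *)
  move=> i; have [->|ij] := eqVneq i j; first by exists 0.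
  have Hi : esol (vertex G0 i) (tip G0 i) (potential G0 i) lam (u i) (du i) (fun=> 0).
    have := Hu i; have -> : tip (Omega2 l V j s) i = l i by rewrite /= (negbTE ij).
    exact.
  have [c Hc] := edge_kernel len0 iV0 bnz Hi (tu i ij).
  by exists c => _; exact: (Hc 0 (lexx 0) (ltW (l_gt0 i))).
have : \det (colset (A2 lam) j (colv ((omega m lam).1 0) ((omega m lam).2 0))) = 0.
  apply/(det_colset0 _ _ d0); exists (\col_i (if i == j then 1 else c i)).
    by rewrite mxE eqxx.
  rewrite colE -[RHS]vu; congr (a1 *m _ + a2 *m _); apply/matrixP => i k; rewrite !mxE.
    have [->|ij] := eqVneq i j; first by rewrite mulr1 uj.
    by rewrite (Hc i ij).1 mulrC.
  have [->|ij] := eqVneq i j; first by rewrite mulr1 duj.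
  by rewrite (Hc i ij).2 mulrC.
rewrite D3E => /eqP; rewrite subr_eq0 => /eqP ->.
by rewrite mulfK.
Qed.

Lemma M12E lam : D1 lam != 0 -> D2 lam != 0 ->
  M1 l V g h j s lam + M2 l V a1 a2 g h j s lam = D0 lam / (D1 lam * D2 lam).
Proof.
move=> d1 d2; rewrite M1E// M2E// D0E.
have p0 : (psi1 lam).1 s != 0 by rewrite -D1E.
rewrite D1E mulrBl addrC; congr (_ + _).
  by rewrite -mulf_div divff// mul1r.
by rewrite mulNr; congr (- _); rewrite invfM mulrACA divff// mulr1.
Qed.

End Splitting.

(** * Orders of zeros and poles of the quotient *)

Section QuotientOrder.
Context {R : realType}.
Implicit Types (D E F : R[i] -> R[i]) (z w : R[i]).

Definition factored D z (m : nat) E : Prop :=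
  [/\ entire E, E z != 0 & forall w, D w = (w - z) ^+ m * E w].

Lemma factored_neq0 D z m E w : factored D z m E -> w != z -> E w != 0 -> D w != 0.
Proof.
by move=> [_ _ ->] wz Ew; rewrite mulf_neq0// expf_neq0// subr_eq0.
Qed.

Variables (D0 D1 D2 : R[i] -> R[i]).

(** All that the two one-sided maps prescribe: at the remaining points [F] is constrained by
    meromorphy alone. *)
Definition quotient_of F : Prop := forall w, D1 w != 0 -> D2 w != 0 ->
  F w = D0 w / (D1 w * D2 w).

Lemma factored_quotient z m0 m1 m2 E0 E1 E2 w :
  factored D0 z m0 E0 -> factored D1 z m1 E1 -> factored D2 z m2 E2 ->
  w != z -> D0 w / (D1 w * D2 w) =
    (w - z) ^ (m0%:Z - m1%:Z - m2%:Z) * (E0 w / (E1 w * E2 w)).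
Proof.
move=> [_ _ ->] [_ _ ->] [_ _ ->] wz; have x0 : w - z != 0 by rewrite subr_eq0.
rewrite !expfzDr// -!invr_expz -!exprnP.
by rewrite mulrACA [RHS]mulrA -mulf_div !invfM !mulrA; congr (_ * _); rewrite -!mulrA [E0 w * _]mulrC -!mulrA.
Qed.

Lemma factored_near z m0 m1 m2 E0 E1 E2 :
  factored D0 z m0 E0 -> factored D1 z m1 E1 -> factored D2 z m2 E2 ->
  \forall w \near (z : R[i]^o), E1 w != 0 /\ E2 w != 0.
Proof.
move=> _ [e1 n1 _] [e2 n2 _].
have h1 := entire_near_neq0 e1 n1; have h2 := entire_near_neq0 e2 n2.
by apply: filterS2 h1 h2 => w; split.
Qed.

Lemma derivableC_quotient E0 E1 E2 w : entire E0 -> entire E1 -> entire E2 ->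
  E1 w != 0 -> E2 w != 0 -> derivableC (fun w => E0 w / (E1 w * E2 w)) w.
Proof.
move=> e0 e1 e2 n1 n2; have h := @derivableCM R _ _ w (e1 w) (e2 w).
have h' := @derivableCV R (fun w => E1 w * E2 w) w (mulf_neq0 n1 n2) h.
exact: (@derivableCM R _ _ w (e0 w) h').
Qed.

(** The cofactors stay nonzero near [z], so a punctured neighbourhood lies where [F] is prescribed,
    and there the powers of [w - z] combine. *)
Lemma quotient_order F z m0 m1 m2 E0 E1 E2 : quotient_of F ->
  factored D0 z m0 E0 -> factored D1 z m1 E1 -> factored D2 z m2 E2 ->
  has_order F z (m0%:Z - m1%:Z - m2%:Z).
Proof.
move=> HF f0 f1 f2; have Hn := factored_near f0 f1 f2.
exists (fun w => E0 w / (E1 w * E2 w)); split.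
- have [e0 _ _] := f0; have [e1 _ _] := f1; have [e2 _ _] := f2.
  by apply: filterS Hn => w [n1 n2]; exact: derivableC_quotient.
- have [_ n0 _] := f0; have [_ n1 _] := f1; have [_ n2 _] := f2.
  by rewrite mulf_neq0// invr_neq0// mulf_neq0.
- rewrite /dnbhs near_withinE; apply: filterS Hn => w [n1 n2] wz.
  rewrite HF ?(factored_neq0 f1)// ?(factored_neq0 f2)//.
  exact: factored_quotient.
Qed.

(** The extension takes at [z] the value of the local expression centred at [z]. This fills
    removable singularities correctly, and the value it gives at a pole is arbitrary. *)
Lemma quotient_meromorphic :
  (forall z, exists m E, factored D0 z m E) ->
  (forall z, exists m E, factored D1 z m E) ->
  (forall z, exists m E, factored D2 z m E) ->
  exists2 F, meromorphic F & quotient_of F.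
Proof.
move=> /choice[m0 /choice[E0 H0]] /choice[m1 /choice[E1 H1]] /choice[m2 /choice[E2 H2]].
pose k z := (m0 z)%:Z - (m1 z)%:Z - (m2 z)%:Z.
pose Q z w := (w - z) ^ k z * (E0 z w / (E1 z w * E2 z w)).
pose F z := Q z z.
have HF : quotient_of F.
  move=> w n1 n2; rewrite /F /Q /k.
  have [_ _ e0] := H0 w; have [_ _ e1] := H1 w; have [_ _ e2] := H2 w.
  have m1w : m1 w = 0%N.
    move: n1; rewrite e1 subrr; case: (m1 w) => // m; rewrite expr0n/= mul0r eqxx//.
  have m2w : m2 w = 0%N.
    move: n2; rewrite e2 subrr; case: (m2 w) => // m; rewrite expr0n/= mul0r eqxx//.
  by rewrite m1w m2w !subr0 [D0 w]e0 [D1 w]e1 [D2 w]e2 m1w m2w !expr0 !mul1r -mulrA.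
exists F => // z; have [k0|k0] := ltP (k z) 0.
  by right; exists (k z) => //; exact: quotient_order.
left; have Hn := factored_near (H0 z) (H1 z) (H2 z).
have [K kK] : exists K : nat, k z = K by move: k0; case: (k z) => // K _; exists K.
have FQ : \forall w \near (z : R[i]^o), F w = Q z w.
  apply: filterS Hn => w [n1 n2]; have [->//|wz] := eqVneq w z.
  rewrite HF ?(factored_neq0 (H1 z))// ?(factored_neq0 (H2 z))//.
  exact: factored_quotient.
have QD : \forall w \near (z : R[i]^o), derivableC (Q z) w.
  apply: filterS Hn => w [n1 n2].
  rewrite /Q kK.
  have [e0 _ _] := H0 z; have [e1 _ _] := H1 z; have [e2 _ _] := H2 z.
  have h1 : entire (fun w => (w - z) ^+ K).
    elim: (K) => [|m IH]; first exact: entire_ext (@entire_cst R 1).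
    have h := @entireM R _ _ (@entireD R _ _ (@entire_id R) (@entire_cst R (- z))) IH.
    by apply: entire_ext h => w'; rewrite exprS.
  exact: (@derivableCM R _ _ w (h1 w) (derivableC_quotient e0 e1 e2 n1 n2)).
(* Derivability at [w] calls for [F = Q z] around [w] and not only at [w], hence the interior. *)
apply: filterS2 (nbhs_interior FQ) QD => w wF wQ.
apply: (near_eq_derivable _ wQ).
by apply: filterS wF => y ->.
Qed.

End QuotientOrder.

(** * Summation of multiplicities *)

Section Counting.
Context {R : realType}.
Variables (e0 e1 e2 : R -> nat) (lam : R).
Hypothesis fin0 : finite_set [set mu | mu <= lam /\ e0 mu != 0%N].
Hypothesis fin1 : finite_set [set mu | mu <= lam /\ e1 mu != 0%N].
Hypothesis fin2 : finite_set [set mu | mu <= lam /\ e2 mu != 0%N].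

Let k mu : int := (e0 mu)%:Z - (e1 mu)%:Z - (e2 mu)%:Z.
Let zer mu : nat := if 0 <= k mu then absz (k mu) else 0%N.
Let pol mu : nat := if k mu <= 0 then absz (k mu) else 0%N.
Let supp := [set mu | mu <= lam /\ e0 mu != 0%N] `|`
  ([set mu | mu <= lam /\ e1 mu != 0%N] `|` [set mu | mu <= lam /\ e2 mu != 0%N]).

Lemma supp_finite : finite_set supp.
Proof. by rewrite /supp !finite_setU. Qed.

(** The relation between orders and multiplicities freed of subtraction, so that it can be summed in
    [nat]. *)
Lemma zer_pol mu : (e0 mu + pol mu = e1 mu + e2 mu + zer mu)%N.
Proof. rewrite /zer /pol /k; case: ifP; case: ifP; lia. Qed.

Lemma supp0 mu : mu <= lam -> ~ supp mu -> [/\ e0 mu = 0, e1 mu = 0 & e2 mu = 0]%N.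
Proof.
move=> mul nS; split; apply/eqP/negPn/negP => h; apply: nS.
- by left.
- by right; left.
- by right; right.
Qed.

Lemma fsum_supp (f : R -> nat) : (forall mu, mu <= lam -> ~ supp mu -> f mu = 0%N) ->
  \sum_(mu \in [set mu | mu <= lam]) f mu = \sum_(mu \in supp) f mu.
Proof.
move=> f0; apply/esym/fsbig_widen.
  by move=> mu [[]|[[]|[]]].
by move=> mu [mul nS]; exact: f0.
Qed.

Lemma fin_zer : finite_set [set mu | mu <= lam /\ zer mu != 0%N].
Proof.
apply: sub_finite_set supp_finite => mu [mul z0]; apply: contrapT => /(supp0 mul)[h0 h1 h2].
by move: z0; rewrite /zer /k h0 h1 h2.
Qed.

Lemma fin_pol : finite_set [set mu | mu <= lam /\ pol mu != 0%N].
Proof.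
apply: sub_finite_set supp_finite => mu [mul z0]; apply: contrapT => /(supp0 mul)[h0 h1 h2].
by move: z0; rewrite /pol /k h0 h1 h2.
Qed.

Lemma count_identity :
  ((\sum_(mu \in [set mu | mu <= lam]) e0 mu)%R : nat)%:Z =
  ((\sum_(mu \in [set mu | mu <= lam]) e1 mu)%R : nat)%:Z +
  ((\sum_(mu \in [set mu | mu <= lam]) e2 mu)%R : nat)%:Z +
  (((\sum_(mu \in [set mu | mu <= lam]) zer mu)%R : nat)%:Z -
   ((\sum_(mu \in [set mu | mu <= lam]) pol mu)%R : nat)%:Z).
Proof.
rewrite !fsum_supp; try by move=> mu mul /(supp0 mul)[h0 h1 h2]; rewrite /zer /pol /k ?h0 ?h1 ?h2.
have : \sum_(mu \in supp) (e0 mu + pol mu) = \sum_(mu \in supp) (e1 mu + e2 mu + zer mu).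
  by apply: eq_fsbigr => mu _; exact: zer_pol.
have S (u v : R -> nat) : \sum_(mu \in supp) (u mu + v mu) =
    \sum_(mu \in supp) u mu + \sum_(mu \in supp) v mu.
  exact: fsbig_split supp_finite.
rewrite (S e0 pol) (S (fun mu => e1 mu + e2 mu)%N zer) (S e1 e2).
set a := \sum_(_ \in _) e0 _; set b := \sum_(_ \in _) pol _.
set c := \sum_(_ \in _) e1 _; set d := \sum_(_ \in _) e2 _; set e := \sum_(_ \in _) zer _.
(* The generic addition of [nat] is displayed as [addn] for [lia]. *)
change ((a + b)%N = (c + d + e)%N -> a%:Z = c%:Z + d%:Z + (e%:Z - b%:Z)).
lia.
Qed.

End Counting.

(** * Counting eigenvalues by the orders of the two-sided map *)

Theorem theorem1p7 (R : realType) (n : nat) (l : 'I_n -> R)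
    (V : 'I_n -> R -> R) (a1 a2 : 'M[R[i]]_n) (g h : 'rV[R[i]]_n)
    (j : 'I_n) (s : R)
    (l_gt0 : forall i, 0 < l i)
    (V_L1 : forall i, (@lebesgue_measure R).-integrable `]0, l i[%classic
                        (EFin \o V i))
    (Gamma_sa : self_adjoint_bc (Gamma a1 a2 g h))
    (s_gt0 : 0 < s) (s_lt : s < l j) :
  (exists F, two_sided_map l V a1 a2 g h j s F) /\
  forall F, two_sided_map l V a1 a2 g h j s F ->
  forall lam : R, exists NOmega N1 N2 Nzeros Npoles : nat,
    [/\ count_le (eigen_mult (Omega l V) (Gamma a1 a2 g h)) lam NOmega,
        count_le (eigen_mult (Omega1 l V j s) (Gamma1 g h j)) lam N1,
        count_le (eigen_mult (Omega2 l V j s) (Gamma2 a1 a2 g h j)) lam N2,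
        count_le (zero_mult F) lam Nzeros /\ count_le (pole_mult F) lam Npoles &
        NOmega%:Z = N1%:Z + N2%:Z + (Nzeros%:Z - Npoles%:Z)].
Proof.
have [rk rkb sa sab] := Gamma_sa; rewrite /= in rk rkb sa sab.
have bsa i : g 0 i * Num.conj (h 0 i) = h 0 i * Num.conj (g 0 i).
  have := congr1 (fun X : 'M[R[i]]_n => X i i) sab.
  by rewrite !tr_diag_mx !mul_diag_mx !mxE eqxx.
(* A row vanishing in both tip matrices would be selected by a unit vector, against full rank. *)
have bnz i : ~ (g 0 i = 0 /\ h 0 i = 0).
  move=> [g0 h0]; have rf : row_free (row_mx (diag_mx g) (diag_mx h)) by rewrite /row_free rkb.
  have : delta_mx 0 i *m row_mx (diag_mx g) (diag_mx h) =
      (0 : 'rV[R[i]]_n) *m row_mx (diag_mx g) (diag_mx h).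
    rewrite mul0mx mul_mx_row -!rowE -(row_mx0 _ 1 n n); congr row_mx;
    by apply/rowP => k; rewrite !mxE ?g0 ?h0 mul0rn.
  move=> /(row_free_inj rf) /(congr1 (fun X : 'rV[R[i]]_n => X 0 i)).
  by rewrite !mxE !eqxx => /eqP; rewrite oner_eq0.
have iV i : L1 0 (l i) (V i) := V_L1 i.
pose G0 := Omega l V; pose G1 := Omega1 l V j s; pose G2 := Omega2 l V j s.
(* Scalar matrices of size one are put in diagonal form, so that the results on star graphs apply to
   the interval. *)
have E1 : Gamma1 g h j = BoundaryCond 1%:M 0 (diag_mx (tip1 j g)) (diag_mx (tip1 j h)).
  by rewrite /Gamma1 /tip1 !diag_const_mx.
have E2 : Gamma2 a1 a2 g h j =
  BoundaryCond a1 a2 (diag_mx (tip2 j g 1)) (diag_mx (tip2 j h 0)) by [].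
have l0 := len0 V l_gt0; have l1 := @len1 R n l V j s s_lt.
have l2 := @len2 R n l V j s l_gt0 s_gt0.
have i0 := iV0 iV; have i1 := @iV1 R n l V j s iV s_gt0.
have i2 := @iV2 R n l V j s iV s_lt.
have r1 := @rk1 R; have s1 := @sa1 R; have b1 := @bsa1 R n g h j bsa.
have z1 := @bnz1 R n g h j bnz; have b2 := @bsa2 R n g h j bsa.
have z2 := @bnz2 R n g h j bnz.
pose D0 := charD G0 a1 a2 g h.
pose D1 := charD G1 1%:M 0 (tip1 j g) (tip1 j h).
pose D2 := charD G2 a1 a2 (tip2 j g 1) (tip2 j h 0).
pose e0 := mult G0 a1 a2 g h.
pose e1 := mult G1 1%:M 0 (tip1 j g) (tip1 j h).
pose e2 := mult G2 a1 a2 (tip2 j g 1) (tip2 j h 0).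
have f0 z : exists E, factored D0 z (e0 z) E.
  exact: (charD_order l0 i0 rk sa bsa bnz z).
have f1 z : exists E, factored D1 z (e1 z) E.
  exact: (charD_order l1 i1 (@rk1 R) s1 b1 z1 z).
have f2 z : exists E, factored D2 z (e2 z) E.
  exact: (charD_order l2 i2 rk sa b2 z2 z).
have n1 z : (D1 z != 0) = (e1 z == 0%N).
  exact: (charD_neq0 l1 i1 (@rk1 R) s1 b1 z1 z).
have n2 z : (D2 z != 0) = (e2 z == 0%N).
  exact: (charD_neq0 l2 i2 rk sa b2 z2 z).
have M12 z : D1 z != 0 -> D2 z != 0 ->
    M1 l V g h j s z + M2 l V a1 a2 g h j s z = D0 z / (D1 z * D2 z).
  by move=> d1 d2; apply: M12E.
split.
  have [F mF qF] := quotient_meromorphic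
    (fun z => ex_intro _ (e0 z) (f0 z)) (fun z => ex_intro _ (e1 z) (f1 z))
    (fun z => ex_intro _ (e2 z) (f2 z)).
  exists F; split=> // z; rewrite E1 E2 => res1 res2.
  have d1 : D1 z != 0 by rewrite n1; apply/eqP; exact: resolvent_mult0 res1.
  have d2 : D2 z != 0 by rewrite n2; apply/eqP; exact: resolvent_mult0 res2.
  by rewrite qF// M12.
move=> F [_ HF] lam.
(* Any admissible [F] is the quotient wherever [D1] and [D2] are nonzero, so its orders do not
   depend on the chosen extension. *)
have qF : quotient_of D0 D1 D2 F.
  move=> z d1 d2; rewrite -M12// HF//.
    by rewrite E1; apply: mult0_resolvent => //; apply/eqP; rewrite -n1.
  by rewrite E2; apply: mult0_resolvent => //; apply/eqP; rewrite -n2.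
pose k mu : int := (e0 mu%:C%C)%:Z - (e1 mu%:C%C)%:Z - (e2 mu%:C%C)%:Z.
have ordF mu : has_order F mu%:C%C (k mu).
  have [E0 F0] := f0 mu%:C%C; have [E1' F1] := f1 mu%:C%C; have [E2' F2] := f2 mu%:C%C.
  exact: (quotient_order qF F0 F1 F2).
have fin0 := mult_finite l0 i0 rk sa bsa bnz lam.
have fin1 := mult_finite l1 i1 (@rk1 R) s1 b1 z1 lam.
have fin2 := mult_finite l2 i2 rk sa b2 z2 lam.
pose zer mu : nat := if 0 <= k mu then absz (k mu) else 0%N.
pose pol mu : nat := if k mu <= 0 then absz (k mu) else 0%N.
exists (\sum_(mu \in [set mu | mu <= lam]) e0 mu%:C%C),
  (\sum_(mu \in [set mu | mu <= lam]) e1 mu%:C%C),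
  (\sum_(mu \in [set mu | mu <= lam]) e2 mu%:C%C),
  (\sum_(mu \in [set mu | mu <= lam]) zer mu),
  (\sum_(mu \in [set mu | mu <= lam]) pol mu); split.
- exists (fun mu => e0 mu%:C%C); split; [|exact: fin0|by []].
  by move=> mu _; exact: (eigen_multP a1 a2 l0 i0 bnz).
- exists (fun mu => e1 mu%:C%C); split; [|exact: fin1|by []].
  by move=> mu _; rewrite E1; exact: (eigen_multP 1%:M 0 l1 i1 z1).
- exists (fun mu => e2 mu%:C%C); split; [|exact: fin2|by []].
  by move=> mu _; rewrite E2; exact: (eigen_multP a1 a2 l2 i2 z2).
- split; [exists zer|exists pol]; split.
  + by move=> mu _; exists (k mu).
  + exact: (fin_zer fin0 fin1 fin2).
  + by [].
  + by move=> mu _; exists (k mu).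
  + exact: (fin_pol fin0 fin1 fin2).
  + by [].
- exact: (count_identity fin0 fin1 fin2).
Qed.
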